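(* Let $S=\begin{pmatrix}A&B\\C&D\end{pmatrix}\in\operatorname{Sp}(2n,\mathbb{R})$ with $\det B\ne0$. An entire function $g(z)$ on $\mathbb{C}^n$ is the linear canonical transform $g=\widehat f_S$ of a function $f$ with support in the ball $B_R=\{x\in\mathbb{R}^n:|x|\le R\}$ if and only if, for each $N\in\mathbb{N}$, there is a constant $C_N>0$ such that $$|g(z)|\le C_N\,\frac{e^{-2\pi\,\xi\cdot(DB^{-1})_+\eta+2\pi R|B^{-1}\eta|}}{(1+|z|)^N}$$ for all $z=\xi+i\eta\in\mathbb{C}^n$ ($\xi,\eta\in\mathbb{R}^n$).
   Context: $J=\begin{pmatrix}0&I_n\\-I_n&0\end{pmatrix}$, and $\operatorname{Sp}(2n,\mathbb{R})$ is the group of real $2n\times2n$ matrices $S$ with $S^TJS=J$; the blocks $A,B,C,D$ are $n\times n$. $(DB^{-1})_+=\frac12\left(DB^{-1}+(DB^{-1})^T\right)$ denotes the symmetric part of $DB^{-1}$. The linear canonical transform (LCT) of $f$ associated with $S$ is $$\widehat f_S(\xi)=\frac{1}{i^{n/2}\sqrt{\det B}}\int_{\mathbb{R}^n}f(x)\,e^{i\pi\left(\xi\cdot DB^{-1}\xi+x\cdot B^{-1}Ax\right)-2i\pi x\cdot B^{-1}\xi}\,dx,$$ defined for $f\in\mathcal{S}(\mathbb{R}^n)$ and extended to a unitary transformation of $L^2(\mathbb{R}^n)$ (the sign ambiguity in the square root is ignored). For compactly supported $f$ it is extended to complex arguments $z\in\mathbb{C}^n$ by replacing $\xi$ with $z$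 in this formula, where $z\cdot w=\sum_jz_jw_j$ (bilinear, no conjugation). $|z|$ is the Euclidean norm on $\mathbb{C}^n$.
   Formalization: The function f is required to be a Schwartz function (so smooth with support in the ball); for merely square-integrable f, such as the indicator function of the ball, the decay bound for every N fails. *)

(* Defs.v *)
From HB Require Import structures.
From mathcomp Require Import all_boot all_order all_algebra.
From mathcomp Require Import all_classical all_reals all_analysis.
From mathcomp Require Import complex.
Set Implicit Arguments.
Unset Strict Implicit.
Unset Printing Implicit Defensive.
Import Order.TTheory GRing.Theory Num.Theory.
Import numFieldNormedType.Exports.
Local Open Scope classical_set_scope.
Local Open Scope ring_scope.
Local Open Scope complex_scope.

(* The product measure on [T * n.-tuple T], transported to [n.+1.-tuple T]. *)
Section TupleCons.
Context d (T : measurableType d) (R : realType) (n : nat).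
Variables (m1 : {sigma_finite_measure set T -> \bar R}).
Variables (m2 : {sigma_finite_measure set (n.-tuple T) -> \bar R}).
Local Open Scope ereal_scope.

Definition tuple_cons (p : T * n.-tuple T) : n.+1.-tuple T :=
  [the n.+1.-tuple T of p.1 :: p.2].

Lemma measurable_tuple_cons : measurable_fun setT tuple_cons.
Proof.
apply: measurable_cons; [exact: measurable_fst|exact: measurable_snd].
Qed.

Definition cons_measure : set (n.+1.-tuple T) -> \bar R :=
  pushforward (m1 \x m2) tuple_cons.

Let mpre A : measurable A -> measurable (tuple_cons @^-1` A).
Proof.
by move=> mA; rewrite -[X in measurable X]setTI; exact: measurable_tuple_cons.
Qed.

Let cons_measure0 : cons_measure set0 = 0.
Proof. by rewrite /cons_measure /pushforward preimage_set0 measure0. Qed.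

Let cons_measure_ge0 A : 0 <= cons_measure A.
Proof. by rewrite /cons_measure /pushforward; exact: measure_ge0. Qed.

Let cons_measure_sigma_additive : semi_sigma_additive cons_measure.
Proof.
move=> F mF tF mUF; rewrite /cons_measure /pushforward preimage_bigcup.
apply: measure_semi_sigma_additive.
- by move=> k; exact: mpre.
- apply/trivIsetP => /= i j _ _ ij; rewrite -preimage_setI.
  by move/trivIsetP : tF => /(_ _ _ _ _ ij) ->//; rewrite preimage_set0.
- by rewrite -preimage_bigcup; exact: mpre.
Qed.

HB.instance Definition _ := isMeasure.Build _ _ _ cons_measure
  cons_measure0 cons_measure_ge0 cons_measure_sigma_additive.

Let cons_measure_sigma_finite : sigma_finite setT cons_measure.
Proof.
have [F FT Ffin] : sigma_finite setT (m1 \x m2).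
  have /sigma_finiteP[F [TF ndF Foo]] := sigma_finiteT m1.
  have /sigma_finiteP[G [TG ndG Goo]] := sigma_finiteT m2.
  exists (fun k => F k `*` G k).
    rewrite -setXTT TF TG predeqE => -[x y]; split.
      move=> [/= [k _ Fkx] [l _ Gly]]; exists (maxn k l) => //; split.
      - by move: x Fkx; exact/subsetPset/ndF/leq_maxl.
      - by move: y Gly; exact/subsetPset/ndG/leq_maxr.
    by move=> [k _ []/= ? ?]; split; exists k.
  move=> k; have [? ?] := Foo k; have [? ?] := Goo k.
  split; first exact: measurableX.
  by rewrite product_measure1E// lte_mul_pinfty// ge0_fin_numE.
pose u (t : n.+1.-tuple T) : T * n.-tuple T := (thead t, [tuple of behead t]).
have mu : measurable_fun setT u.
  apply: measurable_fun_pair; [exact: measurable_tnth|exact: measurable_behead].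
have uK : cancel tuple_cons u.
  by move=> [x t]; rewrite /u /tuple_cons; congr (_, _); exact/val_inj.
exists (fun k => u @^-1` F k).
  by rewrite -preimage_bigcup -FT preimage_setT.
move=> k; have [mF Fk] := Ffin k; split.
  by rewrite -[X in measurable X]setTI; exact: mu.
rewrite /cons_measure /pushforward -comp_preimage.
by rewrite (_ : u \o _ = id) //; apply/funext => x /=; rewrite uK.
Qed.

HB.instance Definition _ :=
  Measure_isSigmaFinite.Build _ _ _ cons_measure cons_measure_sigma_finite.

End TupleCons.

(* Lebesgue measure on R^n, carried by the Borel sets of [n.-tuple R]. *)
Fixpoint lebesgue_tuple (R : realType) (n : nat) :
    {sigma_finite_measure set (n.-tuple (measurableTypeR R)) -> \bar R} :=
  match n with
  | 0 => \d_ [tuple]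
  | n'.+1 => cons_measure (@lebesgue_measure R) (lebesgue_tuple R n')
  end.

Section Euclidean.
Variables (R : realType) (n : nat).

(* Bilinear: no conjugation when [K] is complex. *)
Definition dotv (K : comNzRingType) (z w : 'cV[K]_n) : K :=
  \sum_(j < n) z j 0 * w j 0.

(* The library norm on column vectors is the sup norm, not the Euclidean one. *)
Definition enorm (x : 'cV[R]_n) : R := Num.sqrt (\sum_(j < n) x j 0 ^+ 2).

Definition cenorm (z : 'cV[R[i]]_n) : R :=
  Num.sqrt (\sum_(j < n) (complex.Re (z j 0) ^+ 2 + complex.Im (z j 0) ^+ 2)).

Definition cvec (x : 'cV[R]_n) : 'cV[R[i]]_n := map_mx (real_complex R) x.

Definition supp (f : 'cV[R]_n -> R[i]) : set 'cV[R]_n :=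
  closure [set x | f x != 0].

Definition eball (r : R) : set 'cV[R]_n := [set x | enorm x <= r].

(* Frechet differentiability over the field R[i], at every point. *)
Definition entire (g : 'cV[R[i]]_n -> R[i]) : Prop :=
  forall z, differentiable (g : 'cV[R[i]]_n -> (R[i])^o) z.

Fixpoint partials (s : seq 'I_n) (h : 'cV[R]_n -> R) : 'cV[R]_n -> R :=
  if s is i :: s' then 'D_(delta_mx i 0) (partials s' h) else h.

Definition smooth (h : 'cV[R]_n -> R) : Prop :=
  forall s : seq 'I_n, continuous (partials s h) /\
    forall (i : 'I_n) x, derivable (partials s h) x (delta_mx i 0).

Definition real_schwartz (h : 'cV[R]_n -> R) : Prop :=
  smooth h /\
  forall (s : seq 'I_n) (N : nat), exists M : R,
    forall x, (1 + enorm x) ^+ N * `|partials s h x| <= M.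

(* A complex-valued function is Schwartz iff its real and imaginary parts are. *)
Definition schwartz (f : 'cV[R]_n -> R[i]) : Prop :=
  real_schwartz (fun x => complex.Re (f x)) /\
  real_schwartz (fun x => complex.Im (f x)).

Definition col_of_tuple (t : n.-tuple (measurableTypeR R)) : 'cV[R]_n :=
  \col_j tnth t j.

Definition integral_Rn (h : 'cV[R]_n -> R[i]) : R[i] :=
  Rintegral (lebesgue_tuple R n) setT
    (fun t => complex.Re (h (col_of_tuple t))) +i*
  Rintegral (lebesgue_tuple R n) setT
    (fun t => complex.Im (h (col_of_tuple t))).

End Euclidean.

Definition cexp (R : realType) (w : R[i]) : R[i] :=
  (expR (complex.Re w))%:C * (cos (complex.Im w) +i* sin (complex.Im w)).

Section LinearCanonicalTransform.
Variables (R : realType) (n : nat).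

Definition symplJ : 'M[R]_(n + n) := block_mx 0 1%:M (- 1%:M) 0.

Definition symplectic (S : 'M[R]_(n + n)) : Prop :=
  S^T *m symplJ *m S = symplJ.

Definition sympart (M : 'M[R]_n) : 'M[R]_n := 2^-1 *: (M + M^T).

(* [i^(n/2)] is the principal value [exp (i pi n / 4)]; [b] is a square root of
   [\det B], so that its two values account for the sign ambiguity. *)
Definition lct (S : 'M[R]_(n + n)) (b : R[i]) (f : 'cV[R]_n -> R[i])
    (z : 'cV[R[i]]_n) : R[i] :=
  let A := ulsubmx S in let B := ursubmx S in let D := drsubmx S in
  let toC := map_mx (real_complex R) in
  (cexp ('i%C * (pi * n%:R / 4)%:C) * b)^-1 *
  integral_Rn (fun x => f x *
    cexp ('i%C * pi%:C * (dotv z (toC (D *m invmx B) *m z)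
                        + dotv (cvec x) (toC (invmx B *m A) *m cvec x))
          - 2 * 'i%C * pi%:C * dotv (cvec x) (toC (invmx B) *m z))).

End LinearCanonicalTransform.

(* Main.v *)
Require Import Defs.
From mathcomp Require Import all_boot all_order all_algebra.
From mathcomp Require Import all_classical all_reals all_analysis.
From mathcomp Require Import complex measurable_realfun.
From mathcomp Require Import ring lra.
Import Order.TTheory GRing.Theory Num.Theory.
Import numFieldNormedType.Exports.
Set Implicit Arguments.
Unset Strict Implicit.
Unset Printing Implicit Defensive.
Local Open Scope classical_set_scope.
Local Open Scope ring_scope.
Local Open Scope complex_scope.

(** Write M for D B^-1 and Q for B^-1 A. The exponent of the kernel is a sum of
three terms, so that
<<
  lct f z = kappa^-1 * exp (i pi z.Mz) * F (B^-1 z),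
>>
where F is the Fourier-Laplace transform of h x = f x * exp (i pi x.Qx)
([lct_laplace]). The chirp exp (i pi x.Qx) is smooth and has no zero, hence h is
smooth with support in the ball exactly when f is; the imaginary part of z.Mz
for z = xi + i eta is 2 xi.M_+ eta, which gives the factor
exp (- 2 pi xi.M_+ eta) of the growth condition ([quadratic_modulus]); and |z|
and |B^-1 z| are comparable. What remains is the Paley-Wiener theorem for F:
smooth functions with support in the ball of radius r correspond to the entire
functions such that, for all N,
<<
  |F (xi + i eta)| <= C_N * exp (2 pi r |eta|) / (1 + |xi + i eta|)^N.
>>

From h to F: integrating by parts, 2 pi i w_j F(w) is the transform of the j-th
partial derivative of h ([laplace_pderiv]), and iterating this yields all the
powers of 1 + |w| ([laplace_decay]).

From F to h: let h x be the integral of F xi * exp (2 pi i x.xi) over R^n. Each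
differentiation multiplies the integrand by 2 pi i xi_j, which preserves rapid
decrease, so h is smooth ([inv_transform_csmooth]). Goursat's theorem for
rectangles ([contour0]) allows the integral to be taken over R^n + i eta
instead, one coordinate at a time ([strip_shift]); therefore
|h x| <= K * exp (2 pi (r |eta| - x.eta)) for every eta, and eta = t x / |x| with
t large shows that h x = 0 when |x| > r ([density_support]). The same shift says
that h x * exp (2 pi x.eta) is the inverse Fourier transform of xi |->
F (xi + i eta). The Fourier inversion theorem ([fourier_inversion], by Poisson
kernels) on each plane R^n + i eta then recovers F at all complex points from h
([density_inversion]).

All integrands are dominated by multiples of products of Cauchy kernels
1 / (1 + t^2); this provides their integrability, Fubini's theorem, and explicit
tails for the integrals over the line, which are evaluated by antiderivatives on
large intervals. *)

(** * Modulus and exponential of a complex number *)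

Section ComplexModulus.
Context {R : realType}.
Implicit Types (z w : R[i]) (a b : R).

(** The norm of [R[i]] takes values in [R[i]]; estimates are made in [R]. *)
Definition cabs z : R := ComplexField.Normc.normc z.

Lemma cabsE z : `|z| = (cabs z)%:C.
Proof. by []. Qed.

Lemma cabs_sqr z : cabs z ^+ 2 = complex.Re z ^+ 2 + complex.Im z ^+ 2.
Proof. by case: z => a b; rewrite /cabs /= sqr_sqrtr // addr_ge0 ?sqr_ge0. Qed.

Lemma cabs_ge0 z : 0 <= cabs z.
Proof. by case: z => a b; exact: sqrtr_ge0. Qed.

Lemma cabs0 : cabs 0 = 0.
Proof. exact: ComplexField.Normc.normc0. Qed.

Lemma cabs0_eq0 z : cabs z = 0 -> z = 0.
Proof. exact: ComplexField.Normc.eq0_normc. Qed.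

Lemma cabsM z w : cabs (z * w) = cabs z * cabs w.
Proof. exact: ComplexField.Normc.normcM. Qed.

Lemma cabsD z w : cabs (z + w) <= cabs z + cabs w.
Proof. exact: le_normcD. Qed.

Lemma cabsN z : cabs (- z) = cabs z.
Proof. exact: normcN. Qed.

Lemma cabsB z w : cabs (z - w) <= cabs z + cabs w.
Proof. by rewrite -(cabsN w); exact: cabsD. Qed.

Lemma cabsR a : cabs a%:C = `|a|.
Proof. by rewrite /cabs /= expr0n addr0 sqrtr_sqr. Qed.

Lemma cabs_imag a : cabs (0 +i* a) = `|a|.
Proof. by rewrite /cabs /= expr0n add0r sqrtr_sqr. Qed.

Lemma cabsV z : cabs z^-1 = (cabs z)^-1.
Proof. exact: ComplexField.Normc.normcV. Qed.

Lemma cabs_gt0 z : z != 0 -> 0 < cabs z.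
Proof.
by move=> z0; rewrite lt_neqAle cabs_ge0 andbT eq_sym; apply: contra z0 => /eqP/cabs0_eq0 ->.
Qed.

Lemma cabs_sum (I : Type) (s : seq I) (F : I -> R[i]) :
  cabs (\sum_(i <- s) F i) <= \sum_(i <- s) cabs (F i).
Proof.
elim/big_rec2 : _ => [|i x y _ le_yx]; first by rewrite cabs0.
by rewrite (le_trans (cabsD _ _)) // lerD2l.
Qed.

Lemma cabs_prod (I : Type) (s : seq I) (F : I -> R[i]) :
  cabs (\prod_(i <- s) F i) = \prod_(i <- s) cabs (F i).
Proof.
elim/big_rec2 : _ => [|i x y _ <-]; last by rewrite cabsM.
by rewrite (cabsR 1) normr1.
Qed.

Lemma norm_Re_le z : `|complex.Re z| <= cabs z.
Proof.
rewrite -(ler_pXn2r (ltn0Sn 1)) ?nnegrE ?cabs_ge0 // cabs_sqr real_normK ?num_real //.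
by rewrite lerDl sqr_ge0.
Qed.

Lemma norm_Im_le z : `|complex.Im z| <= cabs z.
Proof.
rewrite -(ler_pXn2r (ltn0Sn 1)) ?nnegrE ?cabs_ge0 // cabs_sqr real_normK ?num_real //.
by rewrite lerDr sqr_ge0.
Qed.

Lemma cabs_le_ReIm z : cabs z <= `|complex.Re z| + `|complex.Im z|.
Proof.
rewrite -(ler_pXn2r (ltn0Sn 1)) ?nnegrE ?cabs_ge0 ?addr_ge0 // cabs_sqr.
rewrite sqrrD !real_normK ?num_real //.
have := mulr_ge0 (normr_ge0 (complex.Re z)) (normr_ge0 (complex.Im z)); lra.
Qed.

Lemma Re_mul z w : complex.Re (z * w) =
  complex.Re z * complex.Re w - complex.Im z * complex.Im w.
Proof. by case: z; case: w. Qed.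

Lemma Im_mul z w : complex.Im (z * w) =
  complex.Re z * complex.Im w + complex.Im z * complex.Re w.
Proof. by case: z; case: w => //= a b c d; rewrite addrC. Qed.

Lemma Re_add z w : complex.Re (z + w) = complex.Re z + complex.Re w.
Proof. by case: z; case: w. Qed.
Lemma Im_add z w : complex.Im (z + w) = complex.Im z + complex.Im w.
Proof. by case: z; case: w. Qed.
Lemma Re_opp z : complex.Re (- z) = - complex.Re z.
Proof. by case: z. Qed.
Lemma Im_opp z : complex.Im (- z) = - complex.Im z.
Proof. by case: z. Qed.

Lemma Csum (I : Type) (s : seq I) (F : I -> R) :
  (\sum_(i <- s) F i)%:C = \sum_(i <- s) (F i)%:C.
Proof. exact: (rmorph_sum (real_complex R)). Qed.

(** All that the estimates below use of the real and the imaginary part, so that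
    one argument serves both. *)
Lemma ReIm_ind (P : (R[i] -> R) -> Prop) :
  (forall f : R[i] -> R, (forall z w, f (z - w) = f z - f w) ->
    (forall a z, f (a%:C * z) = a * f z) -> (forall z, `|f z| <= cabs z) -> P f) ->
  P (@complex.Re R) /\ P (@complex.Im R).
Proof.
move=> H; split; apply: H => [z w|a z|].
- by rewrite Re_add Re_opp.
- by rewrite Re_mul mul0r subr0.
- exact: norm_Re_le.
- by rewrite Im_add Im_opp.
- by rewrite Im_mul mul0r addr0.
- exact: norm_Im_le.
Qed.

Lemma complexP z w : complex.Re z = complex.Re w -> complex.Im z = complex.Im w ->
  z = w.
Proof. by case: z; case: w => /= ? ? ? ? -> ->. Qed.

Lemma le0_mul_eps a b : (forall e, 0 < e -> a <= b * e) -> a <= 0.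
Proof.
move=> H; apply/ler_addgt0Pr => e e0; rewrite add0r.
have b1 : 0 < `|b| + 1 by rewrite ltr_wpDl.
apply: (le_trans (H _ (divr_gt0 e0 b1))).
rewrite mulrCA; apply: ler_piMr; first exact: ltW.
by rewrite ler_pdivrMr // mul1r (le_trans (ler_norm _)) // lerDl.
Qed.

(** Collects several small errors, each a multiple of e, in a proof that a
    complex number vanishes. *)
Lemma cabs_le_eps z a : (forall e, 0 < e -> cabs z <= a * e) -> z = 0.
Proof.
move=> /le0_mul_eps z0; apply: cabs0_eq0; apply/eqP.
by rewrite eq_le z0 cabs_ge0.
Qed.

End ComplexModulus.

Section ComplexExponential.
Context {R : realType}.
Implicit Types (z w : R[i]) (a b : R).

Lemma Re_cexp w : complex.Re (cexp w) = expR (complex.Re w) * cos (complex.Im w).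
Proof. by rewrite /cexp /= mul0r subr0. Qed.

Lemma Im_cexp w : complex.Im (cexp w) = expR (complex.Re w) * sin (complex.Im w).
Proof. by rewrite /cexp /= mul0r addr0. Qed.

Lemma cexpD z w : cexp (z + w) = cexp z * cexp w.
Proof.
apply: complexP; [rewrite [RHS]Re_mul|rewrite [RHS]Im_mul];
  by rewrite !Re_cexp !Im_cexp Re_add Im_add expRD ?cosD ?sinD; ring.
Qed.

Lemma cexp0 : cexp 0 = 1 :> R[i].
Proof. by apply: complexP; rewrite ?Re_cexp ?Im_cexp /= expR0 mul1r ?cos0 ?sin0. Qed.

Lemma cabs_cexp w : cabs (cexp w) = expR (complex.Re w).
Proof.
apply/eqP; rewrite -(eqrXn2 (ltn0Sn 1)) ?cabs_ge0 ?expR_ge0 // cabs_sqr Re_cexp Im_cexp.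
by rewrite !exprMn -mulrDr cos2Dsin2 mulr1.
Qed.

Lemma cexp_real a : cexp a%:C = (expR a)%:C.
Proof. by apply: complexP; rewrite ?Re_cexp ?Im_cexp /= ?cos0 ?sin0 ?mulr1 ?mulr0. Qed.

Lemma cexp_neq0 w : cexp w != 0.
Proof.
apply/eqP => /(congr1 cabs); rewrite cabs_cexp cabs0 => /eqP.
by rewrite gt_eqF // expR_gt0.
Qed.

Lemma cexpN w : cexp (- w) = (cexp w)^-1.
Proof.
by apply: (mulIf (cexp_neq0 w)); rewrite -cexpD addNr cexp0 mulVf ?cexp_neq0.
Qed.

Lemma sin_norm_le a : `|sin a| <= `|a|.
Proof.
have key b : 0 < b -> `|sin b| <= b.
  move=> b0; have [|c /[!in_itv] /= cb] := @MVT R sin cos 0 b b0 (fun x _ => is_derive_sin x).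
    exact/continuous_subspaceT/continuous_sin.
  rewrite sin0 !subr0 => ->; rewrite normrM (gtr0_norm b0).
  by apply: ler_piMl; [exact: ltW|exact: cos_max].
have [a0|a0|->] := ltrgt0P a; last by rewrite sin0 normr0.
- exact: key.
- by rewrite -normrN -sinN key // oppr_gt0.
Qed.

Lemma cosB1_norm_le a : `|cos a - 1| <= `|a|.
Proof.
have key b : 0 < b -> `|cos b - 1| <= b.
  move=> b0; have [|c /[!in_itv] /= cb] :=
    @MVT R cos (fun x => - sin x) 0 b b0 (fun x _ => is_derive_cos x).
    exact/continuous_subspaceT/continuous_cos.
  rewrite cos0 !subr0 => ->; rewrite normrM (gtr0_norm b0) normrN.
  by apply: ler_piMl; [exact: ltW|exact: sin_max].
have [a0|a0|->] := ltrgt0P a; last by rewrite cos0 subrr normr0.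
- exact: key.
- by rewrite -cosN key // oppr_gt0.
Qed.

Lemma cosB1_norm_le_sqr a : `|cos a - 1| <= a ^+ 2.
Proof.
have key b : 0 < b -> `|cos b - 1| <= b ^+ 2.
  move=> b0; have [|c /[!in_itv] /= /andP[c0 cb]] :=
    @MVT R cos (fun x => - sin x) 0 b b0 (fun x _ => is_derive_cos x).
    exact/continuous_subspaceT/continuous_cos.
  rewrite cos0 !subr0 => ->; rewrite normrM (gtr0_norm b0) expr2 ler_pM2r // normrN.
  by rewrite (le_trans (sin_norm_le _)) // gtr0_norm // ltW.
have [a0|a0|->] := ltrgt0P a; last by rewrite cos0 subrr normr0 expr0n.
- exact: key.
- by rewrite -cosN -sqrrN key // oppr_gt0.
Qed.

Lemma sinB_norm_le_sqr a : `|sin a - a| <= a ^+ 2.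
Proof.
have key b : 0 < b -> `|sin b - b| <= b ^+ 2.
  move=> b0; have [|c /[!in_itv] /= /andP[c0 cb]] :=
    @MVT R (fun x => sin x - x) (fun x => cos x - 1) 0 b b0
      (fun x _ => is_deriveB (is_derive_sin x) (is_derive_id x 1)).
    by apply: continuous_subspaceT => x; apply: continuousB;
      [exact: continuous_sin|exact: cvg_id].
  rewrite sin0 !subr0 => ->; rewrite normrM (gtr0_norm b0) expr2 ler_pM2r //.
  by rewrite (le_trans (cosB1_norm_le _)) // gtr0_norm // ltW.
have [a0|a0|->] := ltrgt0P a; last by rewrite sin0 subrr normr0 expr0n.
- exact: key.
- by rewrite -sqrrN -normrN opprD -sinN key // oppr_gt0.
Qed.

(** Both bounds come from 1 + x <= expR x, the upper one at x = - a. *)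
Lemma expRB1_norm_le a : `|a| <= 2^-1 -> `|expR a - 1 - a| <= 2 * a ^+ 2.
Proof.
rewrite ler_norml => /andP[a1 a2].
have h1 := expR_ge1Dx a; have h2 := expR_ge1Dx (- a).
rewrite ler_norml; apply/andP; split; first by have := sqr_ge0 a; lra.
have e0 := expR_gt0 a.
have e1 : expR a * expR (- a) = 1 by rewrite expRN divff // gt_eqF.
have e2 : expR a * (1 - a) <= 1 by rewrite -[leRHS]e1 ler_pM2l.
suff : expR a - 1 - a <= 2 * (a ^+ 2) by [].
have e3 : (expR a - 1 - a) * (1 - a) <= a ^+ 2 by nra.
have e4 : 0 <= a ^+ 2 := sqr_ge0 a.
have e5 : (expR a - 1 - a) * 2^-1 <= (expR a - 1 - a) * (1 - a).
  by rewrite ler_wpM2l //; lra.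
lra.
Qed.

End ComplexExponential.

(** * Real and complex derivatives *)

Section DifferenceQuotients.
Context {R : realType}.

(** The expansion f (x + h v) = f x + h d + o(h) with explicit epsilons: having
    no quotient, it is easily restricted to lines and glued at a point. *)
Lemma is_deriveP (V : normedModType R) (f : V -> R) (x v : V) (d : R) :
  is_derive x v f d <->
  forall e, 0 < e -> exists2 r, 0 < r &
    forall h : R, `|h| < r -> `|f (x + h *: v) - f x - h * d| <= e * `|h|.
Proof.
split=> [[df dfE] e e0|H].
- have := df; rewrite /derivable => /cvg_ex[l fl].
  have ld : l = d by rewrite -dfE; exact/esym/cvg_lim.
  move: fl; rewrite ld => /cvgrPdist_le /(_ _ e0).
  rewrite near_withinE => /nbhs_ballP[r /= r0 Hr]; exists r => // h hr.
  have [->|h0] := eqVneq h 0.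
    by rewrite scale0r addr0 subrr mul0r subrr normr0 mulr0.
  have := Hr h; rewrite /ball /= sub0r normrN => /(_ hr h0) /=.
  rewrite -(ler_pM2r (_ : 0 < `|h|)) ?normr_gt0 // -normrM.
  suff -> : (d - h^-1 *: (f (h *: v + x) - f x)) * h =
    - (f (x + h *: v) - f x - h * d) by rewrite normrN.
  rewrite /GRing.scale /= [h *: v + x]addrC; by field.
- have fl : h^-1 *: ((f \o shift x) (h *: v) - f x) @[h --> 0^'] --> d.
    apply/cvgrPdist_le => eps eps0; have [r r0 Hr] := H eps eps0.
    rewrite near_withinE; apply/nbhs_ballP; exists r => //= h.
    rewrite /ball /= sub0r normrN => hr h0.
    rewrite -(ler_pM2r (_ : 0 < `|h|)) ?normr_gt0 // -normrM.
    have := Hr h hr.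
    suff -> : (d - h^-1 *: (f (h *: v + x) - f x)) * h =
      - (f (x + h *: v) - f x - h * d) by rewrite normrN.
    rewrite /GRing.scale /= [h *: v + x]addrC; by field.
  by split; [apply/cvg_ex; exists d|exact/cvg_lim].
Qed.

Lemma continuousP_eps (V : normedModType R) (f : V -> R) (x : V) :
  {for x, continuous f} <->
  forall e, 0 < e -> exists2 r, 0 < r & forall y, `|x - y| < r -> `|f x - f y| <= e.
Proof.
split=> [cf e e0|H].
- move/cvgrPdist_le : cf => /(_ _ e0) /nbhs_normP[r /= r0 Hr].
  by exists r => // y xy; exact: Hr.
- apply/cvgrPdist_le => e e0; have [r r0 Hr] := H e e0.
  by apply/nbhs_normP; exists r => //= y /Hr.
Qed.

End DifferenceQuotients.

Section ComplexDerivative.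
Context {R : realType}.
Implicit Types (G P : R[i] -> R[i]) (z c h : R[i]).

(** Complex differentiability at z, with the error measured by the real-valued
    modulus. *)
Definition cderiv G z c := forall e : R, 0 < e -> exists2 d : R, 0 < d &
  forall h, cabs h < d -> cabs (G (z + h) - G z - c * h) <= e * cabs h.

Definition holomorphic G := forall z, exists c, cderiv G z c.

Lemma cderiv_lip G z c : cderiv G z c -> exists2 d : R, 0 < d &
  forall h, cabs h < d -> cabs (G (z + h) - G z) <= (cabs c + 1) * cabs h.
Proof.
move=> /(_ 1 ltr01)[d d0 H]; exists d => // h hd.
have -> : G (z + h) - G z = (G (z + h) - G z - c * h) + c * h by ring.
rewrite (le_trans (cabsD _ _)) // cabsM mulrDl addrC lerD2l.
exact: H.
Qed.

Lemma cderivM G P z c d : cderiv G z c -> cderiv P z d ->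
  cderiv (fun w => G w * P w) z (c * P z + G z * d).
Proof.
move=> Gc Pd e e0.
have [r1 r10 H1] := cderiv_lip Gc.
pose A := cabs (P z) + cabs (G z) + (cabs c + 1) + 1.
have A0 : 0 < A by rewrite ltr_wpDl // !addr_ge0 ?cabs_ge0.
have [r2 r20 H2] := Gc (e / 3 / A) (divr_gt0 (divr_gt0 e0 (ltr0n _ 3)) A0).
have [r3 r30 H3] := Pd (e / 3 / A) (divr_gt0 (divr_gt0 e0 (ltr0n _ 3)) A0).
have [r4 r40 H4] := cderiv_lip Pd.
pose K := (cabs c + 1) * (cabs d + 1).
have K0 : 0 < K by rewrite mulr_gt0 // ltr_wpDl ?cabs_ge0.
have r50 : 0 < e / 3 / K by rewrite !divr_gt0.
exists (Num.min (Num.min r1 r2) (Num.min (Num.min r3 r4) (e / 3 / K))).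
  by rewrite !lt_min r10 r20 r30 r40 r50.
move=> h; rewrite !lt_min => /andP[/andP[h1 h2] /andP[/andP[h3 h4] h5]].
have -> : G (z + h) * P (z + h) - G z * P z - (c * P z + G z * d) * h =
  (G (z + h) - G z - c * h) * P z + G z * (P (z + h) - P z - d * h) +
  (G (z + h) - G z) * (P (z + h) - P z) by ring.
rewrite (le_trans (cabsD _ _)) // (le_trans (lerD (cabsD _ _) (lexx _))) // !cabsM.
have -> : e * cabs h = e / 3 * cabs h + e / 3 * cabs h + e / 3 * cabs h by field.
have eA : e / 3 / A * A = e / 3 by rewrite divfK ?gt_eqF.
have eA0 : 0 <= e / 3 / A by rewrite ltW // !divr_gt0.
have hh := cabs_ge0 h.
apply: lerD; first apply: lerD.
- apply: (@le_trans _ _ (e / 3 / A * cabs h * A)).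
    apply: ler_pM; rewrite ?cabs_ge0 ?H2 //.
    by rewrite /A; have := cabs_ge0 (P z); have := cabs_ge0 c; have := cabs_ge0 (G z); lra.
  by rewrite mulrAC eA.
- apply: (@le_trans _ _ (A * (e / 3 / A * cabs h))).
    apply: ler_pM; rewrite ?cabs_ge0 ?H3 //.
    by rewrite /A; have := cabs_ge0 (P z); have := cabs_ge0 c; have := cabs_ge0 (G z); lra.
  by rewrite mulrA [A * _]mulrC eA.
- apply: (@le_trans _ _ ((cabs c + 1) * cabs h * ((cabs d + 1) * cabs h))).
    by apply: ler_pM; rewrite ?cabs_ge0 ?H1 ?H4.
  rewrite mulrACA mulrA ler_wpM2r // -/K mulrC -ler_pdivlMr //.
  exact: ltW.
Qed.

(** Sum of the second-order remainders of expR, cos and sin, in the splitting of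
    exp (a + i b) - 1 - (a + i b) into its real and imaginary parts. *)
Lemma cabs_cexpB1_le h : cabs h <= 2^-1 -> cabs (cexp h - 1 - h) <= 6 * cabs h ^+ 2.
Proof.
move=> h1; have aL := norm_Re_le h; have bL := norm_Im_le h.
have a1 := le_trans aL h1.
apply: le_trans (cabs_le_ReIm _) _.
rewrite !Re_add !Re_opp !Im_add !Im_opp Re_cexp Im_cexp cabs_sqr.
have [-> ->] : complex.Re (1 : R[i]) = 1 /\ complex.Im (1 : R[i]) = 0 by [].
set a := complex.Re h in aL a1 *; set b := complex.Im h in bL *.
have E1 := expRB1_norm_le a1; have C1 := cosB1_norm_le_sqr b.
have S1 := sinB_norm_le_sqr b; have e0 := expR_gt0 a.
have e2 : expR a <= 2.
  move: E1; rewrite ler_norml => /andP[_].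
  move: a1; rewrite ler_norml => /andP[a2 a3].
  have : a ^+ 2 <= 4^-1 by nra.
  lra.
have R1 : `|expR a * cos b - 1 - a| <= 2 * b ^+ 2 + 2 * a ^+ 2.
  have -> : expR a * cos b - 1 - a = expR a * (cos b - 1) + (expR a - 1 - a) by ring.
  apply: le_trans (ler_normD _ _) _; apply: lerD => //.
  by rewrite normrM gtr0_norm // ler_pM // ltW.
have I1 : `|expR a * sin b - 0 - b| <= 2 * b ^+ 2 + 2 * (`|a| * `|b|).
  have -> : expR a * sin b - 0 - b = expR a * (sin b - b) + (expR a - 1) * b by ring.
  apply: le_trans (ler_normD _ _) _; apply: lerD.
    by rewrite normrM gtr0_norm // ler_pM // ltW.
  rewrite normrM mulrA ler_wpM2r //.
  have -> : expR a - 1 = expR a - 1 - a + a by ring.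
  apply: le_trans (ler_normD _ _) _.
  rewrite -(real_normK (num_real a)) in E1.
  have := normr_ge0 a; nra.
apply: le_trans (lerD R1 I1) _.
rewrite -(real_normK (num_real a)) -(real_normK (num_real b)).
have := sqr_ge0 (`|a| - `|b|); have := sqr_ge0 a; nra.
Qed.

Lemma cderiv_cexp P z c : cderiv P z c ->
  cderiv (fun w => cexp (P w)) z (cexp (P z) * c).
Proof.
move=> Pc e e0.
have [r1 r10 H1] := cderiv_lip Pc.
pose A := cabs (cexp (P z)); have A0 : 0 < A by rewrite /A cabs_cexp expR_gt0.
have eA : 0 < e / 2 / A by rewrite !divr_gt0.
have [r2 r20 H2] := Pc _ eA.
pose K := cabs c + 1; have K0 : 0 < K by rewrite ltr_wpDl ?cabs_ge0.
have r30 : 0 < 2^-1 / K by rewrite !divr_gt0.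
have K6 : 0 < 6 * K ^+ 2 by apply: mulr_gt0 => //; exact: exprn_gt0.
have r40 : 0 < e / 2 / A / (6 * K ^+ 2) by exact: divr_gt0.
exists (Num.min (Num.min r1 r2) (Num.min (2^-1 / K) (e / 2 / A / (6 * K ^+ 2)))).
  by rewrite !lt_min r10 r20 r30 r40.
move=> h; rewrite !lt_min => /andP[/andP[h1 h2] /andP[h3 h4]].
set k := P (z + h) - P z.
have kK : cabs k <= K * cabs h by exact: H1.
have -> : P (z + h) = P z + k by rewrite /k; ring.
rewrite cexpD.
have -> : cexp (P z) * cexp k - cexp (P z) - cexp (P z) * c * h =
  cexp (P z) * ((cexp k - 1 - k) + (k - c * h)) by ring.
rewrite cabsM -/A mulrC -ler_pdivlMr //.
apply: le_trans (cabsD _ _) _.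
have -> : e * cabs h / A = e / 2 / A * cabs h + e / 2 / A * cabs h by field; rewrite gt_eqF.
apply: lerD; last exact: H2.
have k1 : cabs k <= 2^-1.
  by apply: le_trans kK _; rewrite mulrC -ler_pdivlMr // ltW.
apply: le_trans (cabs_cexpB1_le k1) _.
apply: (@le_trans _ _ (6 * (K * cabs h) ^+ 2)).
  by rewrite ler_pM2l // ler_pXn2r // nnegrE ?cabs_ge0 // mulr_ge0 ?cabs_ge0 // ltW.
rewrite exprMn mulrA [X in _ * X]expr2 mulrA ler_wpM2r ?cabs_ge0 // mulrC.
by rewrite -ler_pdivlMr // ltW.
Qed.

(** Quadratic polynomials are the primitives of the affine maps in Goursat's
    argument, and the exponents of the chirps along a complex line. *)
Lemma cderiv_quadratic (a b c z : R[i]) :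
  cderiv (fun w => a * w ^+ 2 + b * w + c) z (2 * a * z + b).
Proof.
move=> e e0; pose K := cabs a + 1; have K0 : 0 < K by rewrite ltr_wpDl ?cabs_ge0.
exists (e / K) => [|h hd]; first exact: divr_gt0.
have -> : a * (z + h) ^+ 2 + b * (z + h) + c - (a * z ^+ 2 + b * z + c) -
  (2 * a * z + b) * h = a * h * h by ring.
rewrite !cabsM ler_wpM2r ?cabs_ge0 // mulrC.
move: hd; rewrite ltr_pdivlMr // => /ltW; apply: le_trans.
by rewrite ler_wpM2l ?cabs_ge0 // /K lerDl.
Qed.

Definition rderiv (K : R -> R[i]) (x : R) (k : R[i]) :=
  is_derive x 1 (fun x => complex.Re (K x)) (complex.Re k) /\
  is_derive x 1 (fun x => complex.Im (K x)) (complex.Im k).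

Lemma cderiv_rderiv P z v c (s : R) : cderiv P (z + s%:C * v) c ->
  rderiv (fun s => P (z + s%:C * v)) s (c * v).
Proof.
move=> Pc; apply: (ReIm_ind (P := fun f =>
  is_derive s 1 (fun s => f (P (z + s%:C * v))) (f (c * v)))) => f fD fZ fle.
apply/is_deriveP => e e0.
pose A := cabs v + 1; have A0 : 0 < A by rewrite ltr_wpDl ?cabs_ge0.
have [r r0 H] := Pc _ (divr_gt0 e0 A0).
exists (r / A); first exact: divr_gt0.
move=> h hr; rewrite -fZ -!fD /GRing.scale /= mulr1.
have -> : z + (s + h)%:C * v = z + s%:C * v + h%:C * v.
  by rewrite (rmorphD (real_complex R)); ring.
rewrite mulrCA; apply: le_trans (fle _) _.
apply: le_trans (H _ _) _.
  rewrite cabsM cabsR; move: hr; rewrite ltr_pdivlMr //; apply: le_lt_trans.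
  by rewrite ler_wpM2l // /A lerDl.
rewrite cabsM cabsR mulrCA [leRHS]mulrC ler_wpM2l // mulrAC.
by rewrite ler_pdivrMr // ler_pM2l // /A lerDl.
Qed.

Lemma cderiv_horizontal P (x y : R) c : cderiv P (x +i* y) c ->
  rderiv (fun x => P (x +i* y)) x c.
Proof.
move=> Pc; have E (t : R) : t +i* y = 'i%C * y%:C + t%:C * 1.
  by apply: complexP; rewrite !(Re_add, Im_add, Re_mul, Im_mul) /=; ring.
have := @cderiv_rderiv P ('i%C * y%:C) 1 c x; rewrite [c * 1]mulr1 -E => /(_ Pc).
by rewrite (_ : (fun x => P (x +i* y)) = fun s => P ('i%C * y%:C + s%:C * 1));
  last by apply/funext => s; rewrite E.
Qed.

Lemma cderiv_vertical P (x y : R) c : cderiv P (x +i* y) c ->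
  rderiv (fun y => P (x +i* y)) y (c * 'i%C).
Proof.
move=> Pc; have E (t : R) : x +i* t = x%:C + t%:C * 'i%C.
  by apply: complexP; rewrite !(Re_add, Im_add, Re_mul, Im_mul) /=; ring.
have := @cderiv_rderiv P x%:C 'i%C c y; rewrite -E => /(_ Pc).
by rewrite (_ : (fun y => P (x +i* y)) = fun s => P (x%:C + s%:C * 'i%C));
  last by apply/funext => s; rewrite E.
Qed.

Lemma rderiv_continuous (K : R -> R[i]) (x : R) k : rderiv K x k ->
  {for x, continuous (fun x => complex.Re (K x))} /\
  {for x, continuous (fun x => complex.Im (K x))}.
Proof.
by move=> [[d1 _] [d2 _]]; split;
  apply: differentiable_continuous; exact/derivable1_diffP.
Qed.

Lemma rderivB (K L : R -> R[i]) (x : R) k l : rderiv K x k -> rderiv L x l ->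
  rderiv (fun x => K x - L x) x (k - l).
Proof.
move=> [K1 K2] [L1 L2]; split.
- rewrite Re_add Re_opp; have := is_deriveB K1 L1.
  by congr is_derive; apply/funext => t /=; rewrite !fctE Re_add Re_opp.
- rewrite Im_add Im_opp; have := is_deriveB K2 L2.
  by congr is_derive; apply/funext => t /=; rewrite !fctE Im_add Im_opp.
Qed.

(** There is no mean value equality for complex-valued functions; applying it to
    the real and the imaginary parts costs the factor 2. *)
Lemma mean_value_bound (K : R -> R[i]) (k : R -> R[i]) (M a b : R) : a <= b ->
  (forall x, a <= x <= b -> rderiv K x (k x) /\ cabs (k x) <= M) ->
  cabs (K b - K a) <= 2 * M * (b - a).
Proof.
rewrite le_eqVlt => /predU1P[-> _|ab H]; first by rewrite !subrr cabs0 mulr0.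
have key (f f' : R -> R) : (forall x, a <= x <= b -> is_derive x 1 f (f' x)) ->
    (forall x, a <= x <= b -> `|f' x| <= M) -> `|f b - f a| <= M * (b - a).
  move=> df bf; have [x /[!in_itv] /= /andP[x1 x2]||x /[!in_itv] /= /andP[x1 x2] ->] :=
      @MVT R f f' a b ab.
  - by apply: df; rewrite !ltW.
  - apply: derivable_within_continuous => x /[!in_itv] /= xab.
    exact: (@ex_derive _ _ _ _ _ _ _ (df _ xab)).
  - rewrite normrM (gtr0_norm (_ : 0 < b - a)) ?subr_gt0 //.
    apply: ler_wpM2r; first by rewrite subr_ge0 ltW.
    by apply: bf; rewrite !ltW.
apply: le_trans (cabs_le_ReIm _) _; rewrite Re_add Re_opp Im_add Im_opp.
have -> : 2 * M * (b - a) = M * (b - a) + M * (b - a) by ring.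
apply: lerD.
- apply: (key (fun x => complex.Re (K x)) (fun x => complex.Re (k x))) => x /H [[]] // _ _.
  exact/le_trans/norm_Re_le.
- apply: (key (fun x => complex.Im (K x)) (fun x => complex.Im (k x))) => x /H [[]] // _ _.
  exact/le_trans/norm_Im_le.
Qed.

(** The integral from a is differentiable on the right of a only; a is to be
    chosen on the left of the interval where a primitive is wanted. *)
Lemma exists_primitive (u : R -> R) (a : R) : continuous u ->
  exists U : R -> R, forall x, a < x -> is_derive x 1 U (u x).
Proof.
move=> cu; exists (fun x => \int[lebesgue_measure]_(t in `[a, x]) u t) => x ax.
have xu : x < x + 1 by rewrite ltrDl.
have [|D E] := @continuous_FTC1_closed R u a x (x + 1) xu _ ax (cu x).
  apply: continuous_compact_integrable; first exact: segment_compact.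
  exact: continuous_subspaceT.
by split; [exact: D|rewrite -E derive1E].
Qed.

Lemma exists_cprimitive (u : R -> R[i]) (a : R) :
  continuous (fun x => complex.Re (u x)) -> continuous (fun x => complex.Im (u x)) ->
  exists U : R -> R[i], forall x, a < x -> rderiv U x (u x).
Proof.
move=> /(exists_primitive a)[U HU] /(exists_primitive a)[V HV].
by exists (fun x => U x +i* V x) => x ax; split; [exact: HU|exact: HV].
Qed.

End ComplexDerivative.

(** * Goursat's theorem for a rectangle *)

Section NestedIntervals.
Context {R : realType}.
Implicit Types (I : R * R).

Definition half_itv (b : bool) I : R * R :=
  if b then ((I.1 + I.2) / 2, I.2) else (I.1, (I.1 + I.2) / 2).

Lemma half_itv_sub b I : I.1 <= I.2 ->
  [/\ I.1 <= (half_itv b I).1, (half_itv b I).1 <= (half_itv b I).2, (half_itv b I).2 <= I.2 &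
      (half_itv b I).2 - (half_itv b I).1 = (I.2 - I.1) / 2].
Proof. by case: I => a c /= ac; case: b; split => /=; lra. Qed.

(** The sequence b of choices is arbitrary: in Goursat's argument it is dictated
    by the size of the contour integrals. *)
Lemma nested_halves (b : nat -> bool) (I : nat -> R * R) :
  (I 0%N).1 <= (I 0%N).2 -> (forall k, I k.+1 = half_itv (b k) (I k)) ->
  (exists a, forall k, (I k).1 <= a <= (I k).2) /\
  (forall k, (I k).2 - (I k).1 = ((I 0%N).2 - (I 0%N).1) / 2 ^+ k /\
     (I 0%N).1 <= (I k).1).
Proof.
move=> I0 IS.
have le k : (I k).1 <= (I k).2.
  by elim: k => // k IH; rewrite IS; have [] := half_itv_sub (b k) IH.
have sub k m : (I k).1 <= (I (k + m)%N).1 /\ (I (k + m)%N).2 <= (I k).2.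
  elim: m => [|m [IH1 IH2]]; first by rewrite addn0.
  rewrite addnS IS; have [h1 _ h2 _] := half_itv_sub (b (k + m)%N) (le (k + m)%N).
  by split; [exact: le_trans h1|exact: le_trans IH2].
have cross k m : (I k).1 <= (I m).2.
  have [_ h2] := sub m k; have [h1 _] := sub k m.
  by apply: le_trans h1 _; apply: le_trans (le _) _; rewrite addnC.
split; last first.
  move=> k; split; last by have [] := sub 0%N k.
  elim: k => [|k IH]; first by rewrite expr0 divr1.
  rewrite IS; have [_ _ _ ->] := half_itv_sub (b k) (le k).
  by rewrite IH exprS invfM; ring.
exists (sup (range (fun k => (I k).1))) => k; apply/andP; split.
  apply: ub_le_sup; last by exists k.
  by exists (I 0%N).2 => _ [m _ <-].
by apply: ge_sup; [exists (I 0%N).1; exists 0%N|move=> _ [m _ <-]].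
Qed.

End NestedIntervals.

Section Goursat.
Context {R : realType}.
Variables (G : R[i] -> R[i]) (H V : R -> R -> R[i]) (a0 : R).
Hypothesis Ghol : holomorphic G.
Hypothesis HG : forall y x, a0 < x -> rderiv (H y) x (G (x +i* y)).
Hypothesis VG : forall x y, a0 < y -> rderiv (V x) y (G (x +i* y) * 'i%C).

(** The integral of G around the rectangle I x J, expressed by primitives H y of
    G along horizontal lines and V x of 'i G along vertical lines; its
    additivity under subdivision becomes an identity between differences. *)
Definition contour (I J : R * R) : R[i] :=
  (H J.1 I.2 - H J.1 I.1) - (H J.2 I.2 - H J.2 I.1) +
  (V I.2 J.2 - V I.2 J.1) - (V I.1 J.2 - V I.1 J.1).

Lemma contour_halves I J : contour I J =
  contour (half_itv false I) (half_itv false J) +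
  contour (half_itv true I) (half_itv false J) +
  contour (half_itv false I) (half_itv true J) +
  contour (half_itv true I) (half_itv true J).
Proof. by case: I => x1 x2; case: J => y1 y2; rewrite /contour /=; ring. Qed.

Lemma contour_quarter I J : exists b : bool * bool,
  cabs (contour I J) <= 4 * cabs (contour (half_itv b.1 I) (half_itv b.2 J)).
Proof.
apply: contrapT => /forallNP no.
pose c b1 b2 := contour (half_itv b1 I) (half_itv b2 J).
have lt b1 b2 : 4 * cabs (c b1 b2) < cabs (contour I J).
  by rewrite ltNge; apply/negP => h; apply: (no (b1, b2)).
have := cabsD (c false false + c true false + c false true) (c true true).
rewrite -contour_halves.
have := cabsD (c false false + c true false) (c false true).
have := cabsD (c false false) (c true false).
have := lt false false; have := lt false true; have := lt true false.
have := lt true true.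
lra.
Qed.

(** Near the point a + i b, G is an affine map up to eps times the distance.
    Subtracting the primitive of this affine map from all the H y and V x does
    not change the contour integral, and the mean value bound applies to each
    side of what is left. *)
Lemma contour_local (a b eps : R) : 0 < eps -> exists2 d, 0 < d &
  forall I J : R * R, a0 < I.1 -> a0 < J.1 -> I.1 <= a <= I.2 -> J.1 <= b <= J.2 ->
    (I.2 - I.1) + (J.2 - J.1) < d ->
    cabs (contour I J) <= 4 * eps * ((I.2 - I.1) + (J.2 - J.1)) ^+ 2.
Proof.
move=> eps0; have [c /(_ _ eps0)[d d0 Hd]] := Ghol (a +i* b).
exists d => // -[x1 x2] [y1 y2] /= x1a y1a /andP[ax1 ax2] /andP[by1 by2].
set D := _ + _ => Dd.
pose z0 : R[i] := a +i* b; pose A (w : R[i]) : R[i] := G z0 + c * (w - z0).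
pose P (w : R[i]) : R[i] := c / 2 * w ^+ 2 + (G z0 - c * z0) * w + 0.
have dP w : cderiv P w (A w).
  have := @cderiv_quadratic R (c / 2) (G z0 - c * z0) 0 w.
  suff -> : 2 * (c / 2) * w + (G z0 - c * z0) = A w by [].
  by rewrite /A; field.
have near x y : x1 <= x <= x2 -> y1 <= y <= y2 ->
    cabs (G (x +i* y) - A (x +i* y)) <= eps * D.
  move=> /andP[xx1 xx2] /andP[yy1 yy2].
  have wD : cabs ((x +i* y) - z0) <= D.
    apply: le_trans (cabs_le_ReIm _) _; rewrite /= /D; apply: lerD;
      rewrite ler_norml; apply/andP; split; lra.
  have := Hd _ (le_lt_trans wD Dd); rewrite -/z0.
  have -> : z0 + (x +i* y - z0) = x +i* y by ring.
  rewrite /A opprD addrA => /le_trans; apply.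
  by rewrite ler_wpM2l // ltW.
have hb y : y1 <= y <= y2 ->
    cabs ((H y x2 - P (x2 +i* y)) - (H y x1 - P (x1 +i* y))) <= 2 * (eps * D) * (x2 - x1).
  move=> yy; apply: (@mean_value_bound _ (fun x => H y x - P (x +i* y))
    (fun x => G (x +i* y) - A (x +i* y))); first lra.
  move=> x xx; split; last exact: near.
  apply: rderivB; first by apply: HG; lra.
  exact/cderiv_horizontal/dP.
have vb x : x1 <= x <= x2 ->
    cabs ((V x y2 - P (x +i* y2)) - (V x y1 - P (x +i* y1))) <= 2 * (eps * D) * (y2 - y1).
  move=> xx; apply: (@mean_value_bound _ (fun y => V x y - P (x +i* y))
    (fun y => G (x +i* y) * 'i%C - A (x +i* y) * 'i%C)); first lra.
  move=> y yy; split; last first.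
    rewrite -mulrBl cabsM cabs_imag normr1 mulr1; exact: near.
  apply: rderivB; first by apply: VG; lra.
  exact/cderiv_vertical/dP.
have x12 : x1 <= x2 := le_trans ax1 ax2.
have y12 : y1 <= y2 := le_trans by1 by2.
have -> : contour (x1, x2) (y1, y2) =
  ((H y1 x2 - P (x2 +i* y1)) - (H y1 x1 - P (x1 +i* y1))) -
  ((H y2 x2 - P (x2 +i* y2)) - (H y2 x1 - P (x1 +i* y2))) +
  ((V x2 y2 - P (x2 +i* y2)) - (V x2 y1 - P (x2 +i* y1))) -
  ((V x1 y2 - P (x1 +i* y2)) - (V x1 y1 - P (x1 +i* y1))).
  by rewrite /contour /=; ring.
apply: le_trans (cabsB _ _) _.
have hb1 := hb y1 (introT andP (conj (lexx _) y12)).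
have hb2 := hb y2 (introT andP (conj y12 (lexx _))).
have vb1 := vb x1 (introT andP (conj (lexx _) x12)).
have vb2 := vb x2 (introT andP (conj x12 (lexx _))).
apply: le_trans (lerD (cabsD _ _) vb1) _.
apply: le_trans (lerD (lerD (cabsB _ _) vb2) (lexx _)) _.
apply: le_trans (lerD (lerD (lerD hb1 hb2) (lexx _)) (lexx _)) _.
by rewrite /D expr2; lra.
Qed.

(** Quartering repeatedly, there is a k-th rectangle with a contour integral of
    modulus at least 4^-k times the original one, while [contour_local], at the
    common point of these rectangles, makes it O(eps 4^-k). *)
Theorem contour0 I J : a0 < I.1 -> a0 < J.1 -> I.1 <= I.2 -> J.1 <= J.2 ->
  contour I J = 0.
Proof.
move=> aI aJ I12 J12.
have [f Hf] := choice (fun q : (R * R) * (R * R) => contour_quarter q.1 q.2).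
pose step (q : (R * R) * (R * R)) := (half_itv (f q).1 q.1, half_itv (f q).2 q.2).
pose q k := iter k step (I, J).
have [[a Ha] wI] := @nested_halves R (fun k => (f (q k)).1) (fun k => (q k).1) I12
  (fun k => erefl).
have [[b Hb] wJ] := @nested_halves R (fun k => (f (q k)).2) (fun k => (q k).2) J12
  (fun k => erefl).
have big k : cabs (contour I J) <= 4 ^+ k * cabs (contour (q k).1 (q k).2).
  elim: k => [|k IH]; first by rewrite expr0 mul1r.
  apply: le_trans IH _; rewrite exprSr -mulrA ler_wpM2l ?exprn_ge0 //.
pose D := (I.2 - I.1) + (J.2 - J.1).
have D0 : 0 <= D by rewrite /D; lra.
apply: (@cabs_le_eps _ _ (4 * D ^+ 2)) => eps eps0.
have [d d0 Hd] := contour_local a b eps0.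
pose k := Num.bound (D / d).
have p0 : 0 < 2 ^+ k :> R by rewrite exprn_gt0.
have kd : D / 2 ^+ k < d.
  rewrite ltr_pdivrMr // mulrC -ltr_pdivrMr //.
  apply: lt_le_trans (archi_boundP _) _; first by rewrite divr_ge0 // ltW.
  by rewrite -natrX ler_nat ltnW // ltn_expl.
have [wIk aIk] := wI k; have [wJk aJk] := wJ k.
have wk : ((q k).1.2 - (q k).1.1) + ((q k).2.2 - (q k).2.1) = D / 2 ^+ k.
  by rewrite wIk wJk -mulrDl.
have := Hd (q k).1 (q k).2 (lt_le_trans aI aIk) (lt_le_trans aJ aJk) (Ha k) (Hb k).
rewrite wk => /(_ kd) le.
apply: le_trans (big k) _.
apply: (@le_trans _ _ (4 ^+ k * (4 * eps * (D / 2 ^+ k) ^+ 2))).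
  by rewrite ler_wpM2l // exprn_ge0.
rewrite exprMn exprVn -exprM mulnC exprM (_ : 2 ^+ 2 = 4 :> R); last by ring.
rewrite le_eqVlt; apply/orP; left; apply/eqP; field.
by rewrite expf_eq0 /= pnatr_eq0.
Qed.

End Goursat.

(** * Integrals of complex-valued functions *)

Section ComplexMeasurability.
Context {R : realType} d (T : measurableType d).
Implicit Types (h : T -> R[i]).

Definition cmeas h := measurable_fun setT (fun t => complex.Re (h t)) /\
  measurable_fun setT (fun t => complex.Im (h t)).

Lemma cmeas_cst (c : R[i]) : cmeas (fun _ => c).
Proof. by split; exact: measurable_cst. Qed.

Lemma cmeas_real (f : T -> R) : measurable_fun setT f -> cmeas (fun t => (f t)%:C).
Proof. by split => //; exact: measurable_cst. Qed.

Lemma cmeasD h1 h2 : cmeas h1 -> cmeas h2 -> cmeas (fun t => h1 t + h2 t).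
Proof.
move=> [a1 b1] [a2 b2]; split.
  by under eq_fun do rewrite Re_add; exact: measurable_funD.
by under eq_fun do rewrite Im_add; exact: measurable_funD.
Qed.

Lemma cmeasM h1 h2 : cmeas h1 -> cmeas h2 -> cmeas (fun t => h1 t * h2 t).
Proof.
move=> [a1 b1] [a2 b2]; split.
  under eq_fun do rewrite Re_mul.
  by apply: measurable_funB; exact: measurable_funM.
under eq_fun do rewrite Im_mul.
by apply: measurable_funD; exact: measurable_funM.
Qed.

Lemma cmeasN h : cmeas h -> cmeas (fun t => - h t).
Proof.
move=> mh; rewrite (_ : (fun _ => _) = fun t => (-1) * h t).
  exact: cmeasM (cmeas_cst _) mh.
by apply/funext => t; rewrite mulN1r.
Qed.

Lemma cmeasB h1 h2 : cmeas h1 -> cmeas h2 -> cmeas (fun t => h1 t - h2 t).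
Proof. by move=> m1 m2; apply: cmeasD => //; exact: cmeasN. Qed.

Lemma cmeas_cexp h : cmeas h -> cmeas (fun t => cexp (h t)).
Proof.
move=> [a b]; have mE : measurable_fun setT (fun t => expR (complex.Re (h t))).
  exact: measurableT_comp.
split.
- under eq_fun do rewrite Re_cexp; apply: measurable_funM => //.
  apply: (measurableT_comp _ b); apply: continuous_measurable_fun.
  exact: continuous_cos.
- under eq_fun do rewrite Im_cexp; apply: measurable_funM => //.
  apply: (measurableT_comp _ b); apply: continuous_measurable_fun.
  exact: continuous_sin.
Qed.

Lemma cmeas_prod (I : Type) (s : seq I) (F : I -> T -> R[i]) :
  (forall i, cmeas (F i)) -> cmeas (fun t => \prod_(i <- s) F i t).
Proof.
move=> mF; elim: s => [|i s IH].
  by under eq_fun do rewrite big_nil; exact: cmeas_cst.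
by under eq_fun do rewrite big_cons; exact: cmeasM.
Qed.

End ComplexMeasurability.

Lemma cmeas_comp {R : realType} d d' (T : measurableType d) (T' : measurableType d')
  (h : T -> R[i]) (f : T' -> T) :
  cmeas h -> measurable_fun setT f -> cmeas (fun t => h (f t)).
Proof. by move=> [a b] mf; split; [exact: (measurableT_comp a)|exact: (measurableT_comp b)]. Qed.

Section ComplexIntegral.
Context {R : realType} d (T : measurableType d) (mu : {measure set T -> \bar R}).
Implicit Types (h : T -> R[i]) (k : T -> R).

Definition cint h : R[i] :=
  Rintegral mu setT (fun t => complex.Re (h t)) +i*
  Rintegral mu setT (fun t => complex.Im (h t)).

Definition cintegrable h :=
  mu.-integrable setT (EFin \o (fun t => complex.Re (h t))) /\
  mu.-integrable setT (EFin \o (fun t => complex.Im (h t))).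

Definition rintegrable k := mu.-integrable setT (EFin \o k).

Lemma le_rintegrable (f k : T -> R) : measurable_fun setT f -> rintegrable k ->
  (forall t, `|f t| <= k t) -> rintegrable f.
Proof.
move=> mf ik fk; apply: (le_integrable measurableT _ _ ik); first exact/measurable_EFinP.
by move=> t _; rewrite /= lee_fin (le_trans (fk t)) // ler_norm.
Qed.

Lemma rintegrableZl c k : rintegrable k -> rintegrable (fun t => c * k t).
Proof.
move=> ik; exact: (eq_integrable measurableT _ _ _ (integrableZl measurableT c ik)).
Qed.

Lemma rintegrableD k1 k2 : rintegrable k1 -> rintegrable k2 ->
  rintegrable (fun t => k1 t + k2 t).
Proof.
by move=> i1 i2; exact: (eq_integrable measurableT _ _ _ (integrableD measurableT i1 i2)). Qed.

Lemma dominated_cintegrable h k : cmeas h -> rintegrable k ->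
  (forall t, cabs (h t) <= k t) -> cintegrable h.
Proof.
move=> [a b] ik hk; split.
- by apply: le_rintegrable a ik _ => t; exact: le_trans (norm_Re_le _) (hk t).
- by apply: le_rintegrable b ik _ => t; exact: le_trans (norm_Im_le _) (hk t).
Qed.

(** The factor 2 comes from bounding the real and the imaginary parts
    separately. *)
Lemma cint_norm_le h k : cmeas h -> rintegrable k ->
  (forall t, cabs (h t) <= k t) -> cabs (cint h) <= 2 * \int[mu]_t k t.
Proof.
move=> mh ik hk; have [i1 i2] := dominated_cintegrable mh ik hk.
apply: le_trans (cabs_le_ReIm _) _; rewrite /= mulr_natl mulr2n.
have key (f : T -> R) : rintegrable f -> (forall t, `|f t| <= k t) ->
    `|\int[mu]_t f t| <= \int[mu]_t k t.
  move=> jf fk; apply: le_trans (le_normr_Rintegral _ jf) _ => //.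
  by apply: le_Rintegral => //; exact: integrable_norm.
apply: lerD; apply: key => // t.
- exact: le_trans (norm_Re_le _) (hk t).
- exact: le_trans (norm_Im_le _) (hk t).
Qed.

Lemma cintD h1 h2 : cintegrable h1 -> cintegrable h2 ->
  cint (fun t => h1 t + h2 t) = cint h1 + cint h2.
Proof.
move=> [a1 b1] [a2 b2]; apply: complexP; rewrite ?Re_add ?Im_add /=.
- rewrite -RintegralD //; congr Rintegral.
  by apply/funext => t; rewrite Re_add.
- rewrite -RintegralD //; congr Rintegral.
  by apply/funext => t; rewrite Im_add.
Qed.

Lemma cintZl (c : R[i]) h : cintegrable h -> cint (fun t => c * h t) = c * cint h.
Proof.
move=> [a1 b1]; have Z (x : R) (f : T -> R) : rintegrable f ->
    rintegrable (fun t => x * f t) by move=> /rintegrableZl; exact.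
apply: complexP; rewrite ?Re_mul ?Im_mul /= -!RintegralZl //.
- rewrite -RintegralB //; try exact: Z.
  by congr Rintegral; apply/funext => t; rewrite Re_mul.
- rewrite -RintegralD //; try exact: Z.
  by congr Rintegral; apply/funext => t; rewrite Im_mul.
Qed.

Lemma cintB h1 h2 : cintegrable h1 -> cintegrable h2 ->
  cint (fun t => h1 t - h2 t) = cint h1 - cint h2.
Proof.
move=> [a1 b1] [a2 b2]; apply: complexP; rewrite ?Re_add ?Im_add ?Re_opp ?Im_opp /=.
- rewrite -RintegralB //; congr Rintegral.
  by apply/funext => t; rewrite Re_add Re_opp.
- rewrite -RintegralB //; congr Rintegral.
  by apply/funext => t; rewrite Im_add Im_opp.
Qed.

Lemma eq_cint h1 h2 : h1 =1 h2 -> cint h1 = cint h2.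
Proof. by move=> /funext ->. Qed.

Lemma cint0 : cint (fun=> 0) = 0.
Proof. by rewrite /cint /= Rintegral_cst // mul0r. Qed.

End ComplexIntegral.

Section FubiniProduct.
Context {R : realType} d1 d2 (T1 : measurableType d1) (T2 : measurableType d2).
Variables (m1 : {sigma_finite_measure set T1 -> \bar R})
          (m2 : {sigma_finite_measure set T2 -> \bar R}).
Variables (k1 : T1 -> R) (k2 : T2 -> R).
Hypotheses (k1_ge0 : forall x, 0 <= k1 x) (k2_ge0 : forall y, 0 <= k2 y).
Hypotheses (ik1 : rintegrable m1 k1) (ik2 : rintegrable m2 k2).

Section Real.
Variable f : T1 * T2 -> R.
Hypotheses (mf : measurable_fun setT f) (fk : forall x y, `|f (x, y)| <= k1 x * k2 y).

(** By Tonelli's theorem, domination by k1 x * k2 y gives integrability on the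
    product, hence both orders of integration. *)
Lemma rintegrable_prod : rintegrable (m1 \x m2)%E f.
Proof.
apply/integrable12ltyP; first exact/measurable_EFinP.
have mk1 : measurable_fun setT k1 by apply/measurable_EFinP; exact: measurable_int ik1.
have mk2 : measurable_fun setT k2 by apply/measurable_EFinP; exact: measurable_int ik2.
apply: (@le_lt_trans _ _ (\int[m1]_x ((k1 x)%:E * \int[m2]_y (k2 y)%:E))%E).
- apply: ge0_le_integral => //.
  + by move=> x _; apply: integral_ge0.
  + apply: (measurable_fun_fubini_tonelli_F (abse \o (EFin \o f))) => //=.
    by do 2 apply: measurableT_comp => //.
  + under eq_fun do rewrite muleC.
    by apply: measurable_funeM; exact/measurable_EFinP.
  + move=> x _; rewrite -ge0_integralZl //; last 3 first.
      exact/measurable_EFinP.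
      by move=> y _; rewrite lee_fin.
      by rewrite lee_fin.
    apply: ge0_le_integral => //.
    * apply/measurable_EFinP/measurableT_comp => //.
      exact: measurableT_comp mf (measurable_pair1 _).
    * by apply: measurable_funeM; exact/measurable_EFinP.
    * by move=> y _; rewrite lee_fin; exact: fk.
- have [c ->] : exists c, (\int[m2]_y (k2 y)%:E = c%:E)%E.
    exists (fine (\int[m2]_y (k2 y)%:E)%E); rewrite fineK //.
    exact: integrable_fin_num.
  rewrite (eq_integral (EFin \o (fun t => c * k1 t))); last first.
    by move=> x _; rewrite /= -EFinM mulrC.
  by apply: integrable_lty => //; exact: rintegrableZl.
Qed.

Lemma rfubini1 : Rintegral (m1 \x m2)%E setT f =
  \int[m1]_x \int[m2]_y f (x, y).
Proof.
rewrite {1}/Rintegral -(integral12_prod_meas1 rintegrable_prod); congr fine.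
apply: eq_integral => x _; rewrite /fubini_F /Rintegral fineK //.
apply: integrable_fin_num => //; apply: (@le_rintegrable _ _ _ _ _ (fun y => k1 x * k2 y)) => //.
- exact: measurableT_comp mf (measurable_pair1 _).
- exact: rintegrableZl.
Qed.

Lemma rfubini2 : Rintegral (m1 \x m2)%E setT f =
  \int[m2]_y \int[m1]_x f (x, y).
Proof.
rewrite {1}/Rintegral -(integral21_prod_meas1 rintegrable_prod); congr fine.
apply: eq_integral => y _; rewrite /fubini_G /Rintegral fineK //.
apply: integrable_fin_num => //; apply: (@le_rintegrable _ _ _ _ _ (fun x => k2 y * k1 x)) => //.
- exact: measurableT_comp mf (measurable_pair2 _).
- exact: rintegrableZl.
- by move=> x; rewrite mulrC.
Qed.

End Real.

Variable h : T1 * T2 -> R[i].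
Hypotheses (mh : cmeas h) (hk : forall x y, cabs (h (x, y)) <= k1 x * k2 y).

Let Re_le x y : `|complex.Re (h (x, y))| <= k1 x * k2 y.
Proof. exact: le_trans (norm_Re_le _) (hk x y). Qed.
Let Im_le x y : `|complex.Im (h (x, y))| <= k1 x * k2 y.
Proof. exact: le_trans (norm_Im_le _) (hk x y). Qed.

Lemma cintegrable_prod : cintegrable (m1 \x m2)%E h.
Proof. by split; [exact: rintegrable_prod mh.1 Re_le|exact: rintegrable_prod mh.2 Im_le]. Qed.

Lemma cfubini1 : cint (m1 \x m2)%E h = cint m1 (fun x => cint m2 (fun y => h (x, y))).
Proof. by congr Complex; [exact: rfubini1 mh.1 Re_le|exact: rfubini1 mh.2 Im_le]. Qed.

Lemma cfubini2 : cint (m1 \x m2)%E h = cint m2 (fun y => cint m1 (fun x => h (x, y))).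
Proof. by congr Complex; [exact: rfubini2 mh.1 Re_le|exact: rfubini2 mh.2 Im_le]. Qed.

End FubiniProduct.

(** * Integrals over the line and shifts of contour *)

Section LineIntegral.
Context {R : realType}.
Notation lam := (@lebesgue_measure R).
Implicit Types (u U : R -> R).

(** The dominating function of all the integrals below: its primitive is the
    arctangent, so its tails are explicit, and its products in several variables
    are integrable. *)
Definition cauchy_kernel (x : R) : R := (oneDsqr x)^-1.

Lemma cauchy_kernel_gt0 x : 0 < cauchy_kernel x.
Proof. by rewrite invr_gt0 (lt_le_trans ltr01) // oneDsqr_ge1. Qed.

Lemma cauchy_kernel_ge0 x : 0 <= cauchy_kernel x.
Proof. exact/ltW/cauchy_kernel_gt0. Qed.

Lemma cauchy_kernel_le1 x : cauchy_kernel x <= 1.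
Proof. exact: oneDsqrV_le1. Qed.

Lemma cauchy_kernel_bound_ge0 (a C x : R) : 0 <= a -> a <= C * cauchy_kernel x -> 0 <= C.
Proof. by move=> a0 /(le_trans a0); rewrite pmulr_lge0 // cauchy_kernel_gt0. Qed.

Lemma continuous_cauchy_kernel : continuous cauchy_kernel.
Proof. exact: continuous_oneDsqrV. Qed.

Lemma Rintegral_FTC u U (a b : R) : a < b -> continuous u ->
  (forall x, a <= x <= b -> is_derive x 1 U (u x)) ->
  \int[lam]_(x in `[a, b]) u x = U b - U a.
Proof.
move=> ab cu dU; have cU x : a <= x <= b -> {for x, continuous U}.
  by move=> /dU [d _]; apply: differentiable_continuous; exact/derivable1_diffP.
rewrite /Rintegral (@continuous_FTC2 _ u U a b) //=.
- exact: continuous_subspaceT.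
- split.
  + move=> x /[!in_itv] /= /andP[ax xb].
    by have [|] := dU x; first by rewrite !ltW.
  + by apply: cvg_at_right_filter; apply: cU; rewrite lexx ltW.
  + by apply: cvg_at_left_filter; apply: cU; rewrite lexx ltW.
- move=> x /[!in_itv] /= /andP[ax xb].
  by rewrite derive1E; have [|_ ->] := dU x; first by rewrite !ltW.
Qed.

Lemma Rintegral_cauchy_kernel_itv (L : R) : 0 < L ->
  \int[lam]_(x in `[- L, L]) cauchy_kernel x = 2 * atan L.
Proof.
move=> L0; rewrite (@Rintegral_FTC _ atan) ?atanN; first by ring.
- by rewrite gtrN.
- exact: continuous_cauchy_kernel.
Qed.

Lemma integral_cauchy_kernel : (\int[lam]_x (cauchy_kernel x)%:E = (pi : R)%:E)%E.
Proof.
rewrite ge0_symfun_integralT; [|exact: cauchy_kernel_ge0|exact: continuous_cauchy_kernel|].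
  rewrite -set_itvcy integral0y_oneDsqr -EFinM; congr EFin; by field.
by move=> x; rewrite /cauchy_kernel /oneDsqr /= sqrrN.
Qed.

Lemma rintegrable_cauchy_kernel : rintegrable lam cauchy_kernel.
Proof.
apply/integrableP; split.
  by apply/measurable_EFinP; exact: continuous_measurable_fun continuous_cauchy_kernel.
under eq_integral do rewrite /= ger0_norm ?cauchy_kernel_ge0 //.
by rewrite integral_cauchy_kernel ltry.
Qed.

Lemma Rintegral_cauchy_kernel : \int[lam]_x cauchy_kernel x = pi.
Proof. by rewrite /Rintegral integral_cauchy_kernel. Qed.

(** The omitted part is at most the same tail of C times the Cauchy kernel, and
    the integral of the latter over [-L, L] is 2 atan L. *)
Lemma Rintegral_line_approx u U (C L : R) : 0 < L -> continuous u ->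
  (forall x, `|u x| <= C * cauchy_kernel x) ->
  (forall x, - L <= x <= L -> is_derive x 1 U (u x)) ->
  `|\int[lam]_x u x - (U L - U (- L))| <= C * (pi - 2 * atan L).
Proof.
move=> L0 cu uk dU.
have LL : - L < L by rewrite gtrN.
rewrite -(Rintegral_FTC LL cu dU) -(Rintegral_cauchy_kernel_itv L0) -Rintegral_cauchy_kernel.
have mu : measurable_fun [set: measurableTypeR R] u by exact: continuous_measurable_fun.
have ik := rintegrable_cauchy_kernel.
have iu : rintegrable lam u.
  by exact: le_rintegrable mu (rintegrableZl C ik) uk.
have rst (v : R -> R) : rintegrable lam v -> rintegrable lam (v \_ `[- L, L]).
  move=> iv; rewrite /rintegrable -restrict_EFin; apply/(integrable_mkcond _ _).1 => //.
  exact: integrableS iv.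
rewrite [X in `|_ - X|]Rintegral_mkcond [X in _ * (_ - X)]Rintegral_mkcond.
have iub := rst _ iu; have ikb := rst _ ik.
rewrite -RintegralB // -RintegralB // -RintegralZl //; last first.
  exact: (eq_integrable measurableT _ _ _ (integrableB measurableT ik ikb)).
have id : rintegrable lam (fun x => u x - (u \_ `[- L, L]) x).
  exact: (eq_integrable measurableT _ _ _ (integrableB measurableT iu iub)).
have id2 : rintegrable lam (fun x => cauchy_kernel x - (cauchy_kernel \_ `[- L, L]) x).
  exact: (eq_integrable measurableT _ _ _ (integrableB measurableT ik ikb)).
apply: le_trans (le_normr_Rintegral _ id) _ => //.
apply: le_Rintegral => //; [exact: integrable_norm|exact: rintegrableZl|move=> x _].
rewrite !patchE; case: ifPn => _; last by rewrite !subr0.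
by rewrite !subrr normr0 mulr0.
Qed.

Lemma arctan_tail (e : R) : 0 < e -> exists2 L0, 0 < L0 &
  forall L, L0 <= L -> pi - 2 * atan L <= e.
Proof.
move=> e0; have := @cvgy_atan R => /cvgrPdist_le /(_ (e / 2)) [|M [_ HM]].
  by rewrite divr_gt0.
exists (Num.max M 0 + 1) => [|L ML]; first by rewrite ltr_wpDl // le_max lexx orbT.
have : M < L by apply: lt_le_trans ML; rewrite ltr_pwDr // le_max lexx.
move=> /HM; rewrite ler_norml => /andP[_]; lra.
Qed.

Lemma cauchy_kernel_tail (e : R) : 0 < e -> exists2 L0, 0 < L0 &
  forall L, L0 <= L -> cauchy_kernel L <= e.
Proof.
move=> e0; exists (e^-1 + 1) => [|L eL]; first by rewrite addr_gt0 // invr_gt0.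
have i0 : 0 < e^-1 by rewrite invr_gt0.
have o0 : 0 < oneDsqr L := lt_le_trans ltr01 (oneDsqr_ge1 L).
rewrite /cauchy_kernel -[leRHS]invrK lef_pV2 ?posrE //.
rewrite /oneDsqr; nra.
Qed.

Definition ccont (u : R -> R[i]) :=
  continuous (fun x => complex.Re (u x)) /\ continuous (fun x => complex.Im (u x)).

Lemma ccont_cmeas (u : R -> R[i]) : ccont u ->
  @cmeas R _ (measurableTypeR R) u.
Proof. by move=> [a b]; split; exact: continuous_measurable_fun. Qed.

Lemma cint_line_approx (u U : R -> R[i]) (C L : R) : 0 < L -> ccont u ->
  (forall x, cabs (u x) <= C * cauchy_kernel x) ->
  (forall x, - L <= x <= L -> rderiv U x (u x)) ->
  cabs (cint lam u - (U L - U (- L))) <= 2 * C * (pi - 2 * atan L).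
Proof.
move=> L0 [cu1 cu2] uk dU; apply: le_trans (cabs_le_ReIm _) _.
rewrite !Re_add !Re_opp !Im_add !Im_opp !Re_add !Im_add !Re_opp !Im_opp /=.
rewrite -mulrA mulr_natl mulr2n; apply: lerD.
- apply: (@Rintegral_line_approx _ (fun x => complex.Re (U x))) => //.
    by move=> x; apply: le_trans (norm_Re_le _) (uk x).
  by move=> x /dU [].
- apply: (@Rintegral_line_approx _ (fun x => complex.Im (U x))) => //.
    by move=> x; apply: le_trans (norm_Im_le _) (uk x).
  by move=> x /dU [].
Qed.

(** The primitive vanishes at both ends of every large interval. *)
Lemma cint_derive_compact (U u : R -> R[i]) (C L0 : R) : ccont u ->
  (forall x, cabs (u x) <= C * cauchy_kernel x) ->
  (forall x, rderiv U x (u x)) -> (forall x, L0 <= `|x| -> U x = 0) ->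
  cint lam u = 0.
Proof.
move=> cu uk dU U0; apply: (@cabs_le_eps _ _ (2 * C)) => e e0.
have [L1 L10 H1] := arctan_tail e0.
pose L := Num.max L1 (Num.max L0 0).
have LL1 : L1 <= L by rewrite le_max lexx.
have L_gt0 : 0 < L := lt_le_trans L10 LL1.
have := cint_line_approx L_gt0 cu uk (fun x _ => dU x).
have LL0 : L0 <= `|L| by rewrite (le_trans _ (ler_norm _)) // !le_max lexx orbT.
rewrite !U0 ?normrN // !subr0 => /le_trans; apply.
have C0 : 0 <= C := cauchy_kernel_bound_ge0 (cabs_ge0 _) (uk 0).
by rewrite ler_wpM2l ?H1 // mulr_ge0.
Qed.

Lemma holomorphic_ccont (G : R[i] -> R[i]) y : holomorphic G -> ccont (fun x => G (x +i* y)).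
Proof.
move=> GH; split=> x; have [c /cderiv_horizontal/rderiv_continuous[]//] := GH (x +i* y).
Qed.

Lemma holomorphic_ccont_vertical (G : R[i] -> R[i]) x : holomorphic G ->
  ccont (fun y => G (x +i* y)).
Proof.
move=> GH; split=> y; have [c /cderiv_vertical/rderiv_continuous[]//] := GH (x +i* y).
Qed.

(** In the rectangle [-L, L] x [y1, y2] each vertical side contributes
    O(cauchy_kernel L), and the horizontal sides differ from the full integrals
    by tails. *)
Theorem contour_shift (G : R[i] -> R[i]) (C y1 y2 : R) : holomorphic G -> y1 <= y2 ->
  (forall x y, y1 <= y <= y2 -> cabs (G (x +i* y)) <= C * cauchy_kernel x) ->
  cint lam (fun x => G (x +i* y1)) = cint lam (fun x => G (x +i* y2)).
Proof.
move=> GH y12 Gk; apply/eqP; rewrite -subr_eq0; apply/eqP.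
have C0 : 0 <= C.
  exact: cauchy_kernel_bound_ge0 (cabs_ge0 _) (Gk 0 y1 (introT andP (conj (lexx _) y12))).
apply: (@cabs_le_eps _ _ (4 * C + 4 * C * (y2 - y1))) => e e0.
have [L1 L10 H1] := arctan_tail e0.
have [L2 L20 H2] := cauchy_kernel_tail e0.
pose L := Num.max L1 L2.
have LL1 : L1 <= L by rewrite le_max lexx.
have LL2 : L2 <= L by rewrite le_max lexx orbT.
have L_gt0 : 0 < L := lt_le_trans L10 LL1.
(* All the primitives start at a0, on the left of and below the rectangle. *)
pose a0 := Num.min (- L) y1 - 1.
have aL : a0 < - L.
  have : Num.min (- L) y1 <= - L by rewrite ge_min lexx.
  by rewrite /a0; lra.
have ay : a0 < y1.
  have : Num.min (- L) y1 <= y1 by rewrite ge_min lexx orbT.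
  by rewrite /a0; lra.
have [H HG] := choice (fun y => exists_cprimitive a0
  (holomorphic_ccont y GH).1 (holomorphic_ccont y GH).2).
have cv x : ccont (fun y => G (x +i* y) * 'i%C).
  have [cu1 cu2] := holomorphic_ccont_vertical x GH; split.
    rewrite (_ : (fun _ => _) = fun y => - complex.Im (G (x +i* y))).
      by move=> y; apply: cvgN; exact: cu2.
    by apply/funext => y; rewrite Re_mul /= mulr0 mulr1 sub0r.
  rewrite (_ : (fun _ => _) = fun y => complex.Re (G (x +i* y))) //.
  by apply/funext => y; rewrite Im_mul /= mulr0 mulr1 addr0.
have [V VG] := choice (fun x => exists_cprimitive a0 (cv x).1 (cv x).2).
have LL : - L <= L by rewrite ltW // gtrN.
have E0 := @contour0 R G H V a0 GH HG VG (- L, L) (y1, y2) aL ay LL y12.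
have line y : y1 <= y <= y2 ->
    cabs (cint lam (fun x => G (x +i* y)) - (H y L - H y (- L))) <= 2 * C * e.
  move=> yy; apply: le_trans (cint_line_approx L_gt0 (holomorphic_ccont y GH) _ _) _.
  - by move=> x; exact: Gk.
  - by move=> x /andP[xL _]; apply: HG; exact: lt_le_trans xL.
  - by rewrite ler_wpM2l ?H1 // mulr_ge0.
have side x : cauchy_kernel x <= e -> cabs (V x y2 - V x y1) <= 2 * (C * e) * (y2 - y1).
  move=> xe; apply: (mean_value_bound y12) => y yy; split.
    by apply: VG; have /andP[h _] := yy; exact: lt_le_trans h.
  rewrite cabsM cabs_imag normr1 mulr1.
  by apply: le_trans (Gk x y yy) _; rewrite ler_wpM2l.
have sL := side L (H2 L LL2).
have kN : cauchy_kernel (- L) <= e.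
  by rewrite /cauchy_kernel /oneDsqr sqrrN; exact: H2.
have sN := side (- L) kN.
have l1 := line y1 (introT andP (conj (lexx _) y12)).
have l2 := line y2 (introT andP (conj y12 (lexx _))).
set I1 := cint lam _ in l1 *; set I2 := cint lam _ in l2 *.
have -> : I1 - I2 = (I1 - (H y1 L - H y1 (- L))) - (I2 - (H y2 L - H y2 (- L)))
   - (V L y2 - V L y1) + (V (- L) y2 - V (- L) y1).
  by apply/eqP; rewrite -subr_eq0 -[X in _ == X]E0 /contour; apply/eqP; ring.
apply: le_trans (cabsD _ _) _; apply: le_trans (lerD (cabsB _ _) sN) _.
apply: le_trans (lerD (lerD (cabsB _ _) sL) (lexx _)) _.
apply: le_trans (lerD (lerD (lerD l1 l2) (lexx _)) (lexx _)) _.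
lra.
Qed.

End LineIntegral.

(** * Integrals over R^n *)

Section TupleIntegral.
Context {R : realType}.
Notation lam := (@lebesgue_measure R).
Notation leb := (lebesgue_tuple R).
Notation Rm := (measurableTypeR R).

Definition kernel_prod n (t : n.-tuple Rm) : R :=
  \prod_(j < n) cauchy_kernel (tnth t j).

Lemma kernel_prod_ge0 n (t : n.-tuple Rm) : 0 <= kernel_prod t.
Proof. by apply: prodr_ge0 => j _; exact: cauchy_kernel_ge0. Qed.

Lemma kernel_prod_gt0 n (t : n.-tuple Rm) : 0 < kernel_prod t.
Proof. by apply: prodr_gt0 => j _; exact: cauchy_kernel_gt0. Qed.

Lemma kernel_prod_le1 n (t : n.-tuple Rm) : kernel_prod t <= 1.
Proof.
apply: (@le_trans _ _ (\prod_(j < n) (1 : R))); last by rewrite big1_eq.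
by apply: ler_prod => j _; rewrite cauchy_kernel_ge0 cauchy_kernel_le1.
Qed.

Lemma kernel_prod_lower n (t : n.-tuple Rm) (K : R) :
  (forall j, 1 + (tnth t j : R) ^+ 2 <= K) -> 1 <= K ^+ n * kernel_prod t.
Proof.
move=> tK; rewrite -[X in K ^+ X]card_ord -prodr_const -big_split /=.
apply: (@le_trans _ _ (\prod_(j < n) (1 : R))); first by rewrite big1_eq.
apply: ler_prod => j _; rewrite ler01 /= /cauchy_kernel ler_pdivlMr ?mul1r; first exact: tK.
by rewrite (lt_le_trans ltr01) // oneDsqr_ge1.
Qed.

(** The factor (1 + M^2)^n makes the kernel at least 1 on a cube, so that
    bounded functions supported there are dominated by the product kernel. *)
Lemma kernel_prod_box n (t : n.-tuple Rm) (M : R) :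
  (forall j, `|tnth t j : R| <= M) -> 1 <= (1 + M ^+ 2) ^+ n * kernel_prod t.
Proof.
move=> tM; apply: kernel_prod_lower => j.
rewrite lerD2l -(real_normK (num_real (tnth t j : R))).
by apply: lerXn2r; rewrite ?nnegrE // (le_trans _ (tM j)).
Qed.

Definition tset n (t : n.-tuple Rm) (j : 'I_n) (s : R) : n.-tuple Rm :=
  [tuple (if i == j then s else tnth t i) | i < n].

Lemma tnth_tuple_cons0 n (x : Rm) (t : n.-tuple Rm) : tnth (tuple_cons (x, t)) ord0 = x.
Proof. exact: tnth0. Qed.

Lemma tnth_tuple_consS n (x : Rm) (t : n.-tuple Rm) j :
  tnth (tuple_cons (x, t)) (lift ord0 j) = tnth t j.
Proof. exact: tnthS. Qed.

Lemma tset_cons0 n (x s : Rm) (t : n.-tuple Rm) :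
  tset (tuple_cons (x, t)) ord0 s = tuple_cons (s, t).
Proof.
apply: eq_from_tnth => i; rewrite tnth_mktuple.
case: (unliftP ord0 i) => [j ->|->]; last by rewrite eqxx tnth_tuple_cons0.
by rewrite eq_sym (negbTE (neq_lift ord0 j)) !tnth_tuple_consS.
Qed.

Lemma tset_consS n (x s : Rm) (t : n.-tuple Rm) j :
  tset (tuple_cons (x, t)) (lift ord0 j) s = tuple_cons (x, tset t j s).
Proof.
apply: eq_from_tnth => i; rewrite tnth_mktuple.
case: (unliftP ord0 i) => [k ->|->]; last by rewrite !tnth_tuple_cons0.
by rewrite (inj_eq lift_inj) !tnth_tuple_consS tnth_mktuple.
Qed.

Lemma kernel_prod_cons n (x : Rm) (t : n.-tuple Rm) :
  kernel_prod (tuple_cons (x, t)) = cauchy_kernel x * kernel_prod t.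
Proof.
rewrite /kernel_prod big_ord_recl tnth_tuple_cons0; congr (_ * _).
by apply: eq_bigr => j _; rewrite tnth_tuple_consS.
Qed.

Lemma measurable_cauchy_kernel : measurable_fun [set: Rm] (@cauchy_kernel R).
Proof. exact: continuous_measurable_fun continuous_cauchy_kernel. Qed.

Lemma measurable_kernel_prod n : measurable_fun [set: n.-tuple Rm] (@kernel_prod n).
Proof.
apply: measurable_prod => j _.
exact: measurableT_comp measurable_cauchy_kernel (measurable_tnth _).
Qed.

Lemma rintegrable_cons n (f : n.+1.-tuple Rm -> R) : measurable_fun setT f ->
  rintegrable (lam \x leb n)%E (f \o @tuple_cons _ _ n) -> rintegrable (leb n.+1) f.
Proof.
move=> mf jf; apply: integrable_pushforward => //.
- exact: measurable_tuple_cons.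
- exact/measurable_EFinP.
Qed.

Lemma Rintegral_cons n (f : n.+1.-tuple Rm -> R) : measurable_fun setT f ->
  rintegrable (lam \x leb n)%E (f \o @tuple_cons _ _ n) ->
  Rintegral (leb n.+1) setT f = Rintegral (lam \x leb n)%E setT (f \o @tuple_cons _ _ n).
Proof.
move=> mf jf; rewrite /Rintegral; congr fine.
rewrite [LHS]integral_pushforward //; first exact: measurable_tuple_cons.
exact/measurable_EFinP.
Qed.

Lemma rintegrable_kernel_prod n : rintegrable (leb n) (@kernel_prod n).
Proof.
elim: n => [|n IH].
  apply: (eq_integrable measurableT (cst 1%:E)); last first.
    by apply: finite_measure_integrable_cst.
  by move=> t _; rewrite /= /kernel_prod big_ord0.
apply: rintegrable_cons; first exact: measurable_kernel_prod.
have prod := @rintegrable_prod R _ _ Rm (n.-tuple Rm) lam (leb n)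
  (@cauchy_kernel R) (@kernel_prod n); apply: prod => //.
- exact: cauchy_kernel_ge0.
- exact: kernel_prod_ge0.
- exact: rintegrable_cauchy_kernel.
- exact: measurableT_comp (@measurable_kernel_prod n.+1) (@measurable_tuple_cons _ _ _).
- move=> x y; rewrite /= kernel_prod_cons ger0_norm // mulr_ge0 //.
    exact: cauchy_kernel_ge0.
  exact: kernel_prod_ge0.
Qed.

Lemma cint_tuple0 (h : 0.-tuple Rm -> R[i]) : cmeas h -> cint (leb 0) h = h [tuple].
Proof.
move=> [a b]; rewrite /cint /Rintegral.
have E (f : 0.-tuple Rm -> R) : measurable_fun setT f ->
    (\int[leb 0]_x (f x)%:E = (f [tuple])%:E)%E.
  move=> mf; rewrite [LHS]integral_dirac //; last exact/measurable_EFinP.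
  by rewrite diracT mul1e.
by rewrite !E //=; case: (h _).
Qed.

(** Domination by the product kernel makes the integral over R^n an iterated
    integral, in every order of the variables. *)
Definition rapid n (h : n.-tuple Rm -> R[i]) := cmeas h /\
  exists C : R, forall t, cabs (h t) <= C * kernel_prod t.

Lemma rapid_cintegrable n (h : n.-tuple Rm -> R[i]) : rapid h -> cintegrable (leb n) h.
Proof.
move=> [mh [C hC]].
exact: dominated_cintegrable mh (rintegrableZl C (rintegrable_kernel_prod n)) hC.
Qed.

Lemma rapid_bound_ge0 n (h : n.-tuple Rm -> R[i]) C :
  (forall t, cabs (h t) <= C * kernel_prod t) -> 0 <= C.
Proof.
move=> H; have := le_trans (cabs_ge0 _) (H [tuple 0 | _ < n]).
by rewrite pmulr_lge0 // kernel_prod_gt0.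
Qed.

Section Cons.
Variables (n : nat) (h : n.+1.-tuple Rm -> R[i]).
Hypothesis hr : rapid h.

Let dom : exists2 C : R, 0 <= C & forall x t,
  cabs (h (tuple_cons (x, t))) <= C * cauchy_kernel x * kernel_prod t.
Proof.
have [mh [C hC]] := hr; exists C; first exact: rapid_bound_ge0 hC.
by move=> x t; rewrite -mulrA -kernel_prod_cons.
Qed.

Let mh : cmeas (h \o @tuple_cons _ _ n).
Proof. exact: (cmeas_comp hr.1 (@measurable_tuple_cons _ _ _)). Qed.

Lemma cint_cons : cint (leb n.+1) h = cint (lam \x leb n)%E (h \o @tuple_cons _ _ n).
Proof.
have [C C0 hC] := dom.
have kp : forall x : Rm, 0 <= C * cauchy_kernel x.
  by move=> x; rewrite mulr_ge0 // cauchy_kernel_ge0.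
have [i1 i2] := cintegrable_prod kp (@kernel_prod_ge0 n)
  (rintegrableZl C rintegrable_cauchy_kernel) (rintegrable_kernel_prod n) mh hC.
rewrite /cint; congr Complex; apply: Rintegral_cons => //; [exact: hr.1.1|exact: hr.1.2].
Qed.

Lemma cint_cons1 : cint (leb n.+1) h =
  cint lam (fun x => cint (leb n) (fun t => h (tuple_cons (x, t)))).
Proof.
have [C C0 hC] := dom; rewrite cint_cons.
apply: (cfubini1 _ (@kernel_prod_ge0 n)
  (rintegrableZl C rintegrable_cauchy_kernel) (rintegrable_kernel_prod n) mh hC).
by move=> x; rewrite mulr_ge0 // cauchy_kernel_ge0.
Qed.

Lemma cint_cons2 : cint (leb n.+1) h =
  cint (leb n) (fun t => cint lam (fun x => h (tuple_cons (x, t)))).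
Proof.
have [C C0 hC] := dom; rewrite cint_cons.
apply: (cfubini2 _ (@kernel_prod_ge0 n)
  (rintegrableZl C rintegrable_cauchy_kernel) (rintegrable_kernel_prod n) mh hC).
by move=> x; rewrite mulr_ge0 // cauchy_kernel_ge0.
Qed.

Lemma rapid_slice x : rapid (fun t => h (tuple_cons (x, t))).
Proof.
have [C C0 hC] := dom; split; last first.
  by exists (C * cauchy_kernel x) => t; exact: hC.
apply: (cmeas_comp hr.1); apply: measurable_cons; [exact: measurable_cst|exact: measurable_id].
Qed.

End Cons.

(** Fubini's theorem peels off the coordinates one at a time; those other than j
    are integrated outside. *)
Lemma cint_slices0 n (h : n.-tuple Rm -> R[i]) (j : 'I_n) : rapid h ->
  (forall t, cint lam (fun s => h (tset t j s)) = 0) -> cint (leb n) h = 0.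
Proof.
elim: n h j => [h []//|n IH] h j hr; case: (unliftP ord0 j) => [k ->|->] h0.
- rewrite cint_cons1 // (eq_cint _ (h2 := fun=> 0)) ?cint0 // => x.
  apply: (IH _ k); first exact: rapid_slice.
  by move=> t; have := h0 (tuple_cons (x, t)); under eq_cint do rewrite tset_consS.
- rewrite cint_cons2 // (eq_cint _ (h2 := fun=> 0)) ?cint0 // => t.
  by have := h0 (tuple_cons ((0 : R) : Rm, t : n.-tuple Rm)); under eq_cint do rewrite tset_cons0.
Qed.

Lemma cint_prod n (k : 'I_n -> R -> R[i]) :
  (forall j, cmeas (k j : Rm -> R[i])) ->
  (forall j, exists C, forall s, cabs (k j s) <= C * cauchy_kernel s) ->
  rapid (fun t : n.-tuple Rm => \prod_(j < n) k j (tnth t j)) /\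
  cint (leb n) (fun t => \prod_(j < n) k j (tnth t j)) = \prod_(j < n) cint lam (k j).
Proof.
move=> mk bk.
have mP m (l : 'I_m -> R -> R[i]) : (forall j, cmeas (l j : Rm -> R[i])) ->
    cmeas (fun t : m.-tuple Rm => \prod_(j < m) l j (tnth t j)).
  by move=> ml; apply: cmeas_prod => j; exact: cmeas_comp (ml j) (measurable_tnth _).
have rP m (l : 'I_m -> R -> R[i]) : (forall j, cmeas (l j : Rm -> R[i])) ->
    (forall j, exists C, forall s, cabs (l j s) <= C * cauchy_kernel s) ->
    rapid (fun t : m.-tuple Rm => \prod_(j < m) l j (tnth t j)).
  move=> ml /choice[C HC]; split; first exact: mP.
  exists (\prod_j C j) => t; rewrite cabs_prod /kernel_prod -big_split /=.
  by apply: ler_prod => j _; rewrite cabs_ge0 HC.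
split; first exact: rP.
elim: n k mk bk => [|n IH] k mk bk.
  by rewrite cint_tuple0 ?big_ord0 //; exact: mP.
rewrite cint_cons1; last exact: rP.
rewrite big_ord_recl -(IH (fun j => k (lift ord0 j))) //.
set c := cint (leb n) _.
rewrite (eq_cint _ (h2 := fun x : Rm => c * k ord0 x)); last first.
  move=> x; under eq_cint do rewrite big_ord_recl tnth_tuple_cons0.
  rewrite (eq_cint _ (h2 := fun t : n.-tuple Rm =>
    k ord0 x * \prod_(i < n) k (lift ord0 i) (tnth t i))); last first.
    by move=> t; congr (_ * _); apply: eq_bigr => i _; rewrite tnth_tuple_consS.
  rewrite cintZl; first by rewrite mulrC.
  by apply: rapid_cintegrable; apply: (rP n (fun i => k (lift ord0 i))).
rewrite cintZl; first by rewrite mulrC.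
have [C HC] := bk ord0.
exact: dominated_cintegrable (mk _) (rintegrableZl C rintegrable_cauchy_kernel) HC.
Qed.

(** Continuity for the sup distance, in inequalities: tuples are only used with
    their measurable structure. *)
Definition tcont n (h : n.-tuple Rm -> R[i]) := forall t e, 0 < e ->
  exists2 d : R, 0 < d & forall u, (forall j, `|tnth t j - tnth u j| < d) ->
    cabs (h t - h u) <= e.

(** Rounding down to the grid of mesh 1 / (N + 1) takes countably many values,
    each of them on a box, so that any function of the rounded point is
    measurable. *)
Lemma measurable_floor_tuple n (N : nat) (h : n.-tuple Rm -> R) :
  measurable_fun [set: n.-tuple Rm]
    (fun t => h [tuple ((Num.floor (tnth t j * N.+1%:R))%:~R / N.+1%:R : R) | j < n]).
Proof.
move=> _ Y mY; rewrite setTI.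
pose P (z : n.-tuple int) := [set t : n.-tuple Rm | forall j : 'I_n,
  Num.floor (tnth t j * N.+1%:R) = tnth z j].
pose Q (z : n.-tuple int) := if `[< Y (h [tuple ((tnth z j)%:~R / N.+1%:R : R) | j < n]) >]
  then P z else set0.
have -> : (fun t : n.-tuple Rm =>
     h [tuple ((Num.floor (tnth t j * N.+1%:R))%:~R / N.+1%:R : R) | j < n]) @^-1` Y =
   \bigcup_z Q z.
  apply/seteqP; split=> [t Yt|t [z _]].
    exists [tuple Num.floor (tnth t j * N.+1%:R) | j < n] => //.
    rewrite /Q asboolT; first by move=> j; rewrite tnth_mktuple.
    move: Yt; rewrite /preimage /=; congr (Y (h _)).
    by apply: eq_from_tnth => j; rewrite !tnth_mktuple.
  rewrite /Q; case: asboolP => // Yz Pz; move: Yz; rewrite /preimage /=.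
  congr (Y (h _)); apply: eq_from_tnth => j; rewrite !tnth_mktuple.
  by rewrite Pz.
apply: countable_bigcupT_measurable => // z; rewrite /Q; case: ifP => // _.
rewrite (_ : P z = \bigcap_(j in [set: 'I_n])
  [set t : n.-tuple Rm | Num.floor (tnth t j * N.+1%:R) = tnth z j]); last first.
  by apply/seteqP; split=> [t Pt j _|t Pt j]; exact: Pt.
apply: fin_bigcap_measurable => // j _.
rewrite (_ : [set _ | _] = (@tnth _ Rm ^~ j) @^-1`
  `[(tnth z j)%:~R / N.+1%:R, ((tnth z j) + 1)%:~R / N.+1%:R[ ).
  rewrite -[X in measurable X]setTI; apply: measurable_tnth => //.
apply/seteqP; split=> t /=; rewrite in_itv /= ler_pdivrMr // ltr_pdivlMr //.
  by move=> <-; rewrite floor_le floorD1_gt.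
by move=> /floor_def.
Qed.

(** A continuous function is the pointwise limit of its values at the rounded
    points of [measurable_floor_tuple]. *)
Lemma tcont_measurable n (h : n.-tuple Rm -> R[i]) : tcont h -> cmeas h.
Proof.
move=> hc; apply: (ReIm_ind (P := fun f => measurable_fun setT (fun t => f (h t)))) => f fD _ fle.
pose D N (t : n.-tuple Rm) : n.-tuple Rm :=
  [tuple ((Num.floor (tnth t j * N.+1%:R))%:~R / N.+1%:R : R) | j < n].
apply: (@measurable_fun_cvg _ _ _ _ (fun N t => f (h (D N t)))).
  by move=> N; exact: (measurable_floor_tuple N (fun t => f (h t))).
move=> t _; apply/cvgrPdist_le => e e0; have [d d0 Hd] := hc t e e0.
near=> N; rewrite -fD; apply: le_trans (fle _) _; apply: Hd => j.
rewrite tnth_mktuple.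
set x := tnth t j; set m := N.+1%:R : R.
have m0 : 0 < m by rewrite ltr0n.
have h1 := floor_le (x * m); have h2 := floorD1_gt (x * m).
have -> : x - (Num.floor (x * m))%:~R / m = (x * m - (Num.floor (x * m))%:~R) / m.
  by field; rewrite gt_eqF.
rewrite normrM normfV (gtr0_norm m0) ltr_pdivrMr // ger0_norm ?subr_ge0 //.
apply: (@lt_trans _ _ 1); first by rewrite ltrBlDl; move: h2; rewrite intrD.
rewrite -ltr_pdivrMl // mulr1 /m.
near: N; exists (Num.bound d^-1) => // N /= bN.
apply: lt_le_trans (archi_boundP _) _; first by rewrite invr_ge0 ltW.
by rewrite ler_nat (leq_trans bN).
Unshelve. all: by end_near. Qed.

End TupleIntegral.

(** * The Poisson kernel *)

Section PoissonKernel.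
Context {R : realType}.
Notation lam := (@lebesgue_measure R).
Notation Rm := (measurableTypeR R).
Implicit Types (x s u e : R).

Definition phase (a : R) : R[i] := cexp (0 +i* a).

Lemma cabs_phase a : cabs (phase a) = 1.
Proof. by rewrite cabs_cexp expR0. Qed.

Lemma phaseD a b : phase (a + b) = phase a * phase b.
Proof. by rewrite -cexpD; congr cexp; apply: complexP => /=; rewrite ?addr0. Qed.

Lemma phase_sum (I : Type) (r : seq I) (F : I -> R) :
  phase (\sum_(i <- r) F i) = \prod_(i <- r) phase (F i).
Proof.
elim/big_rec2 : _ => [|i x y _ <-]; last by rewrite phaseD.
by rewrite /phase -cexp0; congr cexp.
Qed.

Lemma cmeas_phase d (T : measurableType d) (f : T -> R) :
  measurable_fun setT f -> cmeas (fun t => phase (f t)).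
Proof. by move=> mf; apply: cmeas_cexp; split => //=; exact: measurable_cst. Qed.

(** For primitives of exp (- e |s|), whose expression changes at 0. *)
Lemma is_derive_glue (f1 f2 d1 d2 : R -> R) x : f1 0 = f2 0 -> d1 0 = d2 0 ->
  (0 <= x -> is_derive x 1 f1 (d1 x)) -> (x <= 0 -> is_derive x 1 f2 (d2 x)) ->
  is_derive x 1 (fun x => if 0 <= x then f1 x else f2 x) (if 0 <= x then d1 x else d2 x).
Proof.
move=> f0 d0 D1 D2; apply/is_deriveP => e e0; have [x0|x0|x0] := ltrgtP 0 x.
- have [r r0 H] := (is_deriveP _ _ _ _).1 (D1 (ltW x0)) e e0.
  exists (Num.min r x); first by rewrite lt_min r0.
  move=> h; rewrite lt_min /GRing.scale /= mulr1 => /andP[hr hx].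
  have xh : 0 <= x + h by move: hx; rewrite ltr_norml => /andP[]; lra.
  by rewrite xh; have := H h hr; rewrite /GRing.scale /= mulr1.
- have [r r0 H] := (is_deriveP _ _ _ _).1 (D2 (ltW x0)) e e0.
  exists (Num.min r (- x)); first by rewrite lt_min r0 oppr_gt0.
  move=> h; rewrite lt_min /GRing.scale /= mulr1 => /andP[hr hx].
  have xh : x + h < 0 by move: hx; rewrite ltr_norml => /andP[]; lra.
  by rewrite (lt_geF xh); have := H h hr; rewrite /GRing.scale /= mulr1.
- move: D1 D2; rewrite -x0 lexx => D1 D2.
  have [r1 r10 H1] := (is_deriveP _ _ _ _).1 (D1 isT) e e0.
  have [r2 r20 H2] := (is_deriveP _ _ _ _).1 (D2 isT) e e0.
  exists (Num.min r1 r2); first by rewrite lt_min r10.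
  move=> h; rewrite lt_min => /andP[h1 h2].
  by case: ifP => _; [exact: H1|rewrite f0 d0; exact: H2].
Qed.

Definition exp_cutoff e s : R := expR (- (e * `|s|)).

Lemma exp_cutoff_ge0 e s : 0 <= exp_cutoff e s.
Proof. exact: expR_ge0. Qed.

Lemma continuous_exp_cutoff e : continuous (exp_cutoff e).
Proof.
move=> s; apply: continuous_comp; last exact: continuous_expR.
by apply: cvgN; apply: cvgMr; apply: norm_continuous.
Qed.

(** From expR y = (expR (y / 2))^2 >= (1 + y / 2)^2. *)
Lemma exp_cutoff_bound e s : 0 < e ->
  exp_cutoff e s <= (1 + 4 / e ^+ 2) * cauchy_kernel s.
Proof.
move=> e0; rewrite /exp_cutoff /cauchy_kernel /oneDsqr.
set y := e * `|s|; have y0 : 0 <= y by rewrite mulr_ge0 // ltW.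
have ys : s ^+ 2 = y ^+ 2 / e ^+ 2.
  by rewrite /y exprMn real_normK ?num_real // mulrC mulKf // expf_neq0 // gt_eqF.
have e1 : 1 + y ^+ 2 / 4 <= expR y.
  rewrite (_ : y = y / 2 + y / 2); last by lra.
  rewrite expRD; have := expR_ge1Dx (y / 2); nra.
have s1 : 0 < 1 + s ^+ 2 by rewrite ltr_pwDl // sqr_ge0.
rewrite expRN ler_pdivlMr // ler_pdivrMl ?expR_gt0 // ys.
have i0 : 0 <= (e ^+ 2)^-1 by rewrite invr_ge0 sqr_ge0.
set w := (e ^+ 2)^-1 in i0 *.
have : 0 <= y ^+ 2 := sqr_ge0 y.
move: (y ^+ 2) e1 => z e1 z0.
apply: (@le_trans _ _ ((1 + z / 4) * (1 + 4 * w))); first nra.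
by rewrite ler_wpM2r //; lra.
Qed.

(** The Fourier transform of [exp_cutoff e], by [cint_exp_cutoff]. *)
Definition poisson e u : R := 2 * e / (e ^+ 2 + (2 * pi * u) ^+ 2).

Lemma poisson_ge0 e u : 0 < e -> 0 <= poisson e u.
Proof. by move=> e0; rewrite divr_ge0 ?mulr_ge0 ?addr_ge0 ?sqr_ge0 // ltW. Qed.

(** The integrand is exp (c s), with c = c1 = - e + i b for s >= 0 and
    c = c2 = e + i b for s <= 0, where b = 2 pi u. The primitives
    (exp (c s) - 1) / c both vanish at 0, so they glue to a primitive on the
    line; its limits at +oo and -oo are - 1 / c1 and - 1 / c2. *)
Lemma cint_exp_cutoff e u : 0 < e ->
  cint lam (fun s : Rm => (exp_cutoff e s)%:C * phase (2 * pi * (s * u))) = (poisson e u)%:C.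
Proof.
move=> e0; pose b := 2 * pi * u.
pose c1 : R[i] := (- e) +i* b; pose c2 : R[i] := e +i* b.
have c10 : c1 != 0 by rewrite eq_complex /= oppr_eq0 gt_eqF.
have c20 : c2 != 0 by rewrite eq_complex /= gt_eqF.
pose U c (s : R) : R[i] := (cexp (c * s%:C) - 1) / c.
have dU c s : c != 0 -> rderiv (U c) s (cexp (c * s%:C)).
  move=> c0; pose P (w : R[i]) := (cexp (0 * w ^+ 2 + c * w + 0) - 1) / c.
  have PU t : U c t = P (t +i* 0) by rewrite /P /U mul0r add0r addr0.
  have : cderiv P (s +i* 0) (cexp (c * s%:C)).
    have := cderiv_cexp (cderiv_quadratic 0 c 0 (s +i* 0)).
    rewrite !(mulr0, mul0r, add0r, addr0).
    move=> D eps eps0; have c00 := cabs_gt0 c0.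
    have [d d0 H] := D _ (mulr_gt0 eps0 c00); exists d => // h hd.
    have := H h hd; rewrite /P !mul0r !add0r !addr0 => Hh.
    rewrite -(ler_pM2r c00) -cabsM [leRHS]mulrAC; apply: le_trans Hh.
    rewrite le_eqVlt; apply/orP; left; apply/eqP; congr cabs.
    by field.
  by move=> /cderiv_horizontal; rewrite (_ : U c = fun x => P (x +i* 0)) //; exact/funext.
pose V s := if 0 <= s then U c1 s else U c2 s.
pose k (s : R) : R[i] := (exp_cutoff e s)%:C * phase (2 * pi * (s * u)).
have kE s : k s = if 0 <= s then cexp (c1 * s%:C) else cexp (c2 * s%:C).
  rewrite /k /exp_cutoff /phase.
  rewrite -cexp_real -cexpD; case: (lerP 0 s) => s0; congr cexp;
   apply: complexP; rewrite ?Re_add ?Im_add ?Re_mul ?Im_mul /= /b.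
  - by rewrite ger0_norm //; ring.
  - by ring.
  - by rewrite ltr0_norm //; ring.
  - by ring.
have U0 c : U c 0 = 0 by rewrite /U mulr0 cexp0 subrr mul0r.
have dV s : rderiv V s (k s).
  have [D1 D1'] := dU c1 s c10; have [D2 D2'] := dU c2 s c20.
  have glue (f : R[i] -> R) :
      is_derive s 1 (fun s => f (U c1 s)) (f (cexp (c1 * s%:C))) ->
      is_derive s 1 (fun s => f (U c2 s)) (f (cexp (c2 * s%:C))) ->
      is_derive s 1 (fun s => f (V s)) (f (k s)).
    move=> F1 F2; rewrite kE (fun_if f).
    rewrite (_ : (fun x => _) = fun x => if 0 <= x then f (U c1 x) else f (U c2 x)); last first.
      by apply/funext => x; rewrite -fun_if.
    apply: (@is_derive_glue (fun s => f (U c1 s)) (fun s => f (U c2 s))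
      (fun s => f (cexp (c1 * s%:C))) (fun s => f (cexp (c2 * s%:C)))) => //.
      by rewrite !U0.
    by rewrite !mulr0.
  by split; [exact: (glue (@complex.Re R))|exact: (glue (@complex.Im R))].
have ck : ccont k.
  have cb (f : R -> R) : continuous f -> continuous (fun s => f (2 * pi * (s * u))).
    move=> cf s; apply: continuous_comp; last exact: cf.
    by apply: cvgMr; apply: cvgMl; exact: cvg_id.
  split.
    rewrite (_ : (fun _ => _) = fun s => exp_cutoff e s * cos (2 * pi * (s * u))).
      move=> s; apply: cvgM; first exact: continuous_exp_cutoff.
      by apply: (cb cos); exact: continuous_cos.
    by apply/funext => s; rewrite /k Re_mul Re_cexp Im_cexp /= expR0 mul1r mul0r subr0.
  rewrite (_ : (fun _ => _) = fun s => exp_cutoff e s * sin (2 * pi * (s * u))).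
    move=> s; apply: cvgM; first exact: continuous_exp_cutoff.
    by apply: (cb sin); exact: continuous_sin.
  by apply/funext => s; rewrite /k Im_mul Re_cexp Im_cexp /= expR0 mul1r mul0r addr0.
pose C : R := 1 + 4 / e ^+ 2.
have kC s : cabs (k s) <= C * cauchy_kernel s.
  by rewrite /k cabsM cabs_phase mulr1 cabsR ger0_norm ?exp_cutoff_ge0 // exp_cutoff_bound.
have C0 : 0 <= C := cauchy_kernel_bound_ge0 (cabs_ge0 _) (kC 0).
apply/eqP; rewrite -subr_eq0; apply/eqP; rewrite -/k.
have c12 : (poisson e u)%:C = c2^-1 - c1^-1.
  have cc : c1 * c2 = (- (e ^+ 2 + b ^+ 2))%:C.
    by apply: complexP; rewrite ?Re_mul ?Im_mul /=; ring.
  apply: (mulfI (mulf_neq0 c10 c20)).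
  have -> : c1 * c2 * (c2^-1 - c1^-1) = c1 - c2 by field; rewrite c10 c20.
  have bE : e ^+ 2 + b ^+ 2 != 0 by rewrite gt_eqF // ltr_pwDl ?sqr_ge0 // exprn_gt0.
  rewrite cc -(rmorphM (real_complex R)) /poisson -/b mulNr mulrC divfK //.
  by apply: complexP => /=; ring.
apply: (@cabs_le_eps _ _ (2 * C + (cabs c1)^-1 * C + (cabs c2)^-1 * C)) => eps eps0.
have [L1 L10 H1] := arctan_tail eps0.
have [L2 L20 H2] := cauchy_kernel_tail eps0.
pose L := Num.max L1 L2.
have LL1 : L1 <= L by rewrite le_max lexx.
have LL2 : L2 <= L by rewrite le_max lexx orbT.
have L0 : 0 < L := lt_le_trans L10 LL1.
have A := cint_line_approx L0 ck kC (fun s _ => dV s).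
have VL : V L = (k L - 1) / c1 by rewrite kE /V ltW.
have VN : V (- L) = (k (- L) - 1) / c2 by rewrite kE /V lt_geF // oppr_lt0.
have -> : cint lam k - (poisson e u)%:C =
  (cint lam k - (V L - V (- L))) + k L / c1 - k (- L) / c2.
  by rewrite c12 VL VN; ring.
have kN : cauchy_kernel (- L) <= eps.
  by rewrite /cauchy_kernel /oneDsqr sqrrN; exact: H2.
apply: le_trans (cabsB _ _) _; rewrite [leRHS]mulrDl; apply: lerD; last first.
  rewrite cabsM cabsV mulrC -mulrA ler_wpM2l ?invr_ge0 ?cabs_ge0 //.
  by apply: le_trans (kC _) _; rewrite ler_wpM2l.
apply: le_trans (cabsD _ _) _; rewrite [leRHS]mulrDl; apply: lerD; last first.
  rewrite cabsM cabsV mulrC -mulrA ler_wpM2l ?invr_ge0 ?cabs_ge0 //.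
  by apply: le_trans (kC _) _; rewrite ler_wpM2l // H2.
by apply: le_trans A _; rewrite ler_wpM2l ?mulr_ge0 // H1.
Qed.

Lemma continuous_poisson e a : 0 < e -> continuous (fun x => poisson e (x - a)).
Proof.
move=> e0 x; apply: cvgMr; apply: cvgV.
  by rewrite gt_eqF // ltr_pwDl ?sqr_ge0 // exprn_gt0.
apply: cvgD; first exact: cvg_cst.
apply: (@cvg_comp _ _ _ (fun x => 2 * pi * (x - a)) (fun y => y ^+ 2)); last first.
  exact: exprn_continuous.
by apply: cvgMr; apply: cvgB; [exact: cvg_id|exact: cvg_cst].
Qed.

Lemma pi_ge1 : 1 <= pi :> R.
Proof. by have := @pi_ge2 R; lra. Qed.

(** The constant is unbounded as e tends to 0: this bound serves integrability
    only. *)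
Lemma poisson_bound e a : 0 < e -> exists C, forall x,
  `|poisson e (x - a)| <= C * cauchy_kernel x.
Proof.
move=> e0; pose D : R := (1 + 2 * a ^+ 2) / e ^+ 2 + 2.
exists (2 * e * D) => x; rewrite ger0_norm ?poisson_ge0 // /poisson /cauchy_kernel.
rewrite -[leRHS]mulrA ler_pM2l ?mulr_gt0 //.
have p1 := pi_ge1; have e2 : 0 < e ^+ 2 by rewrite exprn_gt0.
set v := (2 * pi * _) ^+ 2.
have v0 : 0 <= v by rewrite sqr_ge0.
have vx : (x - a) ^+ 2 <= v.
  rewrite /v exprMn ler_peMl ?sqr_ge0 // expr2; nra.
rewrite ler_pdivlMr; last by rewrite (lt_le_trans ltr01) // oneDsqr_ge1.
rewrite mulrC ler_pdivrMr; last by rewrite ltr_pwDl.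
rewrite /oneDsqr /D.
have -> : ((1 + 2 * a ^+ 2) / e ^+ 2 + 2) * (e ^+ 2 + v) =
  (1 + 2 * a ^+ 2) + 2 * e ^+ 2 + (1 + 2 * a ^+ 2) / e ^+ 2 * v + 2 * v.
  by field; rewrite gt_eqF.
have : 0 <= (1 + 2 * a ^+ 2) / e ^+ 2 * v.
  have q0 : 0 <= 1 + 2 * a ^+ 2 by have := sqr_ge0 a; lra.
  by rewrite mulr_ge0 // divr_ge0 // ltW.
have := sqr_ge0 (x - 2 * a); nra.
Qed.

(** The primitive atan (2 pi (x - a) / e) / pi has total variation 1. *)
Lemma Rintegral_poisson e a : 0 < e -> \int[lam]_x poisson e (x - a) = 1.
Proof.
move=> e0; have [C HC] := poisson_bound a e0.
have p0 : 0 < pi :> R := pi_gt0 R.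
pose U (x : R) : R := pi^-1 * atan (2 * pi / e * (x - a)).
have dU x : is_derive x 1 U (poisson e (x - a)).
  have -> : poisson e (x - a) = pi^-1 * ((1 + (2 * pi / e * (x - a)) ^+ 2)^-1 * (2 * pi / e)).
    have p0' := gt_eqF p0; rewrite /poisson.
    have W : e ^+ 2 + (2 * pi * (x - a)) ^+ 2 != 0.
      by rewrite gt_eqF // ltr_pwDl ?sqr_ge0 // exprn_gt0.
    move: (pi : R) p0' W => p p0' W; field.
    by rewrite gt_eqF //= p0' /= W.
  have da : is_derive x 1 (fun x : R => 2 * pi / e * (x - a)) (2 * pi / e).
    have := is_deriveZ (2 * pi / e)
      (is_deriveB (is_derive_id x (1 : R)) (is_derive_cst a x (1 : R))).
    by rewrite subr0 /GRing.scale /= mulr1.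
  have := @is_derive1_comp R atan (fun x : R => 2 * pi / e * (x - a)) x _ _
    (is_derive1_atan _) da.
  by move=> /(is_deriveZ pi^-1); rewrite /GRing.scale /=.
apply/eqP; rewrite -subr_eq0 -normr_eq0 eq_le normr_ge0 andbT.
have Ua : 0 < 2 * pi / e by rewrite divr_gt0 // mulr_gt0.
apply: (@le0_mul_eps _ _ (C + 2 / pi)) => eps eps0.
have [L1 L10 H1] := arctan_tail eps0.
pose M : R := (L1 / (2 * pi / e)).
pose L := Num.max L1 (M + `|a|).
have M0 : 0 < M by rewrite divr_gt0.
have LL1 : L1 <= L by rewrite le_max lexx.
have LM : M + `|a| <= L by rewrite le_max lexx orbT.
have L0 : 0 < L := lt_le_trans L10 LL1.
have C0 : 0 <= C := cauchy_kernel_bound_ge0 (normr_ge0 _) (HC 0).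
have A := Rintegral_line_approx L0 (@continuous_poisson e a e0) HC (fun s _ => dU s).
have at_ v : M <= v -> pi - 2 * atan (2 * pi / e * v) <= eps.
  by move=> Mv; apply: H1; rewrite -ler_pdivrMl // mulrC.
have a1 : pi - 2 * atan (2 * pi / e * (L - a)) <= eps.
  by apply: at_; have := ler_norm a; lra.
have a2 : pi - 2 * atan (2 * pi / e * (L + a)) <= eps.
  by apply: at_; have := ler_norm (- a); rewrite normrN; lra.
have lepi (v : R) : 2 * atan v <= pi by have := atan_ltpi2 v; lra.
have UL : `|U L - U (- L) - 1| <= 2 / pi * eps.
  have -> : U L - U (- L) - 1 = - (2 * pi)^-1 * ((pi - 2 * atan (2 * pi / e * (L - a)))
      + (pi - 2 * atan (2 * pi / e * (L + a)))).
    rewrite /U (_ : 2 * pi / e * (- L - a) = - (2 * pi / e * (L + a))); last by ring.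
    rewrite atanN; move: (atan _) (atan _) => A1 A2.
    by move: (pi : R) (gt_eqF p0) => p p1; field; rewrite p1.
  have b1 := lepi (2 * pi / e * (L - a)); have b2 := lepi (2 * pi / e * (L + a)).
  rewrite normrM normrN (gtr0_norm (_ : 0 < (2 * pi)^-1)) ?invr_gt0 ?mulr_gt0 //.
  rewrite ger0_norm; last lra.
  apply: (@le_trans _ _ ((2 * pi)^-1 * (eps + eps))).
    rewrite ler_pM2l ?invr_gt0 ?mulr_gt0 //; lra.
  have -> : (2 * pi)^-1 * (eps + eps) = pi^-1 * eps.
    by move: (pi : R) (gt_eqF p0) => p p1; field; rewrite p1.
  rewrite ler_pM2r // ler_peMl ?invr_ge0 ?ltW //.
  by rewrite ltr1n.
have -> : \int[lam]_x poisson e (x - a) - 1 =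
  (\int[lam]_x poisson e (x - a) - (U L - U (- L))) + (U L - U (- L) - 1) by ring.
rewrite mulrDl; apply: le_trans (ler_normD _ _) _; apply: lerD => //.
by apply: le_trans A _; rewrite ler_wpM2l // H1.
Qed.

End PoissonKernel.

(** * Fourier inversion *)

Section FourierInversion.
Context {R : realType}.
Notation lam := (@lebesgue_measure R).
Notation leb := (lebesgue_tuple R).
Notation Rm := (measurableTypeR R).

Definition tdot n (x y : n.-tuple Rm) : R := \sum_(j < n) tnth x j * tnth y j.

Lemma measurable_tdot n d (T : measurableType d) (f g : T -> n.-tuple Rm) :
  measurable_fun setT f -> measurable_fun setT g ->
  measurable_fun setT (fun t => tdot (f t) (g t)).
Proof.
move=> mf mg; apply: measurable_sum => j.
by apply: measurable_funM; [exact: measurableT_comp (measurable_tnth _) mf|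
  exact: measurableT_comp (measurable_tnth _) mg].
Qed.

Lemma Rintegral_prod n (k : 'I_n -> R -> R) :
  (forall j, measurable_fun [set: Rm] (k j)) ->
  (forall j, exists C, forall s, `|k j s| <= C * cauchy_kernel s) ->
  rintegrable (leb n) (fun t => \prod_(j < n) k j (tnth t j)) /\
  Rintegral (leb n) setT (fun t => \prod_(j < n) k j (tnth t j)) =
  \prod_(j < n) \int[lam]_s k j s.
Proof.
move=> mk bk.
have mk' j : cmeas (fun s : Rm => (k j s)%:C) by exact: cmeas_real (mk j).
have bk' j : exists C, forall s, cabs (k j s)%:C <= C * cauchy_kernel s.
  by have [C HC] := bk j; exists C => s; rewrite cabsR.
have [r E] := @cint_prod R n (fun j s => (k j s)%:C) mk' bk'.
have prodC (F : 'I_n -> R) : \prod_(j < n) (F j)%:C = (\prod_(j < n) F j)%:C.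
  by rewrite (rmorph_prod (real_complex R)).
have [i1 _] := rapid_cintegrable r.
have E1 : (fun t : n.-tuple Rm => complex.Re (\prod_(j < n) (k j (tnth t j))%:C)) =
  fun t => \prod_(j < n) k j (tnth t j) by apply/funext => t; rewrite prodC.
split; first by move: i1; rewrite E1.
have := congr1 (@complex.Re R) E; rewrite /= E1 => ->.
have E2 j : cint lam (fun s : Rm => (k j s)%:C) = (\int[lam]_s k j s)%:C.
  by rewrite /cint /=; congr Complex; rewrite Rintegral_cst // mul0r.
by under eq_bigr do rewrite E2; rewrite prodC.
Qed.

Lemma Rintegral_sum d (T : measurableType d) (mu : {measure set T -> \bar R})
    (I : Type) (r : seq I) (F : I -> T -> R) : (forall i, rintegrable mu (F i)) ->
  rintegrable mu (fun t => \sum_(i <- r) F i t) /\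
  Rintegral mu setT (fun t => \sum_(i <- r) F i t) = \sum_(i <- r) \int[mu]_t F i t.
Proof.
move=> iF; elim: r => [|i r [IH1 IH2]].
  rewrite big_nil (_ : (fun t => _) = fun=> 0); last by apply/funext => t; rewrite big_nil.
  by split; [exact: integrable0|rewrite Rintegral_cst // mul0r].
rewrite big_cons (_ : (fun t => _) = fun t => F i t + \sum_(i <- r) F i t); last first.
  by apply/funext => t; rewrite big_cons.
split; first exact: rintegrableD.
by rewrite RintegralD ?IH2 //; exact: iF.
Qed.

Definition box_cutoff n (e : R) (x : n.-tuple Rm) : R :=
  \prod_(j < n) exp_cutoff e (tnth x j).

Lemma box_cutoff_exp n e (x : n.-tuple Rm) :
  box_cutoff e x = expR (- (e * \sum_(j < n) `|tnth x j|)).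
Proof.
rewrite /box_cutoff /exp_cutoff mulr_sumr -sumrN.
by elim/big_rec2 : _ => [|i a b _ ->]; rewrite ?expR0 // expRD.
Qed.

Lemma box_cutoff_ge0 n e (x : n.-tuple Rm) : 0 <= box_cutoff e x.
Proof. by rewrite box_cutoff_exp expR_ge0. Qed.

Lemma box_cutoffB1 n e (x : n.-tuple Rm) : 0 < e ->
  `|1 - box_cutoff e x| <= e * \sum_(j < n) `|tnth x j|.
Proof.
move=> e0; rewrite box_cutoff_exp; set S := \sum_(j < n) _.
have S0 : 0 <= e * S by apply: mulr_ge0; [exact: ltW|exact: sumr_ge0].
rewrite ger0_norm; first by have := expR_ge1Dx (- (e * S)); lra.
by rewrite subr_ge0 -[leRHS]expR0 ler_expR oppr_le0.
Qed.

Lemma measurable_box_cutoff n e : measurable_fun [set: n.-tuple Rm] (box_cutoff e).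
Proof.
apply: measurable_prod => j _.
have m1 : measurable_fun [set: Rm] (exp_cutoff e).
  exact: continuous_measurable_fun (@continuous_exp_cutoff R e).
exact: measurableT_comp m1 (measurable_tnth _).
Qed.

(** The factor e is what makes the mass of the Poisson kernel concentrate at 0
    as e tends to 0. *)
Lemma poisson_far (d e v : R) : 0 < d -> 0 < e -> d <= `|v| ->
  poisson e v <= e * (2 * (1 + (d ^+ 2)^-1)) * cauchy_kernel v.
Proof.
move=> d0 e0 dv; have p1 := @pi_ge1 R.
have v2 : d ^+ 2 <= v ^+ 2.
  rewrite -(real_normK (num_real v)); by apply: lerXn2r; rewrite ?nnegrE // ltW.
have d2 : 0 < d ^+ 2 by rewrite exprn_gt0.
have v0 : 0 < v ^+ 2 by exact: lt_le_trans v2.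
apply: (@le_trans _ _ (2 * e * (v ^+ 2)^-1)).
  rewrite /poisson ler_pM2l ?mulr_gt0 // lef_pV2 ?posrE //; last first.
    by rewrite ltr_pwDl ?sqr_ge0 // exprn_gt0.
  have : v ^+ 2 <= (2 * pi * v) ^+ 2.
    by rewrite [leRHS]exprMn ler_peMl ?sqr_ge0 // expr2; nra.
  have := sqr_ge0 e; lra.
have -> : e * (2 * (1 + (d ^+ 2)^-1)) * cauchy_kernel v =
  2 * e * ((1 + (d ^+ 2)^-1) * cauchy_kernel v) by ring.
rewrite ler_pM2l ?mulr_gt0 // /cauchy_kernel ler_pdivlMr; last first.
  by rewrite (lt_le_trans ltr01) // oneDsqr_ge1.
rewrite mulrC ler_pdivrMr // /oneDsqr mulrDl mul1r addrC lerD2l.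
by rewrite mulrC ler_pdivlMr // mul1r.
Qed.

Section Inversion.
Variables (n : nat) (h : n.-tuple Rm -> R[i]).
Hypotheses (hr : rapid h).

Lemma cmeas_tdot_phase (x : n.-tuple Rm) : cmeas (fun xi => phase (2 * pi * tdot x xi)).
Proof.
apply: cmeas_phase; apply: measurable_funM => //.
by apply: measurable_tdot => //; exact: measurable_cst.
Qed.

Definition fourier_inv (x : n.-tuple Rm) : R[i] :=
  cint (leb n) (fun xi => h xi * phase (2 * pi * tdot x xi)).

Lemma fourier_inv_bound : exists C, forall x, cabs (fourier_inv x) <= C.
Proof.
have [mh [C hC]] := hr; exists (2 * \int[leb n]_t (C * kernel_prod t)) => x.
apply: cint_norm_le.
- exact: cmeasM mh (cmeas_tdot_phase x).
- exact: rintegrableZl (rintegrable_kernel_prod n).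
- by move=> t; rewrite cabsM cabs_phase mulr1.
Qed.

(** With the cutoff the double integral converges absolutely; integrating in x
    first turns the cutoff into Poisson kernels. *)
Lemma fourier_inv_cutoff a e : 0 < e ->
  cint (leb n) (fun x => (box_cutoff e x)%:C * (fourier_inv x * phase (- (2 * pi * tdot x a)))) =
  cint (leb n) (fun xi => h xi * (\prod_(j < n) poisson e (tnth xi j - tnth a j))%:C).
Proof.
move=> e0; have [mh [C hC]] := hr.
have C0 := rapid_bound_ge0 hC.
pose K : R := 1 + 4 / e ^+ 2.
have K0 : 0 <= K by rewrite addr_ge0 // divr_ge0 // sqr_ge0.
have cutK (x : n.-tuple Rm) : box_cutoff e x <= K ^+ n * kernel_prod x.
  rewrite -[X in K ^+ X]card_ord -prodr_const -big_split /=.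
  by apply: ler_prod => j _; rewrite exp_cutoff_ge0 exp_cutoff_bound.
pose H (p : n.-tuple Rm * n.-tuple Rm) : R[i] :=
  (box_cutoff e p.1)%:C * (h p.2 * phase (2 * pi * tdot p.1 p.2) * phase (- (2 * pi * tdot p.1 a))).
have mH : cmeas H.
  apply: cmeasM.
    by apply: cmeas_real; exact: measurableT_comp (measurable_box_cutoff e) measurable_fst.
  apply: cmeasM; last first.
    apply: cmeas_phase; apply: measurable_funN; apply: measurable_funM => //.
    by apply: measurable_tdot => //; exact: measurable_cst.
  apply: cmeasM; first exact: cmeas_comp mh measurable_snd.
  by apply: cmeas_phase; apply: measurable_funM => //; exact: measurable_tdot.
have bH x y : cabs (H (x, y)) <= K ^+ n * kernel_prod x * (C * kernel_prod y).
  rewrite /H cabsM cabsM cabsM cabs_phase cabs_phase !mulr1 cabsR ger0_norm ?box_cutoff_ge0 //.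
  by apply: ler_pM; rewrite ?box_cutoff_ge0 ?cabs_ge0.
have k1 (x : n.-tuple Rm) : 0 <= K ^+ n * kernel_prod x.
  by rewrite mulr_ge0 ?exprn_ge0 // kernel_prod_ge0.
have k2 (x : n.-tuple Rm) : 0 <= C * kernel_prod x by rewrite mulr_ge0 // kernel_prod_ge0.
have ik1 := rintegrableZl (K ^+ n) (@rintegrable_kernel_prod R n).
have ik2 := rintegrableZl C (@rintegrable_kernel_prod R n).
have F1 := cfubini1 k1 k2 ik1 ik2 mH bH.
have F2 := cfubini2 k1 k2 ik1 ik2 mH bH.
transitivity (cint (leb n \x leb n)%E H).
  rewrite F1; apply: eq_cint => x.
  rewrite /H /= /fourier_inv.
  rewrite [RHS](@eq_cint _ _ _ _ _ (fun y : n.-tuple Rm =>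
    ((box_cutoff e x)%:C * phase (- (2 * pi * tdot x a))) *
    (h y * phase (2 * pi * tdot x y)))); last by move=> y; ring.
  rewrite cintZl; first by ring.
  apply: (dominated_cintegrable _ ik2); first exact: cmeasM mh (cmeas_tdot_phase x).
  by move=> t; rewrite cabsM cabs_phase mulr1.
rewrite F2; apply: eq_cint => y.
pose k j (s : R) : R[i] := (exp_cutoff e s)%:C * phase (2 * pi * (s * (tnth y j - tnth a j))).
have mk j : cmeas (k j : Rm -> R[i]).
  apply: cmeasM.
    apply: cmeas_real; exact: continuous_measurable_fun (@continuous_exp_cutoff R e).
  by apply: cmeas_phase; apply: measurable_funM => //; exact: measurable_funM.
have bk j : exists C, forall s, cabs (k j s) <= C * cauchy_kernel s.
  exists K => s.
  by rewrite cabsM cabs_phase mulr1 cabsR ger0_norm ?exp_cutoff_ge0 ?exp_cutoff_bound.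
have [rk Ek] := cint_prod mk bk.
rewrite (@eq_cint _ _ _ _ _ (fun x : n.-tuple Rm => h y * \prod_(j < n) k j (tnth x j))).
  rewrite cintZl; last exact: rapid_cintegrable.
  rewrite Ek; congr (_ * _); rewrite (rmorph_prod (real_complex R)).
  by apply: eq_bigr => j _; exact: cint_exp_cutoff.
move=> x; rewrite /H /= /k big_split /= -phase_sum -mulrA -phaseD mulrCA; congr (_ * (_ * _)).
  by rewrite /box_cutoff (rmorph_prod (real_complex R)).
congr phase; rewrite -mulrBr /tdot -sumrB -mulr_sumr; congr (_ * _).
by apply: eq_bigr => j _; rewrite mulrBr.
Qed.

(** The product of the Poisson kernels has mass 1. Where all the coordinates of
    xi are d-close to those of a, h xi is eta-close to h a. Elsewhere some
    coordinate i is d-far, and [poisson_far] trades the i-th Poisson factor for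
    e times a Cauchy kernel; the sum over i of the products so obtained has an
    integral that does not depend on e. *)
Lemma poisson_approx a eta : tcont h -> 0 < eta -> exists K, forall e, 0 < e ->
  cabs (cint (leb n) (fun xi => h xi * (\prod_(j < n) poisson e (tnth xi j - tnth a j))%:C) - h a)
    <= 2 * eta + e * K.
Proof.
move=> hc eta0; have [mh [C hC]] := hr.
have C0 := rapid_bound_ge0 hC.
have hC1 t : cabs (h t) <= C.
  by apply: le_trans (hC t) _; rewrite ler_piMr // kernel_prod_le1.
have [d d0 Hd] := hc a eta eta0.
pose D : R := 2 * (1 + (d ^+ 2)^-1).
have D0 : 0 <= D by rewrite mulr_ge0 // addr_ge0 // invr_ge0 sqr_ge0.
pose q (b s : R) : R := cauchy_kernel (s - b).
have mP e (b : R) : 0 < e -> measurable_fun [set: Rm] (fun s => poisson e (s - b)).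
  by move=> e0; exact: continuous_measurable_fun (@continuous_poisson R e b e0).
have qP (b s : R) : q b s <= (1 + 2 * (1 + b ^+ 2)) * cauchy_kernel s.
  rewrite /q /cauchy_kernel ler_pdivlMr; last by rewrite (lt_le_trans ltr01) // oneDsqr_ge1.
  rewrite mulrC ler_pdivrMr; last by rewrite (lt_le_trans ltr01) // oneDsqr_ge1.
  rewrite /oneDsqr; have := sqr_ge0 (s - 2 * b); have := sqr_ge0 (s - b).
  have : 0 <= b ^+ 2 * (s - b) ^+ 2 by rewrite mulr_ge0 // sqr_ge0.
  nra.
have q0 b s : 0 <= q b s by exact: cauchy_kernel_ge0.
have cq b : continuous (q b).
  move=> s; apply: (@continuous_comp _ _ _ (fun x => x - b)).
    by apply: cvgB; [exact: cvg_id|exact: cvg_cst].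
  exact: continuous_cauchy_kernel.
(* The factors of the Poisson product, the i-th one being replaced by a Cauchy
   kernel. *)
pose k e (i j : 'I_n) (s : R) : R :=
  if j == i then q (tnth a j) s else poisson e (s - tnth a j).
have mk e i j : 0 < e -> measurable_fun [set: Rm] (k e i j).
  move=> e0; rewrite /k; case: (j == i); last exact: mP.
  exact: continuous_measurable_fun (cq _).
have bk e i j : 0 < e -> exists C, forall s, `|k e i j s| <= C * cauchy_kernel s.
  move=> e0; rewrite /k; case: (j == i); last exact: poisson_bound.
  by eexists => s; rewrite ger0_norm ?q0 //; exact: qP.
pose Q (i : 'I_n) := \int[lam]_s q (tnth a i) s.
exists (2 * (2 * C * D * \sum_i Q i)) => e e0.
have [iP EP] := Rintegral_prod (fun j => mP e (tnth a j) e0) (fun j => poisson_bound (tnth a j) e0).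
have {}EP : Rintegral (leb n) setT (fun t => \prod_(j < n) poisson e (tnth t j - tnth a j)) = 1.
  by rewrite EP; under eq_bigr do rewrite Rintegral_poisson //; rewrite big1.
pose P t := \prod_(j < n) poisson e (tnth t j - tnth a j).
have P0 t : 0 <= P t by apply: prodr_ge0 => j _; exact: poisson_ge0.
have mPP : measurable_fun setT P.
  by apply: measurable_prod => j _; exact: measurableT_comp (mP e _ e0) (measurable_tnth _).
have kP i := Rintegral_prod (fun j => mk e i j e0) (fun j => bk e i j e0).
have Ek i : Rintegral (leb n) setT (fun t => \prod_(j < n) k e i j (tnth t j)) = Q i.
  rewrite (kP i).2 (bigD1 i) //= big1 ?mulr1; first by rewrite /k eqxx.
  by move=> j /negbTE ji; rewrite /k ji Rintegral_poisson.
have iPc : cintegrable (leb n) (fun t => (P t)%:C).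
  by apply: (dominated_cintegrable _ iP); [exact: cmeas_real|move=> t; rewrite cabsR ger0_norm].
have ihP : cintegrable (leb n) (fun t => h t * (P t)%:C).
  apply: (dominated_cintegrable _ (rintegrableZl C iP)).
    by apply: cmeasM => //; exact: cmeas_real.
  by move=> t; rewrite cabsM cabsR ger0_norm // ler_wpM2r.
have -> : h a = cint (leb n) (fun t => h a * (P t)%:C).
  rewrite cintZl // (_ : cint _ _ = 1) ?mulr1 //.
  by apply: complexP => /=; [exact: EP|rewrite Rintegral_cst // mul0r].
rewrite -cintB //; last first.
  apply: (dominated_cintegrable _ (rintegrableZl C iP)).
    by apply: cmeasM; [exact: cmeas_cst|exact: cmeas_real].
  by move=> t; rewrite cabsM cabsR ger0_norm // ler_wpM2r.
have isum := Rintegral_sum (index_enum 'I_n) (fun i => (kP i).1).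
have major t : cabs (h t * (P t)%:C - h a * (P t)%:C) <=
    eta * P t + 2 * C * (e * D) * \sum_i \prod_(j < n) k e i j (tnth t j).
  have k0 i : 0 <= \prod_(j < n) k e i j (tnth t j).
    by apply: prodr_ge0 => j _; rewrite /k; case: ifP => _; [exact: q0|exact: poisson_ge0].
  rewrite -mulrBl cabsM cabsR ger0_norm //.
  have [near|/existsNP[i /negP]] := pselect (forall j, `|tnth a j - tnth t j| < d).
    apply: ler_wpDr.
      apply: mulr_ge0; last by apply: sumr_ge0 => i _; exact: k0.
      by apply: mulr_ge0; apply: mulr_ge0 => //; exact: ltW.
    by apply: ler_wpM2r => //; rewrite -cabsN opprB; exact: Hd.
  rewrite -leNgt => di; apply: ler_wpDl; first by rewrite mulr_ge0 // ltW.
  apply: (@le_trans _ _ (2 * C * (e * D * \prod_(j < n) k e i j (tnth t j)))).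
    apply: ler_pM; rewrite ?cabs_ge0 //.
      by apply: le_trans (cabsB _ _) _; have := hC1 t; have := hC1 a; lra.
    have -> : \prod_(j < n) k e i j (tnth t j) = q (tnth a i) (tnth t i) *
        \prod_(j < n | j != i) poisson e (tnth t j - tnth a j).
      by rewrite (bigD1 i) //= /k eqxx; congr (_ * _)%R; apply: eq_bigr => j /negbTE ->.
    rewrite /P (bigD1 i) //= mulrA; apply: ler_wpM2r.
      by apply: prodr_ge0 => j _; exact: poisson_ge0.
    by apply: poisson_far => //; rewrite distrC.
  rewrite -[leRHS]mulrA; apply: ler_wpM2l; first by rewrite mulr_ge0.
  apply: ler_wpM2l; first by apply: mulr_ge0 => //; exact: ltW.
  by rewrite [leRHS](bigD1 i) //= lerDl; apply: sumr_ge0 => l _; exact: k0.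
have [isum1 isum2] := isum; rewrite (eq_bigr _ (fun i _ => Ek i)) in isum2.
apply: le_trans (cint_norm_le _ _ major) _.
- by apply: cmeasB; apply: cmeasM => //; try exact: cmeas_real; exact: cmeas_cst.
- by apply: rintegrableD; exact: rintegrableZl.
rewrite RintegralD //; try exact: rintegrableZl.
rewrite !RintegralZl // EP isum2 mulr1.
by rewrite le_eqVlt; apply/orP; left; apply/eqP; ring.
Qed.

(** Since the inverse transform vanishes outside a cube, removing the cutoff of
    [fourier_inv_cutoff] costs O(e); with the cutoff, [poisson_approx] gives h a
    up to 2 eta + O(e). *)
Theorem fourier_inversion (L : R) (a : n.-tuple Rm) : tcont h -> cmeas fourier_inv ->
  (forall x, (exists j, L < `|tnth x j|) -> fourier_inv x = 0) ->
  cint (leb n) (fun x => fourier_inv x * phase (- (2 * pi * tdot x a))) = h a.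
Proof.
move=> hc mf f0; have [C fC] := fourier_inv_bound.
pose M : R := Num.max L 0.
have M0 : 0 <= M by rewrite le_max lexx orbT.
have C0 : 0 <= C := le_trans (cabs_ge0 _) (fC [tuple 0 | _ < n]).
pose B : R := C * (1 + M ^+ 2) ^+ n.
have fB x : cabs (fourier_inv x) <= B * kernel_prod x.
  have kp0 := kernel_prod_ge0 x.
  have [|/forallNP in_box] := pselect (exists j, L < `|tnth x j|).
    by move=> /f0 ->; rewrite cabs0 !mulr_ge0 // exprn_ge0 // addr_ge0 // sqr_ge0.
  apply: le_trans (fC x) _; rewrite /B -mulrA ler_peMr // kernel_prod_box // => j.
  by rewrite le_max leNgt; apply/orP; left; apply/negP; exact: in_box.
pose F x := fourier_inv x * phase (- (2 * pi * tdot x a)).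
have mF : cmeas F.
  apply: cmeasM => //; apply: cmeas_phase; apply: measurable_funN; apply: measurable_funM => //.
  by apply: measurable_tdot => //; exact: measurable_cst.
have FB x : cabs (F x) <= B * kernel_prod x by rewrite cabsM cabs_phase mulr1.
have iF : cintegrable (leb n) F.
  exact: dominated_cintegrable mF (rintegrableZl B (@rintegrable_kernel_prod R n)) FB.
apply/eqP; rewrite -subr_eq0; apply/eqP; rewrite -/F.
pose J := 2 * \int[leb n]_x ((n%:R * M * B) * kernel_prod x).
apply: (@cabs_le_eps _ _ 4) => eta eta0.
have [K HK] := poisson_approx a hc eta0.
(* With this e, both error terms e * K and e * J are at most eta. *)
pose e : R := eta / (`|K| + `|J| + 1).
have KJ : 0 < `|K| + `|J| + 1 by rewrite ltr_wpDl // addr_ge0.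
have e0 : 0 < e by rewrite divr_gt0.
have := HK e e0; rewrite -fourier_inv_cutoff // -/F => A2.
have iEF : cintegrable (leb n) (fun x => (box_cutoff e x)%:C * F x).
  apply: (dominated_cintegrable _ (rintegrableZl B (@rintegrable_kernel_prod R n))).
    by apply: cmeasM => //; apply: cmeas_real; exact: measurable_box_cutoff.
  move=> x; rewrite cabsM cabsR ger0_norm ?box_cutoff_ge0 //.
  apply: le_trans _ (FB x); rewrite ler_piMl ?cabs_ge0 //.
  by rewrite box_cutoff_exp -[leRHS]expR0 ler_expR oppr_le0 mulr_ge0 ?sumr_ge0 // ltW.
have A1 : cabs (cint (leb n) F - cint (leb n) (fun x => (box_cutoff e x)%:C * F x)) <= e * J.
  rewrite -cintB //.
  rewrite /J mulrCA -RintegralZl //; last by exact: rintegrableZl (rintegrable_kernel_prod n).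
  apply: cint_norm_le.
  - apply: cmeasB => //; apply: cmeasM => //; apply: cmeas_real; exact: measurable_box_cutoff.
  - by apply: rintegrableZl; apply: rintegrableZl; exact: rintegrable_kernel_prod.
  move=> x.
  have -> : F x - (box_cutoff e x)%:C * F x = (1 - box_cutoff e x)%:C * F x.
    by rewrite (rmorphB (real_complex R)) rmorph1; ring.
  have [|/forallNP in_box] := pselect (exists j, L < `|tnth x j|).
    move=> /f0; rewrite /F => ->; rewrite mul0r mulr0 cabs0 !mulr_ge0 ?exprn_ge0 ?ler0n //.
    - exact: ltW.
    - by rewrite addr_ge0 // sqr_ge0.
    - exact: kernel_prod_ge0.
  rewrite cabsM cabsR.
  apply: (@le_trans _ _ ((e * (n%:R * M)) * (B * kernel_prod x))); last first.
    by rewrite le_eqVlt; apply/orP; left; apply/eqP; ring.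
  apply: ler_pM; rewrite ?cabs_ge0 //.
  apply: le_trans (box_cutoffB1 x e0) _; rewrite ler_pM2l //.
  apply: (@le_trans _ _ (\sum_(j < n) M)).
    apply: ler_sum => j _; rewrite le_max leNgt; apply/orP; left; apply/negP; exact: in_box.
  by rewrite sumr_const card_ord mulr_natl.
have -> : cint (leb n) F - h a =
  (cint (leb n) F - cint (leb n) (fun x => (box_cutoff e x)%:C * F x))
  + (cint (leb n) (fun x => (box_cutoff e x)%:C * F x) - h a) by ring.
apply: le_trans (cabsD _ _) _; apply: le_trans (lerD A1 A2) _.
have eJ x : `|x| <= `|K| + `|J| -> e * x <= eta.
  move=> xJ; rewrite /e mulrAC ler_pdivrMr // ler_pM2l //.
  by have := ler_norm x; lra.
have := eJ J; rewrite lerDr => /(_ (normr_ge0 _)).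
have := eJ K; rewrite lerDl => /(_ (normr_ge0 _)).
lra.
Qed.

End Inversion.

End FourierInversion.

(** * Functions of exponential type: shift of the integral and support *)

Lemma sum_sqr_le (R : realType) (I : finType) (F : I -> R) : (forall i, 0 <= F i) ->
  \sum_i F i ^+ 2 <= (\sum_i F i) ^+ 2.
Proof.
move=> F0.
have [] // : 0 <= \sum_i F i /\ \sum_i F i ^+ 2 <= (\sum_i F i) ^+ 2.
apply: (big_ind2 (fun a b : R => 0 <= a /\ b <= a ^+ 2)) => [|a b c d [a0 ba] [c0 dc]|//].
  by rewrite expr0n.
by split; [exact: addr_ge0|nra].
Qed.

Section StripShift.
Context {R : realType}.
Notation lam := (@lebesgue_measure R).
Notation leb := (lebesgue_tuple R).
Notation Rm := (measurableTypeR R).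

Definition ctup n (xi eta : n.-tuple Rm) : 'cV[R[i]]_n :=
  \col_j ((tnth xi j : R) +i* (tnth eta j : R)).

Definition tzero n : n.-tuple Rm := [tuple (0 : R) | _ < n].

Lemma ctup_tset n (xi eta : n.-tuple Rm) j (s y : R) :
  ctup (tset xi j s) (tset eta j y) =
  ctup (tset xi j 0) (tset eta j 0) + (s +i* y) *: delta_mx j 0.
Proof.
apply/matrixP => i k; rewrite (ord1 k) !mxE !tnth_mktuple eqxx andbT.
case: (i == j); last by rewrite mulr0 addr0.
by rewrite mulr1; apply: complexP; rewrite ?Re_add ?Im_add /= add0r.
Qed.

Lemma tset_id n (t : n.-tuple Rm) j : tset t j (tnth t j) = t.
Proof.
by apply: eq_from_tnth => i; rewrite tnth_mktuple; case: eqP => // ->.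
Qed.

Lemma kernel_prod_tset n (t : n.-tuple Rm) j (s : R) :
  kernel_prod (tset t j s) <= cauchy_kernel s.
Proof.
rewrite /kernel_prod (bigD1 j) //= tnth_mktuple eqxx ler_piMr ?cauchy_kernel_ge0 //.
apply: (@le_trans _ _ (\prod_(i < n | i != j) (1 : R))); last by rewrite big1_eq.
by apply: ler_prod => i _; rewrite cauchy_kernel_ge0 cauchy_kernel_le1.
Qed.

Section Shift.
Variables (n : nat) (F : 'cV[R[i]]_n -> R[i]).
Hypothesis Fmeas : forall eta : n.-tuple Rm, cmeas (fun xi => F (ctup xi eta)).
Hypothesis Fhol : forall z j, holomorphic (fun s => F (z + s *: delta_mx j 0)).
Hypothesis Fstrip : forall M : R, exists C : R, forall xi eta : n.-tuple Rm,
  (forall j, `|tnth eta j| <= M) -> cabs (F (ctup xi eta)) <= C * kernel_prod xi.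

Let norm_le (eta : n.-tuple Rm) j : `|tnth eta j| <= \sum_i `|tnth eta i|.
Proof. by rewrite (bigD1 j) //= lerDl sumr_ge0. Qed.

Lemma strip_rapid eta : rapid (fun xi => F (ctup xi eta)).
Proof.
split; first exact: Fmeas.
have [C HC] := Fstrip (\sum_i `|tnth eta i|).
by exists C => t; apply: HC.
Qed.

(** On each line parallel to the j-th axis this is [contour_shift]. *)
Lemma strip_shift1 eta j (y : R) :
  cint (leb n) (fun xi => F (ctup xi eta)) =
  cint (leb n) (fun xi => F (ctup xi (tset eta j y))).
Proof.
have i1 := rapid_cintegrable (strip_rapid eta).
have i2 := rapid_cintegrable (strip_rapid (tset eta j y)).
apply/eqP; rewrite -subr_eq0 -cintB //; apply/eqP.
apply: (cint_slices0 (j := j)).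
  have [m1 [C1 H1]] := strip_rapid eta; have [m2 [C2 H2]] := strip_rapid (tset eta j y).
  split; first exact: cmeasB; exists (C1 + C2) => t.
  by rewrite mulrDl; apply: le_trans (cabsB _ _) (lerD (H1 t) (H2 t)).
move=> t.
pose z0 := ctup (tset t j 0) (tset eta j 0).
pose G (w : R[i]) := F (z0 + w *: delta_mx j 0).
have E (y' s : R) : F (ctup (tset t j s) (tset eta j y')) = G (s +i* y') by rewrite ctup_tset.
have E0 s : F (ctup (tset t j s) eta) = G (s +i* (tnth eta j : R)) by rewrite -E tset_id.
have [C HC] := Fstrip (\sum_i `|tnth eta i| + `|y|).
have bG (a b : R) : `|b| <= \sum_i `|tnth eta i| + `|y| ->
    cabs (G (a +i* b)) <= C * cauchy_kernel a.
  move=> bb; rewrite -E; apply: (@le_trans _ _ (C * kernel_prod (tset t j a))).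
    apply: HC => i; rewrite tnth_mktuple; case: (i == j) => //.
    by apply: le_trans (norm_le eta i) _; rewrite lerDl.
  have C0 : 0 <= C.
    have := le_trans (cabs_ge0 _) (HC t (tzero n) _); rewrite pmulr_lge0 ?kernel_prod_gt0 //.
    by apply=> i; rewrite tnth_mktuple normr0 addr_ge0 // sumr_ge0.
  by rewrite ler_wpM2l // kernel_prod_tset.
have iG b : `|b| <= \sum_i `|tnth eta i| + `|y| -> cintegrable lam (fun s : Rm => G (s +i* b)).
  move=> bb; apply: (dominated_cintegrable _ (rintegrableZl C rintegrable_cauchy_kernel)).
    exact: ccont_cmeas (holomorphic_ccont b (Fhol z0 j)).
  by move=> s; exact: bG.
have b1 : `|tnth eta j| <= \sum_i `|tnth eta i| + `|y|.
  by apply: le_trans (norm_le eta j) _; rewrite lerDl.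
have b2 : `|y| <= \sum_i `|tnth eta i| + `|y| by rewrite lerDr sumr_ge0.
rewrite (@eq_cint _ _ _ _ _ (fun s : Rm => G (s +i* (tnth eta j : R)) - G (s +i* y))); last first.
  by move=> s; rewrite E0 E.
rewrite cintB; [|exact: iG|exact: iG].
apply/eqP; rewrite subr_eq0; apply/eqP.
have strip (y1 y2 : R) : `|y1| <= \sum_i `|tnth eta i| + `|y| ->
    `|y2| <= \sum_i `|tnth eta i| + `|y| -> y1 <= y2 ->
    cint lam (fun s : Rm => G (s +i* y1)) = cint lam (fun s : Rm => G (s +i* y2)).
  move=> y1b y2b y12; apply: (@contour_shift _ G C) => //; first exact: Fhol.
  move=> a b /andP[ba bb]; apply: bG.
  move: y1b y2b; rewrite !ler_norml => /andP[h1 h2] /andP[h3 h4]; lra.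
have [yy|yy] := lerP (tnth eta j) y; first exact: strip.
by apply/esym; apply: strip => //; exact: ltW.
Qed.

(** The coordinates of eta are moved to 0 one after the other. *)
Theorem strip_shift eta :
  cint (leb n) (fun xi => F (ctup xi eta)) = cint (leb n) (fun xi => F (ctup xi (tzero n))).
Proof.
pose e k : n.-tuple Rm := [tuple (if (j < k)%N then 0 : R else tnth eta j) | j < n].
have e0 : e 0%N = eta by apply: eq_from_tnth => j; rewrite tnth_mktuple.
have en : e n = tzero n by apply: eq_from_tnth => j; rewrite !tnth_mktuple ltn_ord.
suff H k : (k <= n)%N -> cint (leb n) (fun xi => F (ctup xi (e 0%N))) =
    cint (leb n) (fun xi => F (ctup xi (e k))) by rewrite -en -[in LHS]e0; exact: H.
elim: k => // k IH kn; rewrite (IH (ltnW kn)).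
rewrite (strip_shift1 _ (Ordinal kn) 0); apply: eq_cint => xi; congr (F (ctup _ _)).
apply: eq_from_tnth => j.
rewrite !tnth_mktuple [(j < k.+1)%N]ltnS [(j <= k)%N]leq_eqVlt -val_eqE /=.
by case: (j == k :> nat).
Qed.

End Shift.

End StripShift.

Section PaleyWienerCore.
Context {R : realType}.
Notation leb := (lebesgue_tuple R).
Notation Rm := (measurableTypeR R).
Variables (n : nat) (r : R) (F : 'cV[R[i]]_n -> R[i]).
Hypothesis r0 : 0 <= r.

Definition tnorm (t : n.-tuple Rm) : R := Num.sqrt (\sum_(j < n) tnth t j ^+ 2).

Hypothesis Fcont : forall eta : n.-tuple Rm, tcont (fun xi => F (ctup xi eta)).
Hypothesis Fhol : forall z j, holomorphic (fun s => F (z + s *: delta_mx j 0)).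
Hypothesis Fbound : exists2 C : R, 0 <= C & forall xi eta : n.-tuple Rm,
  cabs (F (ctup xi eta)) <= C * expR (2 * pi * r * tnorm eta) * kernel_prod xi.

Definition density : n.-tuple Rm -> R[i] := fourier_inv (fun xi => F (ctup xi (tzero n))).

Lemma sqr_tnorm t : tnorm t ^+ 2 = \sum_(j < n) tnth t j ^+ 2.
Proof. by rewrite sqr_sqrtr // sumr_ge0 // => j _; exact: sqr_ge0. Qed.

Lemma tnorm_coord t j : `|tnth t j| <= tnorm t.
Proof.
rewrite -(ler_pXn2r (ltn0Sn 1)) ?nnegrE ?sqrtr_ge0 // sqr_tnorm real_normK ?num_real //.
by rewrite (bigD1 j) //= lerDl sumr_ge0 // => i _; exact: sqr_ge0.
Qed.

Lemma tnorm_le_sum t : tnorm t <= \sum_j `|tnth t j|.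
Proof.
rewrite -(ler_pXn2r (ltn0Sn 1)) ?nnegrE ?sqrtr_ge0 ?sumr_ge0 // sqr_tnorm.
apply: le_trans (sum_sqr_le _); last by [].
by apply: ler_sum => j _; rewrite real_normK ?num_real.
Qed.

Let Frapid eta : rapid (fun xi => F (ctup xi eta)).
Proof.
split; first exact: tcont_measurable.
have [C C0 HC] := Fbound; exists (C * expR (2 * pi * r * tnorm eta)) => t; exact: HC.
Qed.

(** [strip_shift] for F z * exp (2 pi i x.z), where the exponential has constant
    modulus exp (- 2 pi x.eta) on R^n + i eta. *)
Lemma density_shift (x eta : n.-tuple Rm) :
  density x * (expR (2 * pi * tdot x eta))%:C = fourier_inv (fun xi => F (ctup xi eta)) x.
Proof.
pose E (z : 'cV[R[i]]_n) : R[i] := cexp (2 * pi%:C * 'i%C * \sum_j (tnth x j)%:C * z j 0).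
have EE xi eta' : E (ctup xi eta') =
      phase (2 * pi * tdot x xi) * (expR (- (2 * pi * tdot x eta')))%:C.
  rewrite -cexp_real /E -cexpD; congr cexp.
  have -> : \sum_j (tnth x j)%:C * ctup xi eta' j 0 =
      (tdot x xi)%:C + 'i%C * (tdot x eta')%:C.
    rewrite /tdot !Csum mulr_sumr -big_split /=; apply: eq_bigr => j _; rewrite !mxE.
    by apply: complexP; rewrite ?Re_add ?Im_add ?Re_mul ?Im_mul /=; ring.
  by apply: complexP; rewrite ?Re_add ?Im_add ?Re_mul ?Im_mul /=; ring.
pose G z := F z * E z.
have mph := cmeas_tdot_phase x.
have mG eta' : cmeas (fun xi => G (ctup xi eta')).
  rewrite /G; under eq_fun do rewrite EE.
  apply: cmeasM; first exact: (Frapid eta').1.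
  by apply: cmeasM => //; exact: cmeas_cst.
have hG z j : holomorphic (fun s => G (z + s *: delta_mx j 0)).
  pose c := 2 * pi%:C * 'i%C * \sum_i (tnth x i)%:C * z i 0.
  pose b := 2 * pi%:C * 'i%C * (tnth x j)%:C.
  rewrite (_ : (fun s => _) = fun s => F (z + s *: delta_mx j 0) * cexp (0 * s ^+ 2 + b * s + c)).
    move=> w; have [d Hd] := Fhol z j w; eexists.
    exact: cderivM Hd (cderiv_cexp (cderiv_quadratic _ _ _ _)).
  apply/funext => s; rewrite /G /E; congr (_ * cexp _).
  rewrite mul0r add0r /b /c -(mulrA (2 * pi%:C * 'i%C)) -mulrDr addrC; congr (_ * _).
  have -> : (tnth x j)%:C * s = \sum_i (tnth x i)%:C * (s * (i == j)%:R).
    rewrite (bigD1 j) //= eqxx mulr1 big1 ?addr0 // => i /negbTE ->.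
    by rewrite !mulr0.
  by rewrite -big_split /=; apply: eq_bigr => i _; rewrite !mxE eqxx andbT mulrDr.
have sG (M : R) : exists C : R, forall xi eta' : n.-tuple Rm,
    (forall j, `|tnth eta' j| <= M) -> cabs (G (ctup xi eta')) <= C * kernel_prod xi.
  have [C C0 HC] := Fbound.
  exists (C * expR (2 * pi * r * \sum_(j < n) M) * expR (2 * pi * \sum_j (`|tnth x j| * M))).
  move=> xi eta' eM; rewrite /G cabsM EE cabsM cabs_phase mul1r cabsR ger0_norm ?expR_ge0 //.
  rewrite [leRHS]mulrAC; apply: ler_pM; rewrite ?cabs_ge0 ?expR_ge0 //.
    apply: le_trans (HC xi eta') _; rewrite ler_wpM2r ?kernel_prod_ge0 // ler_wpM2l //.
    rewrite ler_expR ler_wpM2l //; first by rewrite !mulr_ge0 // pi_ge0.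
    by apply: le_trans (tnorm_le_sum _) _; apply: ler_sum => j _; exact: eM.
  rewrite ler_expR -mulrN ler_wpM2l ?mulr_ge0 ?pi_ge0 // /tdot -sumrN.
  apply: ler_sum => j _; apply: le_trans (ler_norm _) _.
  by rewrite normrN normrM ler_wpM2l.
have := strip_shift mG hG sG eta.
pose e := expR (- (2 * pi * tdot x eta)).
rewrite (@eq_cint _ _ _ _ _
  (fun xi => e%:C * (F (ctup xi eta) * phase (2 * pi * tdot x xi)))); last first.
  by move=> xi; rewrite /G EE /e; ring.
rewrite [X in _ = X](@eq_cint _ _ _ _ _
  (fun xi => F (ctup xi (tzero n)) * phase (2 * pi * tdot x xi))); last first.
  move=> xi; rewrite /G EE (_ : tdot x (tzero n) = 0) ?mulr0 ?oppr0 ?expR0 ?mulr1 //.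
  by rewrite /tdot big1 // => j _; rewrite tnth_mktuple mulr0.
rewrite cintZl; last first.
  have [C C0 HC] := Fbound.
  apply: (dominated_cintegrable
    (k := fun xi => C * expR (2 * pi * r * tnorm eta) * kernel_prod xi)).
  - by apply: cmeasM => //; exact: (Frapid eta).1.
  - exact: rintegrableZl (rintegrable_kernel_prod n).
  - by move=> t; rewrite cabsM cabs_phase mulr1.
rewrite /density /fourier_inv => <-.
rewrite mulrAC -(rmorphM (real_complex R)) /e -expRD addNr expR0.
by rewrite rmorph1 mul1r.
Qed.

(** By [density_shift], the density at x is at most K
    exp (2 pi (r |eta| - x.eta)) for every eta; for eta = t x / |x| this is
    K exp (- 2 pi t (|x| - r)), which tends to 0 as t grows. *)
Lemma density_support x : r < tnorm x -> density x = 0.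
Proof.
move=> rx; have [C C0 HC] := Fbound.
pose K : R := 2 * \int[leb n]_xi (C * kernel_prod xi).
have K0 : 0 <= K.
  by rewrite mulr_ge0 // Rintegral_ge0 // => t _; rewrite mulr_ge0 // kernel_prod_ge0.
have x0 : 0 < tnorm x := le_lt_trans r0 rx.
pose c := 2 * pi * (tnorm x - r).
have c0 : 0 < c by rewrite !mulr_gt0 ?pi_gt0 // subr_gt0.
have decay t : 0 <= t -> cabs (density x) <= K * expR (- (t * c)).
  move=> t0; pose eta : n.-tuple Rm := [tuple (t / tnorm x * tnth x j : R) | j < n].
  have xe : tdot x eta = t * tnorm x.
    rewrite /tdot; under eq_bigr do rewrite tnth_mktuple mulrCA -expr2.
    rewrite -mulr_sumr -sqr_tnorm; field; exact: lt0r_neq0.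
  have ee : tnorm eta = t.
    rewrite /tnorm; under eq_bigr do rewrite tnth_mktuple exprMn.
    rewrite -mulr_sumr -sqr_tnorm -exprMn divfK ?lt0r_neq0 // sqrtr_sqr ger0_norm //.
  have -> : density x =
      fourier_inv (fun xi => F (ctup xi eta)) x * (expR (- (2 * pi * tdot x eta)))%:C.
    rewrite -density_shift -mulrA -(rmorphM (real_complex R)) -expRD subrr expR0.
    by rewrite rmorph1 mulr1.
  rewrite cabsM cabsR ger0_norm ?expR_ge0 //.
  have -> : K * expR (- (t * c)) = K * expR (2 * pi * r * t) * expR (- (2 * pi * tdot x eta)).
    rewrite -mulrA -expRD xe /c; congr (_ * expR _); ring.
  rewrite ler_pM2r ?expR_gt0 //.
  have -> : K * expR (2 * pi * r * t) =
      2 * \int[leb n]_xi (C * expR (2 * pi * r * t) * kernel_prod xi).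
    rewrite /K !RintegralZl //; try exact: rintegrable_kernel_prod.
    by ring.
  apply: cint_norm_le.
  - apply: cmeasM; first exact: (Frapid eta).1.
    exact: cmeas_tdot_phase.
  - exact: rintegrableZl (rintegrable_kernel_prod n).
  - by move=> xi; rewrite cabsM cabs_phase mulr1 -[in leRHS]ee; exact: HC.
apply: (@cabs_le_eps _ _ K) => e e0.
(* At t = 1 / (e c) the bound is K exp (- 1 / e), and exp (1 / e) >= 1 / e. *)
apply: le_trans (decay (e^-1 / c) _) _; first by rewrite divr_ge0 ?invr_ge0 // ltW.
rewrite divfK ?lt0r_neq0 // ler_wpM2l // expRN -[leRHS]invrK lef_pV2 ?posrE ?expR_gt0 ?invr_gt0 //.
have := expR_ge1Dx e^-1; lra.
Qed.

(** By [density_shift], density x * exp (2 pi x.b) is the inverse Fourier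
    transform of F on the plane R^n + i b, and by [density_support] it vanishes
    outside a cube: Fourier inversion applies on each such plane. *)
Theorem density_inversion (a b : n.-tuple Rm) : cmeas density ->
  cint (leb n) (fun x => density x *
    ((expR (2 * pi * tdot x b))%:C * phase (- (2 * pi * tdot x a)))) =
  F (ctup a b).
Proof.
move=> md.
have dE : fourier_inv (fun xi => F (ctup xi b)) =
    fun x => density x * (expR (2 * pi * tdot x b))%:C.
  by apply/funext => x; rewrite density_shift.
rewrite -(@fourier_inversion _ _ _ (Frapid b) r a) //.
- by rewrite dE; apply: eq_cint => x; rewrite mulrA.
- rewrite dE; apply: cmeasM => //; apply: cmeas_real.
  apply: measurableT_comp => //; apply: measurable_funM => //.
  by apply: measurable_tdot => //; exact: measurable_cst.
- move=> x [j xj]; rewrite dE density_support ?mul0r //.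
  exact: lt_le_trans xj (tnorm_coord x j).
Qed.

End PaleyWienerCore.

(** * Smooth complex-valued functions *)

Section DerivativeRules.
Context {R : realType}.
Implicit Types (K L : R -> R[i]) (x : R).

Lemma rderivD K L x k l : rderiv K x k -> rderiv L x l ->
  rderiv (fun s => K s + L s) x (k + l).
Proof.
move=> [K1 K2] [L1 L2]; split.
- rewrite Re_add; have := is_deriveD K1 L1.
  by congr is_derive; apply/funext => t /=; rewrite !fctE Re_add.
- rewrite Im_add; have := is_deriveD K2 L2.
  by congr is_derive; apply/funext => t /=; rewrite !fctE Im_add.
Qed.

Lemma rderivM K L x k l : rderiv K x k -> rderiv L x l ->
  rderiv (fun s => K s * L s) x (k * L x + K x * l).
Proof.
move=> [K1 K2] [L1 L2]; split.
- have := is_deriveB (is_deriveM K1 L1) (is_deriveM K2 L2).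
  rewrite (_ : (fun s => complex.Re (K s * L s)) = (fun s => complex.Re (K s)) *
    (fun s => complex.Re (L s)) - (fun s => complex.Im (K s)) * (fun s => complex.Im (L s))).
    move=> H; apply: is_derive_eq; rewrite /GRing.scale /= Re_add !Re_mul; ring.
  by apply/funext => t; rewrite !fctE Re_mul.
- have := is_deriveD (is_deriveM K1 L2) (is_deriveM K2 L1).
  rewrite (_ : (fun s => complex.Im (K s * L s)) = (fun s => complex.Re (K s)) *
    (fun s => complex.Im (L s)) + (fun s => complex.Im (K s)) * (fun s => complex.Re (L s))).
    move=> H; apply: is_derive_eq; rewrite /GRing.scale /= Im_add !Im_mul; ring.
  by apply/funext => t; rewrite !fctE Im_mul.
Qed.

Lemma rderiv_cexp K x k : rderiv K x k ->
  rderiv (fun s => cexp (K s)) x (k * cexp (K x)).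
Proof.
move=> [K1 K2].
have E := @is_derive1_comp R (@expR R) (fun s => complex.Re (K s)) x _ _ (is_derive_expR _) K1.
have C := @is_derive1_comp R (@cos R) (fun s => complex.Im (K s)) x _ _ (is_derive_cos _) K2.
have S := @is_derive1_comp R (@sin R) (fun s => complex.Im (K s)) x _ _ (is_derive_sin _) K2.
split.
- have := is_deriveM E C.
  rewrite (_ : (fun s => complex.Re (cexp (K s))) =
    (@expR R \o (fun s => complex.Re (K s))) * (@cos R \o (fun s => complex.Im (K s)))).
    move=> H; apply: is_derive_eq; rewrite /GRing.scale /= Re_mul Re_cexp Im_cexp; ring.
  by apply/funext => t; rewrite !fctE Re_cexp.
- have := is_deriveM E S.
  rewrite (_ : (fun s => complex.Im (cexp (K s))) =
    (@expR R \o (fun s => complex.Re (K s))) * (@sin R \o (fun s => complex.Im (K s)))).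
    move=> H; apply: is_derive_eq; rewrite /GRing.scale /= Im_mul Re_cexp Im_cexp; ring.
  by apply/funext => t; rewrite !fctE Im_cexp.
Qed.

(** The form in which domination provides derivatives of integrals. *)
Lemma rderiv_quadratic_remainder K k (M : R) :
  (forall s : R, cabs (K s - K 0 - s%:C * k) <= M * s ^+ 2) -> rderiv K 0 k.
Proof.
move=> H; apply: (ReIm_ind (P := fun f =>
  is_derive (0 : R) (1 : R) (fun s => f (K s)) (f k))) => f fD fZ fle.
apply/is_deriveP => e e0; have M0 : 0 < `|M| + 1 by rewrite ltr_wpDl.
exists (e / (`|M| + 1)); first exact: divr_gt0.
move=> s; rewrite ltr_pdivlMr // => sM; rewrite /GRing.scale /= mulr1 add0r -fZ -!fD.
apply: le_trans (fle _) _; apply: le_trans (H s) _.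
rewrite -(real_normK (num_real s)) expr2 mulrA ler_wpM2r //.
have := ler_norm M; have := normr_ge0 s; nra.
Qed.

Lemma rderiv_cst (a : R[i]) x : rderiv (fun _ => a) x 0.
Proof. by split; exact: is_derive_cst. Qed.

Lemma rderiv_affine (a b : R[i]) x : rderiv (fun s => a + s%:C * b) x b.
Proof.
have I : rderiv (fun s : R => s%:C) x 1.
  by split; [exact: is_derive_id|exact: is_derive_cst].
have := rderivD (rderiv_cst a x) (rderivM I (rderiv_cst b x)).
by rewrite mulr0 addr0 mul1r add0r.
Qed.

(** A nonzero derivative would make the function nonzero at nearby points. *)
Lemma rderiv_local0 K x k (d : R) : 0 < d -> (forall s, `|s| < d -> K (x + s) = 0) ->
  rderiv K x k -> k = 0.
Proof.
move=> d0 K0.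
have key (f : R -> R) c : (forall s, `|s| < d -> f (x + s) = 0) -> is_derive x 1 f c -> c = 0.
  move=> f0 /is_deriveP H; apply/eqP; rewrite -normr_eq0 eq_le normr_ge0 andbT.
  apply: (@le0_mul_eps _ _ 1) => e e0; rewrite mul1r.
  have [r r0 Hr] := H e e0.
  pose s := Num.min d r / 2.
  have m0 : 0 < Num.min d r by rewrite lt_min d0.
  have s0 : 0 < s by rewrite divr_gt0.
  have sm : s < Num.min d r by rewrite /s ltr_pdivrMr // ltr_pMr // ltr1n.
  have [sd sr] : s < d /\ s < r by move: sm; rewrite lt_min => /andP.
  have fx0 : f x = 0 by rewrite -[x]addr0 f0 ?normr0.
  have := Hr s; rewrite (gtr0_norm s0) => /(_ sr).
  rewrite [s *: 1]mulr1 f0 ?(gtr0_norm s0) // fx0 subr0 sub0r normrN normrM (gtr0_norm s0) mulrC.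
  by rewrite ler_pM2r.
move=> [K1 K2]; apply: complexP.
- by apply: (key (fun s => complex.Re (K s))) K1 => s /K0 ->.
- by apply: (key (fun s => complex.Im (K s))) K2 => s /K0 ->.
Qed.

End DerivativeRules.

Section SmoothClass.
Context {R : realType}.
Variable n : nat.
Notation V := ('cV[R]_n).
Implicit Types (h k : V -> R[i]) (x : V).

Definition pderiv h (j : 'I_n) h' := forall x,
  rderiv (fun s => h (x + s *: delta_mx j 0)) 0 (h' x).

Definition vcont h := continuous (fun x => complex.Re (h x)) /\
  continuous (fun x => complex.Im (h x)).

Lemma is_derive_line (f : V -> R) x (v : V) (d : R) :
  is_derive (0 : R) (1 : R) (fun s : R => f (x + s *: v)) d <-> is_derive x v f d.
Proof.
split=> /is_deriveP H; apply/is_deriveP => e e0; have [r r0 Hr] := H e e0;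
  exists r => // s sr; have := Hr s sr;
  by rewrite [_ *: 1]mulr1 add0r scale0r addr0.
Qed.

Lemma vcontD h k : vcont h -> vcont k -> vcont (fun x => h x + k x).
Proof.
move=> [h1 h2] [k1 k2]; split.
- by under eq_fun do rewrite Re_add; move=> x; exact: (cvgD (h1 x) (k1 x)).
- by under eq_fun do rewrite Im_add; move=> x; exact: (cvgD (h2 x) (k2 x)).
Qed.

Lemma vcontM h k : vcont h -> vcont k -> vcont (fun x => h x * k x).
Proof.
move=> [h1 h2] [k1 k2]; split.
- under eq_fun do rewrite Re_mul; move=> x.
  exact: (cvgB (cvgM (h1 x) (k1 x)) (cvgM (h2 x) (k2 x))).
- under eq_fun do rewrite Im_mul; move=> x.
  exact: (cvgD (cvgM (h1 x) (k2 x)) (cvgM (h2 x) (k1 x))).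
Qed.

Lemma vcont_cexp h : vcont h -> vcont (fun x => cexp (h x)).
Proof.
move=> [h1 h2]; have E x : expR (complex.Re (h y)) @[y --> x] --> expR (complex.Re (h x)).
  by exact: (cvg_comp _ _ (h1 x) (@continuous_expR R _)).
split.
- under eq_fun do rewrite Re_cexp; move=> x.
  exact: (cvgM (E x) (cvg_comp _ _ (h2 x) (@continuous_cos R _))).
- under eq_fun do rewrite Im_cexp; move=> x.
  exact: (cvgM (E x) (cvg_comp _ _ (h2 x) (@continuous_sin R _))).
Qed.

Lemma vcont_eps h : (forall x (e : R), 0 < e -> exists2 d : R, 0 < d &
    forall y : V, (forall j, `|x j 0 - y j 0| < d) -> cabs (h x - h y) <= e) -> vcont h.
Proof.
move=> H; apply: (ReIm_ind (P := fun f => continuous (fun x => f (h x)))) => f fD _ fle.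
move=> x; apply/continuousP_eps => e e0; have [d d0 Hd] := H x e e0.
exists d => // y xy; rewrite -fD; apply: le_trans (fle _) _; apply: Hd => j.
have : ball x d y by rewrite mx_norm_ball.
by move=> [_ /(_ j 0)].
Qed.

Lemma vcontP h : vcont h -> forall x (e : R), 0 < e -> exists2 d : R, 0 < d &
    forall y : V, (forall j, `|x j 0 - y j 0| < d) -> cabs (h x - h y) <= e.
Proof.
move=> [h1 h2] x e e0; have e2 : 0 < e / 2 by rewrite divr_gt0.
have [d1 d10 H1] := (continuousP_eps _ _).1 (h1 x) _ e2.
have [d2 d20 H2] := (continuousP_eps _ _).1 (h2 x) _ e2.
have nb (d : R) (y : V) : 0 < d -> (forall j, `|x j 0 - y j 0| < d) -> `|x - y| < d.
  move=> d0 xy; suff : ball x d y by rewrite mx_norm_ball.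
  by split=> // i k; rewrite (ord1 k); exact: xy.
exists (Num.min d1 d2); first by rewrite lt_min d10.
move=> y xy; apply: le_trans (cabs_le_ReIm _) _; rewrite Re_add Re_opp Im_add Im_opp.
rewrite [leRHS]splitr; apply: lerD; [apply: H1|apply: H2]; apply: nb => // i;
  by have := xy i; rewrite lt_min => /andP[].
Qed.

(** Smoothness as a coinductive property: membership in a family of continuous
    functions that is closed under partial derivatives. To prove a function
    smooth, one exhibits such a family. *)
Definition csmooth h := exists FF : (V -> R[i]) -> Prop, FF h /\
  forall k, FF k -> vcont k /\ forall j, exists2 k', FF k' & pderiv k j k'.

Lemma csmooth_vcont h : csmooth h -> vcont h.
Proof. by move=> [FF [Fh /(_ h Fh)[]]]. Qed.

Lemma csmooth_pderiv h j : csmooth h -> exists2 h', csmooth h' & pderiv h j h'.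
Proof.
move=> [FF [Fh HF]]; have [_ /(_ j)[h' Fh' hh']] := HF h Fh.
by exists h' => //; exists FF.
Qed.

Lemma csmooth_coind (FF : (V -> R[i]) -> Prop) :
  (forall k, FF k -> vcont k /\ forall j, exists2 k', FF k' & pderiv k j k') ->
  forall h, FF h -> csmooth h.
Proof. by move=> HF h Fh; exists FF. Qed.

Inductive calg (BB : (V -> R[i]) -> Prop) : (V -> R[i]) -> Prop :=
| calg_gen h of BB h : calg BB h
| calg_add h k of calg BB h & calg BB k : calg BB (fun x => h x + k x)
| calg_mul h k of calg BB h & calg BB k : calg BB (fun x => h x * k x).

Lemma pderivD h k j h' k' : pderiv h j h' -> pderiv k j k' ->
  pderiv (fun x => h x + k x) j (fun x => h' x + k' x).
Proof. by move=> H K x; exact: rderivD (H x) (K x). Qed.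

Lemma pderivM h k j h' k' : pderiv h j h' -> pderiv k j k' ->
  pderiv (fun x => h x * k x) j (fun x => h' x * k x + h x * k' x).
Proof.
by move=> H K x; have := rderivM (H x) (K x); rewrite scale0r addr0.
Qed.

Lemma pderiv_cexp h j h' : pderiv h j h' ->
  pderiv (fun x => cexp (h x)) j (fun x => h' x * cexp (h x)).
Proof. by move=> H x; have := rderiv_cexp (H x); rewrite scale0r addr0. Qed.

(** By the Leibniz rule, the algebra generated by BB is closed under partial
    derivatives as soon as it contains those of its generators. *)
Lemma calg_csmooth (BB : (V -> R[i]) -> Prop) :
  (forall k, BB k -> vcont k /\ forall j, exists2 k', calg BB k' & pderiv k j k') ->
  forall h, calg BB h -> csmooth h.
Proof.
move=> HB; apply: csmooth_coind => k; elim=> {k} [k /HB //|h k ch [h1 h2] ck [k1 k2]|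
  h k ch [h1 h2] ck [k1 k2]].
- split=> [|j]; first exact: vcontD.
  have [h' ch' hh'] := h2 j; have [k' ck' kk'] := k2 j.
  by exists (fun x => h' x + k' x); [exact: calg_add|exact: pderivD].
- split=> [|j]; first exact: vcontM.
  have [h' ch' hh'] := h2 j; have [k' ck' kk'] := k2 j.
  exists (fun x => h' x * k x + h x * k' x); last exact: pderivM.
  by apply: calg_add; apply: calg_mul.
Qed.

Lemma csmoothM h k : csmooth h -> csmooth k -> csmooth (fun x => h x * k x).
Proof.
move=> sh sk; apply: (@calg_csmooth csmooth); last by apply: calg_mul; exact: calg_gen.
move=> l sl; split=> [|j]; first exact: csmooth_vcont.
by have [l' sl' ll'] := csmooth_pderiv j sl; exists l' => //; exact: calg_gen.
Qed.

Lemma csmoothD h k : csmooth h -> csmooth k -> csmooth (fun x => h x + k x).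
Proof.
move=> sh sk; apply: (@calg_csmooth csmooth); last by apply: calg_add; exact: calg_gen.
move=> l sl; split=> [|j]; first exact: csmooth_vcont.
by have [l' sl' ll'] := csmooth_pderiv j sl; exists l' => //; exact: calg_gen.
Qed.

Lemma csmooth_cst (c : R[i]) : csmooth (fun=> c).
Proof.
apply: (@csmooth_coind (fun h => exists c, h = fun=> c)); last by exists c.
move=> _ [d ->]; split=> [|j]; first by (split=> x; exact: cst_continuous).
exists (fun=> 0); first by exists 0.
by move=> x; exact: (rderiv_cst d 0).
Qed.

Lemma csmooth_coord j : csmooth (fun x => (x j 0)%:C).
Proof.
apply: (@csmooth_coind (fun h => csmooth h \/ h = fun x => (x j 0)%:C)); last by right.
move=> k [sk|->].
  split=> [|i]; first exact: csmooth_vcont.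
  by have [k' sk' kk'] := csmooth_pderiv i sk; exists k' => //; left.
split=> [|i].
  by split; [exact: coord_continuous|move=> x; exact: cst_continuous].
exists (fun=> ((j == i)%:R : R)%:C); first by left; exact: csmooth_cst.
move=> x; have := rderiv_affine (x j 0)%:C ((j == i)%:R : R)%:C 0.
rewrite (_ : (fun s : R => _) = fun s : R => ((x + s *: delta_mx i 0) j 0)%:C) //.
by apply/funext => s; rewrite !mxE eqxx andbT (rmorphD (real_complex R)) (rmorphM (real_complex R)).
Qed.

Lemma csmooth_sum (I : Type) (s : seq I) (H : I -> V -> R[i]) :
  (forall i, csmooth (H i)) -> csmooth (fun x => \sum_(i <- s) H i x).
Proof.
move=> sH; elim: s => [|i s IH].
  by under eq_fun do rewrite big_nil; exact: csmooth_cst.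
by under eq_fun do rewrite big_cons; exact: csmoothD.
Qed.

(** The algebra generated by cexp h and the smooth functions is closed under
    derivatives, since (cexp h)' = h' cexp h. *)
Lemma csmooth_cexp h : csmooth h -> csmooth (fun x => cexp (h x)).
Proof.
move=> sh; pose BB k := csmooth k \/ k = fun x => cexp (h x).
apply: (@calg_csmooth BB); last by apply: calg_gen; right.
move=> k [sk|->].
  split=> [|i]; first exact: csmooth_vcont.
  by have [k' sk' kk'] := csmooth_pderiv i sk; exists k' => //; apply: calg_gen; left.
split=> [|i]; first exact/vcont_cexp/csmooth_vcont.
have [h' sh' hh'] := csmooth_pderiv i sh.
exists (fun x => h' x * cexp (h x)); last exact: pderiv_cexp.
by apply: calg_mul; apply: calg_gen; [left|right].
Qed.

Lemma csmooth_real (u : V -> R) : smooth u -> csmooth (fun x => (u x)%:C).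
Proof.
move=> su; apply: (@csmooth_coind
  (fun h => exists s, h = fun x => (partials s u x)%:C)); last first.
  by exists [::].
move=> _ [s ->]; have [cs ds] := su s; split=> [|j].
  by split => // x; exact: cst_continuous.
exists (fun x => (partials (j :: s) u x)%:C); first by exists (j :: s).
move=> x; split; last exact: is_derive_cst.
by apply: (is_derive_line (partials s u) _ _ _).2; apply: derivableP; exact: ds.
Qed.

(** Here f stands for the real or for the imaginary part. *)
Lemma csmooth_partials h (f : R[i] -> R) :
  (forall k, vcont k -> continuous (fun x => f (k x))) ->
  (forall k j k', pderiv k j k' ->
    forall x, is_derive x (delta_mx j 0) (fun x => f (k x)) (f (k' x))) ->
  csmooth h -> forall s, exists2 k, csmooth k & partials s (fun x => f (h x)) = fun x => f (k x).
Proof.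
move=> fc fd sh; elim=> [|i s [k sk IH]]; first by exists h.
have [k' sk' kk'] := csmooth_pderiv i sk; exists k' => //=; rewrite IH.
by apply/funext => x; have [_ ->] := fd _ _ _ kk' x.
Qed.

Lemma pderiv_Re h j h' : pderiv h j h' ->
  forall x, is_derive x (delta_mx j 0) (fun x => complex.Re (h x)) (complex.Re (h' x)).
Proof.
move=> H x; have [H1 _] := H x.
exact: (is_derive_line (fun x => complex.Re (h x)) _ _ _).1 H1.
Qed.

Lemma pderiv_Im h j h' : pderiv h j h' ->
  forall x, is_derive x (delta_mx j 0) (fun x => complex.Im (h x)) (complex.Im (h' x)).
Proof.
move=> H x; have [_ H2] := H x.
exact: (is_derive_line (fun x => complex.Im (h x)) _ _ _).1 H2.
Qed.

Lemma csmooth_smooth h : csmooth h ->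
  smooth (fun x => complex.Re (h x)) /\ smooth (fun x => complex.Im (h x)).
Proof.
move=> sh; split=> s.
- have [k sk ->] := csmooth_partials (f := @complex.Re R) (fun k => @proj1 _ _) pderiv_Re sh s.
  split; first exact: (csmooth_vcont sk).1.
  move=> i x; have [k' _ kk'] := csmooth_pderiv i sk.
  exact: (@ex_derive _ _ _ _ _ _ _ (pderiv_Re kk' x)).
- have [k sk ->] := csmooth_partials (f := @complex.Im R) (fun k => @proj2 _ _) pderiv_Im sh s.
  split; first exact: (csmooth_vcont sk).2.
  move=> i x; have [k' _ kk'] := csmooth_pderiv i sk.
  exact: (@ex_derive _ _ _ _ _ _ _ (pderiv_Im kk' x)).
Qed.

Lemma pderiv_local0 (U : set V) h j h' : open U -> (forall x, U x -> h x = 0) ->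
  pderiv h j h' -> forall x, U x -> h' x = 0.
Proof.
move=> oU h0 hh' x Ux.
have /nbhs_ballP[d /= d0 dU] : nbhs x U by exact: open_nbhs_nbhs.
apply: (rderiv_local0 d0 _ (hh' x)) => s sd; apply: h0; apply: dU; split=> // i k.
rewrite /ball /= !mxE add0r opprD addrA subrr sub0r normrN normrM.
apply: le_lt_trans sd; rewrite ler_piMr //.
by case: (_ && _); rewrite ?normr1 ?normr0.
Qed.

End SmoothClass.

(** * Differentiation under the inverse Fourier integral *)

Section Moments.
Context {R : realType}.
Variable n : nat.
Notation leb := (lebesgue_tuple R).
Notation Rm := (measurableTypeR R).
Notation V := ('cV[R]_n).

Definition tuple_of_col (x : V) : n.-tuple Rm := [tuple (x j 0 : R) | j < n].

Lemma tuple_of_colK x : col_of_tuple (tuple_of_col x) = x.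
Proof. by apply/matrixP => i k; rewrite mxE tnth_mktuple (ord1 k). Qed.

Lemma col_of_tupleK (t : n.-tuple Rm) : tuple_of_col (col_of_tuple t) = t.
Proof. by apply: eq_from_tnth => j; rewrite tnth_mktuple mxE. Qed.

Lemma cabs_phaseB1 (a : R) : cabs (phase a - 1) <= 2 * `|a|.
Proof.
apply: le_trans (cabs_le_ReIm _) _; rewrite Re_add Im_add Re_opp Im_opp Re_cexp Im_cexp /=.
rewrite expR0 !mul1r oppr0 addr0 mulr_natl mulr2n.
by apply: lerD; [exact: cosB1_norm_le|exact: sin_norm_le].
Qed.

Lemma cabs_phaseB1B (a : R) : cabs (phase a - 1 - (0 +i* a)) <= 2 * a ^+ 2.
Proof.
apply: le_trans (cabs_le_ReIm _) _; rewrite !Re_add !Im_add !Re_opp !Im_opp Re_cexp Im_cexp /=.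
rewrite expR0 !mul1r !oppr0 !addr0 mulr_natl mulr2n.
by apply: lerD; [exact: cosB1_norm_le_sqr|exact: sinB_norm_le_sqr].
Qed.

Definition weight (t : n.-tuple Rm) : R := 1 + \sum_j `|tnth t j|.

Lemma weight_ge1 t : 1 <= weight t.
Proof. by rewrite lerDl sumr_ge0. Qed.

Lemma weight_ge0 t : 0 <= weight t.
Proof. exact: le_trans ler01 (weight_ge1 t). Qed.

Lemma weight_coord t j : `|tnth t j| <= weight t.
Proof.
rewrite /weight (bigD1 j) //= addrCA lerDl addr_ge0 // sumr_ge0 //.
Qed.

(** All polynomial multiples of m are dominated by the product kernel, so that
    derivatives of every order may be taken under the integral sign. *)
Definition moment (m : n.-tuple Rm -> R[i]) := cmeas m /\
  forall N : nat, exists C : R, forall t, weight t ^+ N * cabs (m t) <= C * kernel_prod t.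

Definition freq_mul j (m : n.-tuple Rm -> R[i]) (t : n.-tuple Rm) : R[i] :=
  (0 +i* (2 * pi * tnth t j : R)) * m t.

Lemma moment_freq_mul j m : moment m -> moment (freq_mul j m).
Proof.
move=> [mm Hm]; split.
  apply: cmeasM => //; split; first exact: measurable_cst.
  by apply: measurable_funM => //; exact: measurable_tnth.
move=> N; have [C HC] := Hm N.+1; exists (2 * pi * C) => t.
rewrite /freq_mul cabsM.
have -> : cabs (0 +i* (2 * pi * tnth t j : R)) = 2 * pi * `|tnth t j|.
  by rewrite cabs_imag normrM ger0_norm // mulr_ge0 // pi_ge0.
have p0 : 0 <= 2 * pi :> R by rewrite mulr_ge0 // pi_ge0.
have -> : weight t ^+ N * (2 * pi * `|tnth t j| * cabs (m t)) =
  2 * pi * (`|tnth t j| * (weight t ^+ N * cabs (m t))) by ring.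
rewrite -[leRHS]mulrA ler_wpM2l //; apply: le_trans (HC t).
by rewrite exprS -mulrA ler_wpM2r ?weight_coord // mulr_ge0 ?cabs_ge0 // exprn_ge0 // weight_ge0.
Qed.

Lemma moment_rapid m : moment m -> rapid m.
Proof.
by move=> [mm /(_ 0%N)[C HC]]; split => //; exists C => t; have := HC t; rewrite expr0 mul1r.
Qed.

Definition inv_transform m (x : V) : R[i] := fourier_inv m (tuple_of_col x).

Let iphase m (x : n.-tuple Rm) : rapid m ->
  cintegrable (leb n) (fun xi => m xi * phase (2 * pi * tdot x xi)).
Proof.
move=> [mm [C HC]].
apply: (dominated_cintegrable _ (rintegrableZl C (@rintegrable_kernel_prod R n))).
  by apply: cmeasM => //; exact: cmeas_tdot_phase.
by move=> t; rewrite cabsM cabs_phase mulr1.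
Qed.

(** Since |phase a - 1| <= 2 |a|, one power of the weight pays for a linear
    modulus of continuity. *)
Lemma inv_transform_vcont m : moment m -> vcont (inv_transform m).
Proof.
move=> mo; have [mm Hm] := mo; have [C HC] := Hm 1%N; apply: vcont_eps => x e e0.
pose K : R := 2 * \int[leb n]_t (4 * pi * C * kernel_prod t).
exists (e / (`|K| + 1)) => [|y xy]; first by rewrite divr_gt0 // ltr_wpDl.
set d := e / (`|K| + 1) in xy.
have d0 : 0 <= d by rewrite divr_ge0 ?ltW // ltr_wpDl.
have dK : d * K <= e.
  rewrite /d mulrAC ler_pdivrMr ?ltr_wpDl // ler_pM2l //.
  by have := ler_norm K; lra.
rewrite /inv_transform /fourier_inv -cintB; try exact: iphase (moment_rapid mo).
apply: le_trans dK; rewrite /K mulrCA -RintegralZl //; last first.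
  exact: rintegrableZl (rintegrable_kernel_prod n).
set X := tuple_of_col x; set Y := tuple_of_col y.
apply: cint_norm_le.
- by apply: cmeasB; apply: cmeasM => //; exact: cmeas_tdot_phase.
- by apply: rintegrableZl; exact: rintegrableZl (rintegrable_kernel_prod n).
move=> t.
have -> : m t * phase (2 * pi * tdot X t) - m t * phase (2 * pi * tdot Y t) =
  m t * phase (2 * pi * tdot Y t) * (phase (2 * pi * (tdot X t - tdot Y t)) - 1).
  have -> : 2 * pi * tdot X t = 2 * pi * tdot Y t + 2 * pi * (tdot X t - tdot Y t) by ring.
  by rewrite phaseD; ring.
rewrite cabsM cabsM cabs_phase mulr1.
have p0 : 0 <= 2 * pi :> R by rewrite mulr_ge0 // pi_ge0.
have tD : `|tdot X t - tdot Y t| <= d * weight t.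
  rewrite /tdot -sumrB; apply: le_trans (ler_norm_sum _ _ _) _.
  apply: (@le_trans _ _ (\sum_j d * `|tnth t j|)); last first.
    by rewrite -mulr_sumr ler_wpM2l // lerDr.
  apply: ler_sum => j _; rewrite -mulrBl normrM ler_wpM2r // !tnth_mktuple ltW //.
have c1 := cabs_phaseB1 (2 * pi * (tdot X t - tdot Y t)).
rewrite normrM (ger0_norm p0) in c1.
apply: (@le_trans _ _ (cabs (m t) * (2 * (2 * pi * (d * weight t))))).
  rewrite ler_wpM2l ?cabs_ge0 //; apply: le_trans c1 _.
  by rewrite ler_pM2l // ler_wpM2l.
have := HC t; rewrite expr1 => Ht.
have -> : cabs (m t) * (2 * (2 * pi * (d * weight t))) =
  d * (4 * pi) * (weight t * cabs (m t)) by ring.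
have -> : d * (4 * pi * C * kernel_prod t) = d * (4 * pi) * (C * kernel_prod t) by ring.
apply: ler_wpM2l => //; apply: mulr_ge0 => //; apply: mulr_ge0 => //; exact: pi_ge0.
Qed.

(** The second-order remainder of the phase costs two powers of the weight,
    which m absorbs. *)
Lemma inv_transform_pderiv m j : moment m ->
  pderiv (inv_transform m) j (inv_transform (freq_mul j m)).
Proof.
move=> mo x; have [mm Hm] := mo; have [C HC] := Hm 2%N.
have mo' := moment_freq_mul j mo.
apply: (@rderiv_quadratic_remainder _ _ _
  (2 * \int[leb n]_t (2 * (2 * pi) ^+ 2 * C * kernel_prod t))).
move=> s; rewrite scale0r addr0 /inv_transform /fourier_inv.
set X := tuple_of_col x; set Y := tuple_of_col _.
have YE t : tdot Y t = tdot X t + s * tnth t j.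
  have -> : s * tnth t j = \sum_i (s * (i == j)%:R) * tnth t i.
    rewrite (bigD1 j) //= eqxx mulr1 big1 ?addr0 // => i /negbTE ->.
    by rewrite mulr0 mul0r.
  rewrite /tdot -big_split /=; apply: eq_bigr => i _.
  by rewrite !tnth_mktuple !mxE eqxx andbT mulrDl.
have i1 := iphase X (moment_rapid mo); have i2 := iphase Y (moment_rapid mo).
have i3 := iphase X (moment_rapid mo').
rewrite -cintZl // -cintB // -cintB //; last 2 first.
- split; [have := i1.1; have := i2.1|have := i1.2; have := i2.2] => a b.
    apply: (eq_integrable measurableT _ _ _ (integrableB measurableT a b)) => t _.
    by rewrite /= Re_add Re_opp.
  apply: (eq_integrable measurableT _ _ _ (integrableB measurableT a b)) => t _.
  by rewrite /= Im_add Im_opp.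
- have [mm' [C' HC']] := moment_rapid mo'.
  apply: (dominated_cintegrable _ (rintegrableZl (`|s| * C') (@rintegrable_kernel_prod R n))).
    by apply: cmeasM; [exact: cmeas_cst|apply: cmeasM => //; exact: cmeas_tdot_phase].
  by move=> t; rewrite cabsM cabsM cabs_phase mulr1 cabsR -mulrA ler_wpM2l.
have -> : 2 * \int[leb n]_t (2 * (2 * pi) ^+ 2 * C * kernel_prod t) * s ^+ 2 =
    2 * \int[leb n]_t (s ^+ 2 * (2 * (2 * pi) ^+ 2 * C * kernel_prod t)).
  rewrite [in RHS]RintegralZl //; first by ring.
  exact: rintegrableZl (@rintegrable_kernel_prod R n).
apply: cint_norm_le.
- have mp y : cmeas (fun t : n.-tuple Rm => phase (2 * pi * tdot y t)) by exact: cmeas_tdot_phase.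
  apply: cmeasB; first by apply: cmeasB; exact: cmeasM.
  by apply: cmeasM; [exact: cmeas_cst|apply: cmeasM => //; exact: mo'.1].
- by apply: rintegrableZl; exact: rintegrableZl (rintegrable_kernel_prod n).
move=> t; set a := 2 * pi * (s * tnth t j).
have -> : m t * phase (2 * pi * tdot Y t) - m t * phase (2 * pi * tdot X t) -
   s%:C * (freq_mul j m t * phase (2 * pi * tdot X t)) =
   m t * phase (2 * pi * tdot X t) * (phase a - 1 - (0 +i* a)).
  have -> : 2 * pi * tdot Y t = 2 * pi * tdot X t + a by rewrite YE /a; ring.
  have -> : 0 +i* a = s%:C * (0 +i* (2 * pi * tnth t j : R)).
    by apply: complexP; rewrite ?Re_mul ?Im_mul /= /a; ring.
  by rewrite phaseD /freq_mul; ring.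
rewrite cabsM cabsM cabs_phase mulr1.
apply: (@le_trans _ _ (cabs (m t) * (2 * a ^+ 2))).
  by rewrite ler_wpM2l ?cabs_ge0 // cabs_phaseB1B.
have a2 : a ^+ 2 <= (2 * pi) ^+ 2 * s ^+ 2 * weight t ^+ 2.
  have uw : (tnth t j : R) ^+ 2 <= weight t ^+ 2.
    rewrite -(real_normK (num_real (tnth t j : R))).
    by apply: lerXn2r; rewrite ?nnegrE ?weight_ge0 ?weight_coord.
  have -> : a ^+ 2 = (2 * pi) ^+ 2 * s ^+ 2 * (tnth t j : R) ^+ 2 by rewrite /a; ring.
  by apply: ler_wpM2l => //; apply: mulr_ge0; exact: sqr_ge0.
apply: (@le_trans _ _ (cabs (m t) * (2 * ((2 * pi) ^+ 2 * s ^+ 2 * weight t ^+ 2)))).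
  by rewrite ler_wpM2l ?cabs_ge0 // ler_pM2l.
have -> : cabs (m t) * (2 * ((2 * pi) ^+ 2 * s ^+ 2 * weight t ^+ 2)) =
  s ^+ 2 * (2 * (2 * pi) ^+ 2) * (weight t ^+ 2 * cabs (m t)) by ring.
have -> : s ^+ 2 * (2 * (2 * pi) ^+ 2 * C * kernel_prod t) =
  s ^+ 2 * (2 * (2 * pi) ^+ 2) * (C * kernel_prod t) by ring.
apply: ler_wpM2l => //; apply: mulr_ge0; [exact: sqr_ge0|].
by apply: mulr_ge0 => //; exact: sqr_ge0.
Qed.

(** Each derivative only replaces m by [freq_mul j m], so the inverse transforms
    of functions with all moments form a family closed under derivatives. *)
Lemma inv_transform_csmooth m : moment m -> csmooth (inv_transform m).
Proof.
move=> mo; apply: (@csmooth_coind _ _ (fun h => exists2 m, moment m & h = inv_transform m)).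
  move=> _ [k mk ->]; split=> [|j]; first exact: inv_transform_vcont.
  exists (inv_transform (freq_mul j k)); last exact: inv_transform_pderiv.
  by exists (freq_mul j k) => //; exact: moment_freq_mul.
by exists m.
Qed.

End Moments.

(** * Fourier-Laplace transforms of functions of compact support *)

Section CompactSupport.
Context {R : realType}.
Variable n : nat.
Notation leb := (lebesgue_tuple R).
Notation Rm := (measurableTypeR R).
Notation V := ('cV[R]_n).
Implicit Types (h k : V -> R[i]).

Lemma vcont_tcont h : vcont h -> tcont (fun t : n.-tuple Rm => h (col_of_tuple t)).
Proof.
move=> hc t e e0; have [d d0 Hd] := vcontP hc (col_of_tuple t) e0.
by exists d => // u tu; apply: Hd => j; rewrite !mxE; exact: tu.
Qed.

Lemma enorm_tnorm (t : n.-tuple Rm) : enorm (col_of_tuple t) = tnorm t.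
Proof. by rewrite /enorm /tnorm; congr Num.sqrt; apply: eq_bigr => j _; rewrite mxE. Qed.

Lemma enorm_ge0 (x : V) : 0 <= enorm x.
Proof. exact: sqrtr_ge0. Qed.

Lemma enorm_coord (x : V) j : `|x j 0| <= enorm x.
Proof.
by have := tnorm_coord (tuple_of_col x) j; rewrite -enorm_tnorm tuple_of_colK tnth_mktuple.
Qed.

(** The extreme value theorem on a cube; transposition is needed because
    [rV_compact] speaks of row vectors. *)
Lemma vcont_bounded h (L : R) : vcont h ->
  exists2 C, 0 <= C & forall x : V, (forall j, `|x j 0| <= L) -> cabs (h x) <= C.
Proof.
move=> hc.
pose A : set 'rV[R]_n := [set v | forall j, `[- L, L]%classic (v ord0 j)].
pose f (v : 'rV[R]_n) : R := cabs (h v^T).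
have cf : continuous f.
  move=> v; apply/continuousP_eps => e e0; have [d d0 Hd] := vcontP hc v^T e0.
  exists d => // w vw.
  have : ball v d w by rewrite mx_norm_ball.
  move=> [_ vw'].
  have D : cabs (h v^T - h w^T) <= e by apply: Hd => j; rewrite !mxE; exact: vw'.
  apply: le_trans D; rewrite /f ler_norml; apply/andP; split.
    have := cabsD (h w^T - h v^T) (h v^T); rewrite subrK -(cabsN (h w^T - _)) opprB; lra.
  by have := cabsD (h v^T - h w^T) (h w^T); rewrite subrK; lra.
have cA : compact A.
  by apply: (@rV_compact _ _ (fun=> `[- L, L]%classic)) => _; exact: segment_compact.
have [[v Av]|/forallNP A0] := pselect (exists v, A v).
  have [c _ Hc] := EVT_max_rV (ex_intro _ v Av) cA (continuous_subspaceT cf).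
  exists (f c); first exact: cabs_ge0.
  move=> x xL; have := Hc x^T; rewrite /f trmxK; apply.
  by rewrite inE => j /=; rewrite mxE in_itv /= -ler_norml xL.
exists 0 => // x xL; exfalso; apply: (A0 x^T) => j /=.
by rewrite mxE in_itv /= -ler_norml xL.
Qed.

Variable r : R.

Lemma compact_support_bounded h : vcont h -> (forall x, r < enorm x -> h x = 0) ->
  exists2 C, 0 <= C & forall x, cabs (h x) <= C.
Proof.
move=> hc h0; have [C C0 HC] := vcont_bounded r hc; exists C => // x.
have [rx|rx] := ltrP r (enorm x); first by rewrite h0 // cabs0.
by apply: HC => j; exact: le_trans (enorm_coord x j) rx.
Qed.

Lemma compact_rapid h : vcont h -> (forall x, r < enorm x -> h x = 0) ->
  exists2 C, 0 <= C & forall t : n.-tuple Rm, cabs (h (col_of_tuple t)) <= C * kernel_prod t.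
Proof.
move=> hc h0; have [C C0 HC] := compact_support_bounded hc h0.
exists (C * (1 + r ^+ 2) ^+ n).
  by rewrite mulr_ge0 // exprn_ge0 // addr_ge0 // sqr_ge0.
move=> t; have kp0 := kernel_prod_ge0 t.
have [rx|rx] := ltrP r (enorm (col_of_tuple t)).
  by rewrite h0 // cabs0 !mulr_ge0 // exprn_ge0 // addr_ge0 // sqr_ge0.
apply: le_trans (HC _) _; rewrite -mulrA ler_peMr // kernel_prod_box // => j.
by apply: le_trans rx; rewrite enorm_tnorm; exact: tnorm_coord.
Qed.

Lemma compact_rapid_cmeas h : vcont h -> (forall x, r < enorm x -> h x = 0) ->
  rapid (fun t : n.-tuple Rm => h (col_of_tuple t)).
Proof.
move=> hc h0; split; first exact/tcont_measurable/vcont_tcont.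
by have [C _ HC] := compact_rapid hc h0; exists C.
Qed.

Lemma col_of_tset (t : n.-tuple Rm) j (s : R) :
  col_of_tuple (tset t j s) = col_of_tuple (tset t j 0) + s *: delta_mx j 0.
Proof.
apply/matrixP => i k; rewrite (ord1 k) !mxE !tnth_mktuple eqxx andbT.
by case: (i == j); rewrite ?mulr1 ?mulr0 ?add0r ?addr0.
Qed.

Lemma pderiv_line h j h' (x : V) (s : R) : pderiv h j h' ->
  rderiv (fun s => h (x + s *: delta_mx j 0)) s (h' (x + s *: delta_mx j 0)).
Proof.
move=> hh'; have [H1 H2] := hh' (x + s *: delta_mx j 0).
have key (f : R[i] -> R) (d : R) :
    is_derive (0 : R) (1 : R) (fun s' => f (h (x + s *: delta_mx j 0 + s' *: delta_mx j 0))) d ->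
    is_derive s (1 : R) (fun s => f (h (x + s *: delta_mx j 0))) d.
  move=> /is_deriveP H; apply/is_deriveP => e e0; have [q q0 Hq] := H e e0.
  exists q => // u uq; have := Hq u uq.
  by rewrite [u *: 1]mulr1 add0r scale0r addr0 -(addrA x) -scalerDl.
by split; apply: key.
Qed.

(** On each line parallel to the j-th axis, h' is the derivative of a function
    of compact support. *)
Lemma cint_pderiv0 h j h' : vcont h' -> (forall x, r < enorm x -> h x = 0) ->
  (forall x, r < enorm x -> h' x = 0) -> pderiv h j h' ->
  cint (leb n) (fun t => h' (col_of_tuple t)) = 0.
Proof.
move=> ch' h0 h0' hh'; apply: (cint_slices0 (j := j)); first exact: compact_rapid_cmeas.
move=> t; pose x0 := col_of_tuple (tset t j 0).
have [C C0 HC] := compact_rapid ch' h0'.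
have far (s : R) : r + 1 <= `|s| -> r < enorm (x0 + s *: delta_mx j 0).
  move=> rs; rewrite /x0 -col_of_tset enorm_tnorm; apply: lt_le_trans (tnorm_coord _ j).
  by rewrite tnth_mktuple eqxx; apply: lt_le_trans rs; rewrite ltrDl.
rewrite (@eq_cint _ _ _ _ _ (fun s : Rm => h' (x0 + (s : R) *: delta_mx j 0))); last first.
  by move=> s; rewrite col_of_tset.
apply: (@cint_derive_compact _ (fun s => h (x0 + s *: delta_mx j 0)) _ C (r + 1)).
- apply: (ReIm_ind (P := fun f =>
    continuous (fun s : R => f (h' (x0 + s *: delta_mx j 0))))) => f fD _ fle s.
  apply/continuousP_eps => e e0.
  have [d d0 Hd] := vcontP ch' (x0 + s *: delta_mx j 0) e0; exists d => // u su.
  rewrite -fD; apply: le_trans (fle _) _; apply: Hd => i.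
  rewrite !mxE opprD addrACA subrr add0r -mulrBl normrM.
  by apply: le_lt_trans su; rewrite ler_piMr //; case: (_ && _); rewrite ?normr1 ?normr0.
- move=> s; rewrite /x0 -col_of_tset; apply: le_trans (HC _) _.
  by rewrite ler_wpM2l // kernel_prod_tset.
- by move=> s; exact: pderiv_line.
- by move=> s /far /h0.
Qed.

End CompactSupport.

(** This is a_i b_i <= (q / p a_i^2 + p / q b_i^2) / 2, where p and q are the
    norms of a and b, summed over i. *)
Lemma cauchy_schwarz_sum (R : realType) (I : finType) (a b : I -> R) :
  \sum_i a i * b i <= Num.sqrt (\sum_i a i ^+ 2) * Num.sqrt (\sum_i b i ^+ 2).
Proof.
set A := \sum_i a i ^+ 2; set B := \sum_i b i ^+ 2.
have A0 : 0 <= A by apply: sumr_ge0 => i _; exact: sqr_ge0.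
have B0 : 0 <= B by apply: sumr_ge0 => i _; exact: sqr_ge0.
have [A_eq0|A_neq0] := eqVneq A 0.
  rewrite big1 ?mulr_ge0 ?sqrtr_ge0 // => i _.
  have /eqP : A = 0 := A_eq0; rewrite psumr_eq0; last by move=> k _; exact: sqr_ge0.
  by move=> /allP /(_ i); rewrite mem_index_enum sqrf_eq0 => /(_ isT) /eqP ->; rewrite mul0r.
have [B_eq0|B_neq0] := eqVneq B 0.
  rewrite big1 ?mulr_ge0 ?sqrtr_ge0 // => i _.
  have /eqP : B = 0 := B_eq0; rewrite psumr_eq0; last by move=> k _; exact: sqr_ge0.
  by move=> /allP /(_ i); rewrite mem_index_enum sqrf_eq0 => /(_ isT) /eqP ->; rewrite mulr0.
set p := Num.sqrt A; set q := Num.sqrt B.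
have p0 : 0 < p by rewrite sqrtr_gt0 lt_neqAle eq_sym A_neq0.
have q0 : 0 < q by rewrite sqrtr_gt0 lt_neqAle eq_sym B_neq0.
have pA : p ^+ 2 = A by rewrite sqr_sqrtr.
have qB : q ^+ 2 = B by rewrite sqr_sqrtr.
have H i : a i * b i <= (q / p * a i ^+ 2 + p / q * b i ^+ 2) / 2.
  rewrite -subr_ge0.
  have -> : (q / p * a i ^+ 2 + p / q * b i ^+ 2) / 2 - a i * b i =
    (q * a i - p * b i) ^+ 2 / (2 * p * q) by field; rewrite !gt_eqF.
  by rewrite divr_ge0 ?sqr_ge0 // !mulr_ge0 // ltW.
apply: le_trans (ler_sum _ (fun i _ => H i)) _.
rewrite -mulr_suml big_split /= -!mulr_sumr -/A -/B -pA -qB le_eqVlt; apply/orP; left.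
by apply/eqP; field; rewrite !gt_eqF.
Qed.

Section Forward.
Context {R : realType}.
Variables (n : nat) (r : R).
Notation leb := (lebesgue_tuple R).
Notation V := ('cV[R]_n).
Notation W := ('cV[R[i]]_n).
Hypothesis r0 : 0 <= r.

Definition wave (w : W) (x : V) : R[i] :=
  cexp (- (2 * pi%:C * 'i%C) * \sum_j (x j 0)%:C * w j 0).

Definition laplace (h : V -> R[i]) (w : W) : R[i] :=
  cint (leb n) (fun t => h (col_of_tuple t) * wave w (col_of_tuple t)).

Definition imnorm (w : W) : R := Num.sqrt (\sum_j complex.Im (w j 0) ^+ 2).

Lemma wave_csmooth w : csmooth (wave w).
Proof.
apply: csmooth_cexp; apply: csmoothM; first exact: csmooth_cst.
by apply: csmooth_sum => j; apply: csmoothM; [exact: csmooth_coord|exact: csmooth_cst].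
Qed.

Lemma wave_pderiv w j :
  pderiv (wave w) j (fun x => - (2 * pi%:C * 'i%C) * w j 0 * wave w x).
Proof.
apply: pderiv_cexp => x.
have := rderiv_affine (- (2 * pi%:C * 'i%C) * \sum_i (x i 0)%:C * w i 0)
  (- (2 * pi%:C * 'i%C) * w j 0) 0.
rewrite (_ : (fun s => _) = fun s : R => - (2 * pi%:C * 'i%C) *
  \sum_i ((x + s *: delta_mx j 0) i 0)%:C * w i 0) //.
apply/funext => s; rewrite mulrCA -mulrDr; congr (_ * _)%R.
have -> : s%:C * w j 0 = \sum_i (s * (i == j)%:R)%:C * w i 0.
  rewrite (bigD1 j) //= eqxx mulr1 big1 ?addr0 // => i /negbTE ->.
  by rewrite mulr0 mul0r.
rewrite -big_split /=; apply: eq_bigr => i _.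
by rewrite !mxE eqxx andbT (rmorphD (real_complex R)) mulrDl.
Qed.

Lemma wave_bound w (x : V) : enorm x <= r -> cabs (wave w x) <= expR (2 * pi * r * imnorm w).
Proof.
move=> xr; rewrite cabs_cexp ler_expR.
have -> : complex.Re (- (2 * pi%:C * 'i%C) * \sum_j (x j 0)%:C * w j 0) =
    2 * pi * \sum_j x j 0 * complex.Im (w j 0).
  have Ims (I : finType) (F : I -> R[i]) : complex.Im (\sum_i F i) = \sum_i complex.Im (F i).
    by elim/big_rec2 : _ => // i a b _ <-; rewrite Im_add.
  rewrite Re_mul !Re_opp !Im_opp !Re_mul !Im_mul /= Ims.
  rewrite (eq_bigr (fun j => x j 0 * complex.Im (w j 0))); first by ring.
  by move=> j _; rewrite Im_mul /= mul0r addr0.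
have p0 : 0 <= 2 * pi :> R by rewrite mulr_ge0 // pi_ge0.
rewrite -[leRHS]mulrA ler_wpM2l //; apply: le_trans (cauchy_schwarz_sum _ _) _.
by rewrite ler_wpM2r ?sqrtr_ge0.
Qed.

Definition supported (h : V -> R[i]) := csmooth h /\ forall x, r < enorm x -> h x = 0.

(** The square of the Euclidean norm is continuous, being a polynomial in the
    coordinates. *)
Lemma open_enorm_gt : open [set x : V | r < enorm x].
Proof.
pose q (x : V) : R[i] := \sum_j (x j 0)%:C * (x j 0)%:C.
have qc : continuous (fun x => complex.Re (q x)).
  have /csmooth_vcont[] // : csmooth q.
  by apply: csmooth_sum => j; apply: csmoothM; exact: csmooth_coord.
have E x : complex.Re (q x) = enorm x ^+ 2.
  rewrite sqr_sqrtr; last by apply: sumr_ge0 => j _; exact: sqr_ge0.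
  rewrite /q (_ : \sum_j _ = (\sum_j x j 0 ^+ 2)%:C) // Csum.
  by apply: eq_bigr => j _; rewrite expr2 (rmorphM (real_complex R)).
rewrite (_ : mkset _ = (fun x => complex.Re (q x)) @^-1` `]r ^+ 2, +oo[%classic).
  by apply: open_comp => [x _|]; [exact: qc|exact: interval_open].
have rE (x : V) : (r ^+ 2 < enorm x ^+ 2) = (r < enorm x).
  by rewrite ltr_pXn2r // nnegrE ?enorm_ge0.
by apply/seteqP; split=> x /=; rewrite in_itv /= andbT E rE.
Qed.

Lemma supported_pderiv h j : supported h -> exists2 h', supported h' & pderiv h j h'.
Proof.
move=> [sh h0]; have [h' sh' hh'] := csmooth_pderiv j sh.
by exists h' => //; split => //; exact: (pderiv_local0 open_enorm_gt h0 hh').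
Qed.

Lemma laplace_bound h : supported h ->
  exists2 C, 0 <= C & forall w, cabs (laplace h w) <= C * expR (2 * pi * r * imnorm w).
Proof.
move=> sh; have hc := csmooth_vcont sh.1; have h0 := sh.2.
have [C C0 HC] := compact_rapid hc h0.
have ik := rintegrableZl C (@rintegrable_kernel_prod R n).
exists (2 * \int[leb n]_t (C * kernel_prod t)).
  by rewrite mulr_ge0 // Rintegral_ge0 // => t _; rewrite mulr_ge0 // kernel_prod_ge0.
move=> w; set E := expR _.
have -> : 2 * \int[leb n]_t (C * kernel_prod t) * E =
    2 * \int[leb n]_t (E * (C * kernel_prod t)) by rewrite [in RHS]RintegralZl //; ring.
apply: cint_norm_le; last 2 first.
- exact: rintegrableZl.
- move=> t; rewrite cabsM; have [rx|rx] := ltrP r (enorm (col_of_tuple t)).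
    by rewrite h0 // cabs0 mul0r mulr_ge0 ?expR_ge0 // mulr_ge0 // kernel_prod_ge0.
  by rewrite mulrC; apply: ler_pM; rewrite ?cabs_ge0 ?wave_bound.
- apply: cmeasM; first exact: (compact_rapid_cmeas hc h0).1.
  exact/tcont_measurable/vcont_tcont/csmooth_vcont/wave_csmooth.
Qed.

(** The j-th derivative of h times the wave integrates to 0 by [cint_pderiv0],
    and the wave has the logarithmic derivative - 2 pi i w_j. *)
Lemma laplace_pderiv h j h' (w : W) : supported h -> supported h' -> pderiv h j h' ->
  (2 * pi%:C * 'i%C) * w j 0 * laplace h w = laplace h' w.
Proof.
move=> sh sh' hh'; have h0 := sh.2; have h0' := sh'.2.
pose c := - (2 * pi%:C * 'i%C) * w j 0.
have wc := csmooth_vcont (wave_csmooth w).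
have hc := csmooth_vcont sh.1; have hc' := csmooth_vcont sh'.1.
have D := pderivM hh' (wave_pderiv w j).
have rap k : vcont k -> (forall x, r < enorm x -> k x = 0) ->
    cintegrable (leb n) (fun t => k (col_of_tuple t) * wave w (col_of_tuple t)).
  move=> kc k0; have K0 x : r < enorm x -> k x * wave w x = 0 by move=> /k0 ->; rewrite mul0r.
  exact: rapid_cintegrable (compact_rapid_cmeas (vcontM kc wc) K0).
have := @cint_pderiv0 _ _ r _ j _ _ _ _ D.
rewrite (@eq_cint _ _ _ _ _ (fun t => h' (col_of_tuple t) * wave w (col_of_tuple t) +
  c * (h (col_of_tuple t) * wave w (col_of_tuple t)))); last by move=> t; rewrite /c; ring.
rewrite cintD; [|exact: rap|]; last first.
  have [k1 k2] := rap h hc h0.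
  have K0 x : r < enorm x -> c * (h x * wave w x) = 0 by move=> /h0 ->; rewrite mul0r mulr0.
  have cc : vcont (fun _ : V => c) by apply: csmooth_vcont; exact: csmooth_cst.
  exact: rapid_cintegrable (compact_rapid_cmeas (vcontM cc (vcontM hc wc)) K0).
rewrite cintZl; last exact: rap.
rewrite -/(laplace h w) -/(laplace h' w) => E.
apply/eqP; rewrite -subr_eq0 -oppr_eq0 -(E _ _ _); first by apply/eqP; rewrite /c; ring.
- apply: vcontD; apply: vcontM => //; apply: vcontM => //.
  by apply: csmooth_vcont; exact: csmooth_cst.
- by move=> x /h0 ->; rewrite mul0r.
- by move=> x rx; rewrite h0 // h0' // !mul0r addr0.
Qed.

(** One more power of 1 + |w_1| + ... + |w_n| is paid for by the transforms of h
    and of its first derivatives, by [laplace_pderiv]. *)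
Theorem laplace_decay N h : supported h -> exists2 C, 0 <= C & forall w : W,
  (1 + \sum_j cabs (w j 0)) ^+ N * cabs (laplace h w) <= C * expR (2 * pi * r * imnorm w).
Proof.
elim: N h => [|N IH] h sh.
  by have [C C0 HC] := laplace_bound sh; exists C => // w; rewrite expr0 mul1r.
have [C C0 HC] := IH h sh.
have /choice[hd Hd] j : exists h', supported h' /\ pderiv h j h'.
  by have [h' sh' hh'] := supported_pderiv j sh; exists h'.
have /choice[Cd HCd] j : exists c, 0 <= c /\ forall w : W, (1 + \sum_j cabs (w j 0)) ^+ N *
    cabs (laplace (hd j) w) <= c * expR (2 * pi * r * imnorm w).
  by have [c c0 Hc] := IH _ (Hd j).1; exists c.
exists (C + \sum_j Cd j).
  by rewrite addr_ge0 // sumr_ge0 // => j _; exact: (HCd j).1.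
move=> w; set E := expR _; set S := 1 + _.
have S0 : 0 <= S ^+ N by rewrite exprn_ge0 // addr_ge0 // sumr_ge0 // => j _; exact: cabs_ge0.
have -> : S ^+ N.+1 * cabs (laplace h w) =
    S ^+ N * cabs (laplace h w) + \sum_j S ^+ N * (cabs (w j 0) * cabs (laplace h w)).
  rewrite -mulr_sumr -mulr_suml exprSr /S; ring.
rewrite mulrDl; apply: lerD; first exact: HC.
rewrite mulr_suml; apply: ler_sum => j _.
apply: le_trans ((HCd j).2 w); rewrite -/S ler_wpM2l //.
rewrite -(laplace_pderiv w sh (Hd j).1 (Hd j).2) cabsM cabsM.
rewrite ler_wpM2r ?cabs_ge0 // ler_peMl ?cabs_ge0 //.
have -> : cabs (2 * pi%:C * 'i%C) = 2 * pi :> R.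
  have -> : 2 * pi%:C * 'i%C = 0 +i* (2 * pi) :> R[i].
    by apply: complexP; rewrite ?Re_mul ?Im_mul /=; ring.
  by rewrite cabs_imag ger0_norm // mulr_ge0 // pi_ge0.
by have := @pi_ge2 R; lra.
Qed.

(** Every derivative is bounded and supported in the ball, where (1 + |x|)^N is
    at most (1 + r)^N. *)
Lemma supported_schwartz (f : V -> R[i]) : supported f -> schwartz f.
Proof.
move=> sf; have [sm1 sm2] := csmooth_smooth sf.1.
have key (p : R[i] -> R) (ple : forall a, `|p a| <= cabs a)
    (pd : forall k j k', @pderiv R n k j k' ->
      forall x, is_derive x (delta_mx j 0) (fun x => p (k x)) (p (k' x))) s (N : nat) :
    exists M' : R, forall x : V, (1 + enorm x) ^+ N * `|partials s (fun x => p (f x)) x| <= M'.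
  have [k sk ->] : exists2 k, supported k & partials s (fun x => p (f x)) = fun x => p (k x).
    elim: s => [|i s [k sk IH]]; first by exists f.
    have [k' sk' kk'] := supported_pderiv i sk; exists k' => //=; rewrite IH.
    by apply/funext => x; have [_ ->] := pd _ _ _ kk' x.
  have [c c0 Hc] := compact_support_bounded (csmooth_vcont sk.1) sk.2.
  exists ((1 + r) ^+ N * c) => x; have e0 := enorm_ge0 x.
  have [rx|rx] := ltrP r (enorm x).
    have -> : p (k x) = 0.
      by apply/eqP; rewrite -normr_eq0 eq_le normr_ge0 andbT (le_trans (ple _)) // sk.2 // cabs0.
    by rewrite normr0 mulr0 mulr_ge0 // exprn_ge0 // addr_ge0.
  apply: ler_pM; rewrite ?exprn_ge0 ?addr_ge0 //.
    by apply: lerXn2r; rewrite ?nnegrE ?addr_ge0 ?lerD2l.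
  exact: le_trans (ple _) (Hc x).
split; split => //; apply: key.
- exact: norm_Re_le.
- exact: pderiv_Re.
- exact: norm_Im_le.
- exact: pderiv_Im.
Qed.

End Forward.

(** * The linear canonical transform *)

Section Entire.
Context {R : realType}.
Variables (n : nat) (g : 'cV[R[i]]_n -> R[i]).
Hypothesis ge : entire g.

Lemma gt0_realC (d : R[i]) : 0 < d -> exists2 e : R, 0 < e & d = e%:C.
Proof.
case: d => a b; rewrite ltcE /= => /andP[/eqP -> a0]; by exists a.
Qed.

Lemma entire_continuous (z : 'cV[R[i]]_n) (e : R) : 0 < e -> exists2 d : R, 0 < d &
  forall w : 'cV[R[i]]_n, (forall j, cabs (z j 0 - w j 0) < d) -> cabs (g z - g w) <= e.
Proof.
move=> e0; have /cvgrPdist_le cg := differentiable_continuous (ge z).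
have eC : 0 < e%:C :> R[i] by rewrite ltcR.
have /nbhs_ballP[d /= d0 Hd] := cg _ eC.
have [r r0 dr] := gt0_realC d0; exists r => // w zw.
have := Hd w; rewrite cabsE lecR; apply; split => // i k.
by rewrite (ord1 k) /ball /= dr cabsE ltcR; exact: zw.
Qed.

Lemma entire_line (z v : 'cV[R[i]]_n) : holomorphic (fun s => g (z + s *: v)).
Proof.
move=> s0; have /(diff_derivable (v := v)) := ge (z + s0 *: v).
rewrite /derivable => /cvg_ex[/= l /cvgrPdist_le gl]; exists l => e e0.
have eC : 0 < e%:C :> R[i] by rewrite ltcR.
have := gl _ eC; rewrite near_withinE => /nbhs_ballP[d /= d0 Hd].
have [r r0 dr] := gt0_realC d0; exists r => // h hr.
have [->|h0] := eqVneq h 0.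
  by rewrite addr0 subrr mulr0 subrr cabs0 mulr0.
have := Hd h; rewrite /ball /= sub0r normrN dr cabsE ltcR => /(_ hr h0) /=.
rewrite cabsE lecR => H.
have hc := cabs_gt0 h0.
rewrite -(ler_pM2r hc) -cabsM in H; apply: le_trans H.
rewrite le_eqVlt; apply/orP; left; apply/eqP; rewrite -cabsN; congr cabs.
rewrite /GRing.scale /= [h *: v + _]addrC -(addrA z) -scalerDl; field.
exact: h0.
Qed.

End Entire.

Section BilinearForm.
Context {R : realType}.
Variable n : nat.
Notation toC := (map_mx (real_complex R)).

Lemma dotvDl (K : comNzRingType) (x y z : 'cV[K]_n) : dotv (x + y) z = dotv x z + dotv y z.
Proof. by rewrite /dotv -big_split /=; apply: eq_bigr => j _; rewrite mxE mulrDl. Qed.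

Lemma dotvDr (K : comNzRingType) (x y z : 'cV[K]_n) : dotv x (y + z) = dotv x y + dotv x z.
Proof. by rewrite /dotv -big_split /=; apply: eq_bigr => j _; rewrite mxE mulrDr. Qed.

Lemma dotvZl (K : comNzRingType) (a : K) (x y : 'cV[K]_n) : dotv (a *: x) y = a * dotv x y.
Proof. by rewrite /dotv mulr_sumr; apply: eq_bigr => j _; rewrite mxE mulrA. Qed.

Lemma dotvZr (K : comNzRingType) (a : K) (x y : 'cV[K]_n) : dotv x (a *: y) = a * dotv x y.
Proof. by rewrite /dotv mulr_sumr; apply: eq_bigr => j _; rewrite mxE mulrCA. Qed.

Lemma dotv_trmx (K : comNzRingType) (M : 'M[K]_n) (x y : 'cV[K]_n) :
  dotv x (M *m y) = dotv y (M^T *m x).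
Proof.
rewrite /dotv; under eq_bigr do rewrite mxE mulr_sumr.
rewrite exchange_big /=; apply: eq_bigr => j _; rewrite mxE mulr_sumr.
by apply: eq_bigr => i _; rewrite mxE mulrCA mulrA [y j 0 * _]mulrC -mulrA [x i 0 * _]mulrC mulrA.
Qed.

Definition cpoint (xi eta : 'cV[R]_n) : 'cV[R[i]]_n := \col_j (xi j 0 +i* eta j 0).

Lemma cpointE xi eta : cpoint xi eta = cvec xi + 'i%C *: cvec eta.
Proof.
apply/matrixP => i k; rewrite (ord1 k) !mxE.
by apply: complexP; rewrite ?Re_add ?Im_add ?Re_mul ?Im_mul /=; ring.
Qed.

Lemma mulmx_cvec (M : 'M[R]_n) (x : 'cV[R]_n) : toC M *m cvec x = cvec (M *m x).
Proof. by rewrite /cvec map_mxM. Qed.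

Lemma mulmx_cpoint (M : 'M[R]_n) xi eta :
  toC M *m cpoint xi eta = cpoint (M *m xi) (M *m eta).
Proof. by rewrite !cpointE mulmxDr -scalemxAr !mulmx_cvec. Qed.

Lemma dotv_cvec (x y : 'cV[R]_n) : dotv (cvec x) (cvec y) = (dotv x y)%:C.
Proof. by rewrite /dotv Csum; apply: eq_bigr => j _; rewrite !mxE (rmorphM (real_complex R)). Qed.

(** The cross terms xi.M eta + eta.M xi only see the symmetric part of M. *)
Lemma Im_quadratic (M : 'M[R]_n) xi eta :
  complex.Im (dotv (cpoint xi eta) (toC M *m cpoint xi eta)) =
  2 * dotv xi (sympart M *m eta).
Proof.
rewrite mulmx_cpoint !cpointE !(dotvDl, dotvDr, dotvZl, dotvZr, dotv_cvec).
have -> : dotv xi (sympart M *m eta) = (dotv xi (M *m eta) + dotv eta (M *m xi)) / 2.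
  rewrite /sympart -scalemxAl dotvZr mulmxDl dotvDr mulrC; congr (_ * _)%R.
  by congr (_ + _)%R; rewrite [RHS]dotv_trmx.
by rewrite ?Im_add ?Im_mul ?Re_add ?Re_mul /=; field.
Qed.

(** The source of the factor of the growth condition that does not involve r. *)
Lemma quadratic_modulus (M : 'M[R]_n) xi eta :
  cabs (cexp ('i%C * pi%:C * dotv (cpoint xi eta) (toC M *m cpoint xi eta))) =
  expR (- 2 * pi * dotv xi (sympart M *m eta)).
Proof.
rewrite cabs_cexp; congr expR.
have Rei (a : R) (w : R[i]) : complex.Re ('i%C * a%:C * w) = - (a * complex.Im w).
  by rewrite !Re_mul Im_mul /=; ring.
by rewrite Rei Im_quadratic; ring.
Qed.

Lemma imnorm_cpoint (xi eta : 'cV[R]_n) : imnorm (cpoint xi eta) = enorm eta.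
Proof. by rewrite /imnorm /enorm; congr Num.sqrt; apply: eq_bigr => j _; rewrite mxE. Qed.

Lemma coord_cabs_le (z : 'cV[R[i]]_n) j : cabs (z j 0) <= \sum_j cabs (z j 0).
Proof. by rewrite (bigD1 j) //= lerDl sumr_ge0 // => k _; exact: cabs_ge0. Qed.

Lemma cenorm_le_sum (z : 'cV[R[i]]_n) : cenorm z <= \sum_j cabs (z j 0).
Proof.
have S0 : 0 <= \sum_j cabs (z j 0) by apply: sumr_ge0 => j _; exact: cabs_ge0.
rewrite -(ler_pXn2r (ltn0Sn 1)) ?nnegrE ?sqrtr_ge0 //.
rewrite sqr_sqrtr; last by apply: sumr_ge0 => j _; rewrite addr_ge0 // sqr_ge0.
under eq_bigr do rewrite -cabs_sqr.
by apply: sum_sqr_le => j; exact: cabs_ge0.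
Qed.

Lemma coord_le_cenorm (z : 'cV[R[i]]_n) j : cabs (z j 0) <= cenorm z.
Proof.
rewrite -(ler_pXn2r (ltn0Sn 1)) ?nnegrE ?sqrtr_ge0 ?cabs_ge0 //.
rewrite sqr_sqrtr; last by apply: sumr_ge0 => k _; rewrite addr_ge0 // sqr_ge0.
rewrite cabs_sqr (bigD1 j) //= lerDl sumr_ge0 // => k _.
by rewrite addr_ge0 // sqr_ge0.
Qed.

Lemma waveE (w : 'cV[R[i]]_n) (x : 'cV[R]_n) :
  wave w x = cexp (- (2 * pi%:C * 'i%C) * dotv (cvec x) w).
Proof. by rewrite /wave /dotv; congr (cexp (_ * _)); apply: eq_bigr => j _; rewrite mxE. Qed.

(** A crude operator norm, which serves to compare |z| and |B^-1 z| up to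
    constants. *)
Definition mxsum (M : 'M[R]_n) : R := \sum_i \sum_j `|M i j|.

Lemma mxsum_ge0 M : 0 <= mxsum M.
Proof. by apply: sumr_ge0 => i _; apply: sumr_ge0. Qed.

Lemma sum_mulmx_le (M : 'M[R]_n) (w : 'cV[R[i]]_n) (S : R) : (forall j, cabs (w j 0) <= S) ->
  \sum_j cabs ((toC M *m w) j 0) <= mxsum M * S.
Proof.
move=> wS; rewrite /mxsum mulr_suml; apply: ler_sum => i _; rewrite mxE mulr_suml.
apply: le_trans (cabs_sum _ _) _; apply: ler_sum => j _.
by rewrite mxE cabsM cabsR ler_wpM2l.
Qed.

End BilinearForm.

Section Assembly.
Context {R : realType}.
Variables (n : nat) (A B C D : 'M[R]_n).
Hypothesis detB : \det B != 0.
Variables (b : R[i]).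
Hypothesis bB : b ^+ 2 = (\det B)%:C.
Variable r : R.
Hypothesis r0 : 0 <= r.
Notation toC := (map_mx (real_complex R)).
Notation V := ('cV[R]_n).
Notation W := ('cV[R[i]]_n).
Notation leb := (lebesgue_tuple R).
Notation Rm := (measurableTypeR R).
Let M := D *m invmx B.
Let Q := invmx B *m A.

Definition kappa : R[i] := cexp ('i%C * (pi * n%:R / 4)%:C) * b.

Lemma kappa_neq0 : kappa != 0.
Proof.
rewrite mulf_neq0 ?cexp_neq0 //; apply: contra detB => /eqP b0.
by move: bB; rewrite b0 expr0n => /(congr1 (@complex.Re R)) /= <-.
Qed.

Let Bu : B \in unitmx. Proof. by rewrite unitmxE unitfE. Qed.

Let toCK (z : W) : toC B *m (toC (invmx B) *m z) = z.
Proof. by rewrite mulmxA -map_mxM (mulmxV Bu) map_mx1 mul1mx. Qed.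

Let toCK' (z : W) : toC (invmx B) *m (toC B *m z) = z.
Proof. by rewrite mulmxA -map_mxM (mulVmx Bu) map_mx1 mul1mx. Qed.

Definition chirp (c : R[i]) (x : V) : R[i] := cexp (c * dotv (cvec x) (toC Q *m cvec x)).

Lemma chirp_csmooth c : csmooth (chirp c).
Proof.
apply: csmooth_cexp; apply: csmoothM; first exact: csmooth_cst.
apply: csmooth_sum => j; apply: csmoothM.
  by under eq_fun do rewrite mxE; exact: csmooth_coord.
under eq_fun do rewrite mxE; apply: csmooth_sum => k; apply: csmoothM; first exact: csmooth_cst.
by under eq_fun do rewrite mxE; exact: csmooth_coord.
Qed.

Let ip : R[i] := 'i%C * pi%:C.

(** The exponent of the kernel is the sum of a term in z, a term in x and the
    Fourier pairing of x with B^-1 z. *)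
Lemma lct_laplace f (z : W) : supported r (fun x => f x * chirp ip x) ->
  lct (block_mx A B C D) b f z =
  kappa^-1 * (cexp (ip * dotv z (toC M *m z)) *
              laplace (fun x => f x * chirp ip x) (toC (invmx B) *m z)).
Proof.
move=> sf; rewrite /lct block_mxKul block_mxKur block_mxKdr; congr (_ * _)%R.
rewrite -[integral_Rn _]/(cint (leb n) _).
rewrite /laplace -cintZl; last first.
  pose k x := f x * chirp ip x * wave (toC (invmx B) *m z) x.
  apply: (@rapid_cintegrable _ _ (fun t => k (col_of_tuple t))).
  apply: (@compact_rapid_cmeas _ _ r) => [|x rx]; last by rewrite /k sf.2 // mul0r.
  by apply: vcontM; apply: csmooth_vcont; [exact: sf.1|exact: wave_csmooth].
apply: eq_cint => t; rewrite waveE /chirp.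
set x := cvec _; set w := toC (invmx B) *m z.
have -> : 'i%C * pi%:C * (dotv z (toC (D *m invmx B) *m z) + dotv x (toC (invmx B *m A) *m x)) -
    2 * 'i%C * pi%:C * dotv x w =
  ip * dotv z (toC M *m z) + ip * dotv x (toC Q *m x) + - (2 * pi%:C * 'i%C) * dotv x w.
  by rewrite /ip /M /Q; ring.
by rewrite cexpD cexpD; ring.
Qed.

Lemma schwartz_supported f : schwartz f -> supp f `<=` eball r ->
  supported r (fun x => f x * chirp ip x).
Proof.
move=> [[s1 _] [s2 _]] sr; split.
  apply: csmoothM; last exact: chirp_csmooth.
  have := csmoothD (csmooth_real s1) (csmoothM (@csmooth_cst R n 'i%C) (csmooth_real s2)).
  rewrite (_ : (fun x => _ + _) = f) //; apply/funext => x.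
  by apply: complexP; rewrite ?Re_add ?Im_add ?Re_mul ?Im_mul /=; ring.
move=> x rx; have [->|fx] := eqVneq (f x) 0; first by rewrite mul0r.
have /sr : supp f x by apply: subset_closure.
by rewrite /eball /= leNgt rx.
Qed.

(** [laplace_decay] at w = B^-1 z; the constant K converts powers of 1 + |w|
    into powers of 1 + |z|, since z = B w. *)
Lemma lct_decay f (N : nat) : supported r (fun x => f x * chirp ip x) ->
  exists2 CN : R, 0 < CN & forall xi eta : V,
    cabs (lct (block_mx A B C D) b f (cpoint xi eta)) <=
    CN * (expR (- 2 * pi * dotv xi (sympart M *m eta) + 2 * pi * r * enorm (invmx B *m eta)) /
      (1 + cenorm (cpoint xi eta)) ^+ N).
Proof.
move=> sf; have [c c0 Hc] := laplace_decay r0 N sf.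
pose K := 1 + mxsum B.
have K1 : 1 <= K by rewrite lerDl mxsum_ge0.
have K0 : 0 <= K := le_trans ler01 K1.
exists (cabs kappa^-1 * (K ^+ N * c) + 1).
  by rewrite ltr_wpDl // !mulr_ge0 ?cabs_ge0 // exprn_ge0.
move=> xi eta; set z := cpoint xi eta; rewrite lct_laplace // cabsM cabsM quadratic_modulus expRD.
set w := toC (invmx B) *m z.
have wE : imnorm w = enorm (invmx B *m eta) by rewrite /w mulmx_cpoint imnorm_cpoint.
have := Hc w; rewrite wE; set E := expR (2 * pi * r * _); set S := 1 + _ => HS.
set L := cabs (laplace _ _) in HS *; set P := expR _.
have z1 : 0 < 1 + cenorm z by rewrite ltr_pwDl // sqrtr_ge0.
have S1 : 1 + cenorm z <= K * S.
  have := sum_mulmx_le B (coord_cabs_le w); rewrite /w toCK => zS.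
  have := le_trans (cenorm_le_sum z) zS; rewrite -/w.
  have T0 : 0 <= \sum_j cabs (w j 0) by apply: sumr_ge0 => j _; exact: cabs_ge0.
  have := mxsum_ge0 B; rewrite /K /S; nra.
rewrite [leRHS]mulrA ler_pdivlMr ?exprn_gt0 //.
have zN : (1 + cenorm z) ^+ N <= K ^+ N * S ^+ N.
  have KS0 := le_trans (ltW z1) S1.
  by rewrite -exprMn; apply: lerXn2r; rewrite ?nnegrE // ltW.
have P0 : 0 <= P by exact: expR_ge0.
have E0 : 0 <= E by exact: expR_ge0.
have k0 : 0 <= cabs kappa^-1 := cabs_ge0 _.
have L0 : 0 <= L := cabs_ge0 _.
apply: (@le_trans _ _ (cabs kappa^-1 * (P * L) * (K ^+ N * S ^+ N))).
  by rewrite ler_wpM2l // !mulr_ge0.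
have -> : cabs kappa^-1 * (P * L) * (K ^+ N * S ^+ N) =
  cabs kappa^-1 * P * K ^+ N * (S ^+ N * L) by ring.
apply: (@le_trans _ _ (cabs kappa^-1 * P * K ^+ N * (c * E))).
  by rewrite ler_wpM2l // !mulr_ge0 // exprn_ge0.
have -> : cabs kappa^-1 * P * K ^+ N * (c * E) = cabs kappa^-1 * (K ^+ N * c) * (P * E) by ring.
by rewrite ler_wpM2r ?mulr_ge0 // lerDl.
Qed.

Section Backward.
Variable g : W -> R[i].
Hypothesis g_entire : entire g.
Hypothesis g_decay : forall N : nat, exists2 CN : R, 0 < CN & forall xi eta : V,
  cabs (g (cpoint xi eta)) <= CN * (expR (- 2 * pi * dotv xi (sympart M *m eta) +
    2 * pi * r * enorm (invmx B *m eta)) / (1 + cenorm (cpoint xi eta)) ^+ N).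

(** The function F such that g z = kappa^-1 * exp (i pi z.Mz) * F (B^-1 z); it
    has to be a Fourier-Laplace transform. *)
Definition dechirped (w : W) : R[i] :=
  kappa * (g (toC B *m w) * cexp (- (ip * dotv (toC B *m w) (toC M *m (toC B *m w))))).

Let ctup_cpoint (xi eta : n.-tuple Rm) : ctup xi eta = cpoint (col_of_tuple xi) (col_of_tuple eta).
Proof. by apply/matrixP => i k; rewrite (ord1 k) !mxE. Qed.

Lemma dechirped_decay (N : nat) : exists2 c : R, 0 <= c & forall xi eta : n.-tuple Rm,
  weight xi ^+ N * cabs (dechirped (ctup xi eta)) <= c * expR (2 * pi * r * tnorm eta).
Proof.
have [CN CN0 HC] := g_decay N; pose K := 1 + mxsum (invmx B).
have K1 : 1 <= K by rewrite lerDl mxsum_ge0.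
have K0 : 0 <= K := le_trans ler01 K1.
exists (cabs kappa * (K ^+ N * CN)).
  by rewrite !mulr_ge0 ?cabs_ge0 ?exprn_ge0 // ltW.
move=> xi eta; rewrite /dechirped ctup_cpoint mulmx_cpoint -enorm_tnorm.
set x := col_of_tuple xi; set y := col_of_tuple eta; set z := cpoint _ _.
have := HC (B *m x) (B *m y); rewrite -/z (mulmxA (invmx B)) (mulVmx Bu) mul1mx expRD.
set P := expR _; set E := expR _ => Hg.
have P0 : 0 < P by exact: expR_gt0.
have E0 : 0 < E by exact: expR_gt0.
have -> : cabs (kappa * (g z * cexp (- (ip * dotv z (toC M *m z))))) =
    cabs kappa * (cabs (g z) * P^-1).
  rewrite cabsM cabsM cexpN; congr (_ * (_ * _))%R.
  by rewrite -[P]quadratic_modulus cabsV.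
have z1 : 0 < 1 + cenorm z by rewrite ltr_pwDl // sqrtr_ge0.
have wz : weight xi <= K * (1 + cenorm z).
  have := sum_mulmx_le (invmx B) (coord_le_cenorm z).
  have -> : toC (invmx B) *m z = cpoint x y.
    by rewrite /z -mulmx_cpoint toCK'.
  have le1 : \sum_j `|tnth xi j| <= \sum_j cabs (cpoint x y j 0).
    by apply: ler_sum => j _; apply: le_trans (norm_Re_le _); rewrite !mxE.
  have := mxsum_ge0 (invmx B); have : 0 <= cenorm z by exact: sqrtr_ge0.
  rewrite /weight /K; nra.
have wN : weight xi ^+ N <= K ^+ N * (1 + cenorm z) ^+ N.
  have Kz0 := le_trans (weight_ge0 xi) wz.
  by rewrite -exprMn; apply: lerXn2r; rewrite ?nnegrE // weight_ge0.
have zN0 : 0 < (1 + cenorm z) ^+ N by rewrite exprn_gt0.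
have Hg' : cabs (g z) * P^-1 * (1 + cenorm z) ^+ N <= CN * E.
  move: Hg; rewrite mulrA ler_pdivlMr // => Hg.
  by rewrite mulrAC ler_pdivrMr // -mulrA [E * P]mulrC.
have G0 : 0 <= cabs (g z) * P^-1 by rewrite mulr_ge0 ?cabs_ge0 // invr_ge0 ltW.
apply: (@le_trans _ _ (K ^+ N * (1 + cenorm z) ^+ N * (cabs kappa * (cabs (g z) * P^-1)))).
  by rewrite ler_wpM2r // mulr_ge0 ?cabs_ge0.
have -> : K ^+ N * (1 + cenorm z) ^+ N * (cabs kappa * (cabs (g z) * P^-1)) =
  cabs kappa * K ^+ N * (cabs (g z) * P^-1 * (1 + cenorm z) ^+ N) by ring.
have -> : cabs kappa * (K ^+ N * CN) * E = cabs kappa * K ^+ N * (CN * E) by ring.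
by rewrite ler_wpM2l // mulr_ge0 ?cabs_ge0 // exprn_ge0.
Qed.

(** The n factors 1 + t_j^2 of the inverse of the product kernel cost 2 n powers
    of the weight. *)
Lemma kernel_prod_weight (t : n.-tuple Rm) : 1 <= weight t ^+ (2 * n) * kernel_prod t.
Proof.
rewrite exprM; apply: kernel_prod_lower => j.
have t1 : 1 + `|tnth t j : R| <= weight t.
  by rewrite /weight lerD2l (bigD1 j) //= lerDl sumr_ge0.
apply: (@le_trans _ _ ((1 + `|tnth t j : R|) ^+ 2)).
  rewrite -(real_normK (num_real (tnth t j : R))); have := normr_ge0 (tnth t j : R); nra.
by apply: lerXn2r; rewrite ?nnegrE ?weight_ge0 ?addr_ge0.
Qed.

Lemma dechirped_kernel (N : nat) : exists2 c : R, 0 <= c & forall xi eta : n.-tuple Rm,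
  weight xi ^+ N * cabs (dechirped (ctup xi eta)) <=
    c * expR (2 * pi * r * tnorm eta) * kernel_prod xi.
Proof.
have [c c0 Hc] := dechirped_decay (N + 2 * n); exists c => // xi eta.
set X := weight xi ^+ N * _.
have X0 : 0 <= X by rewrite mulr_ge0 ?cabs_ge0 // exprn_ge0 // weight_ge0.
apply: (@le_trans _ _ (X * (weight xi ^+ (2 * n) * kernel_prod xi))).
  by rewrite ler_peMr // kernel_prod_weight.
rewrite mulrA ler_wpM2r ?kernel_prod_ge0 //; apply: le_trans (Hc xi eta).
by rewrite exprD /X mulrAC.
Qed.

(** Along a complex line the exponent is a quadratic polynomial. *)
Lemma dechirped_hol z j : holomorphic (fun s => dechirped (z + s *: delta_mx j 0)).
Proof.
pose a : W := toC B *m z; pose v : W := toC B *m delta_mx j 0.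
pose q2 := - (ip * dotv v (toC M *m v)).
pose q1 := - (ip * (dotv a (toC M *m v) + dotv v (toC M *m a))).
pose q0 := - (ip * dotv a (toC M *m a)).
rewrite (_ : (fun s => _) = fun s =>
  kappa * cexp (q2 * s ^+ 2 + q1 * s + q0) * g (a + s *: v)); last first.
  apply/funext => s; rewrite /dechirped mulmxDr -scalemxAr -/a -/v -mulrA [g _ * _]mulrC.
  congr (_ * (cexp _ * _))%R.
  rewrite mulmxDr -scalemxAr !(dotvDl, dotvDr, dotvZl, dotvZr) /q0 /q1 /q2; ring.
move=> s; have [d Hd] := entire_line g_entire a v s.
have dk : cderiv (fun=> kappa) s 0.
  move=> e e0; exists 1 => // h _; rewrite subrr mul0r subrr cabs0 mulr_ge0 ?cabs_ge0 //.
  exact: ltW.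
eexists; exact: cderivM (cderivM dk (cderiv_cexp (cderiv_quadratic _ _ _ _))) Hd.
Qed.

Lemma dechirped_tcont (eta : n.-tuple Rm) : tcont (fun xi => dechirped (ctup xi eta)).
Proof.
pose y := col_of_tuple eta.
pose F (x : V) := dechirped (cpoint x y).
have -> : (fun xi => dechirped (ctup xi eta)) = fun xi => F (col_of_tuple xi).
  by apply/funext => xi; rewrite ctup_cpoint.
apply: vcont_tcont; rewrite /F /dechirped; apply: vcontM.
  by apply: csmooth_vcont; exact: csmooth_cst.
apply: vcontM; last first.
  apply: csmooth_vcont; apply: csmooth_cexp.
  have sp j : csmooth (fun x : V => (toC B *m cpoint x y) j 0).
    under eq_fun do rewrite mxE; apply: csmooth_sum => k.
    apply: csmoothM; first exact: csmooth_cst.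
    under eq_fun do rewrite cpointE !mxE.
    by apply: csmoothD; [exact: csmooth_coord|exact: csmooth_cst].
  under eq_fun do rewrite -mulNr; apply: csmoothM; first exact: csmooth_cst.
  apply: csmooth_sum => j; apply: csmoothM => //.
  under eq_fun do rewrite mxE; apply: csmooth_sum => k.
  by apply: csmoothM => //; exact: csmooth_cst.
apply: vcont_eps => x e e0.
have [d d0 Hd] := entire_continuous g_entire (toC B *m cpoint x y) e0.
have K0 : 0 < mxsum B + 1 by rewrite ltr_wpDl // mxsum_ge0.
exists (d / (mxsum B + 1)) => [|x' xx']; first exact: divr_gt0.
apply: Hd => j.
have -> : (toC B *m cpoint x y) j 0 - (toC B *m cpoint x' y) j 0 =
    (toC B *m (cpoint x y - cpoint x' y)) j 0 by rewrite mulmxBr !mxE.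
have coordle k : cabs ((cpoint x y - cpoint x' y) k 0) <= d / (mxsum B + 1).
  have -> : (cpoint x y - cpoint x' y) k 0 = (x k 0 - x' k 0)%:C.
    by rewrite !mxE; apply: complexP; rewrite ?Re_add ?Im_add /= ?subrr.
  by rewrite cabsR ltW.
have := sum_mulmx_le B coordle; set w := toC B *m _ => H.
apply: le_lt_trans (le_trans (coord_cabs_le w j) H) _.
by rewrite mulrCA gtr_pMr // ltr_pdivrMr // mul1r ltrDl.
Qed.

Let m (xi : n.-tuple Rm) := dechirped (ctup xi (tzero n)).

Lemma moment_dechirped : moment m.
Proof.
split; first exact/tcont_measurable/dechirped_tcont.
move=> N; have [c c0 Hc] := dechirped_kernel N.
by exists (c * expR (2 * pi * r * tnorm (tzero n))) => t; exact: Hc.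
Qed.

(** The opposite chirp cancels the one that [lct_laplace] introduces. *)
Definition preimage_density (x : V) : R[i] := inv_transform m x * chirp (- ip) x.

Let Fbound : exists2 c : R, 0 <= c & forall xi eta : n.-tuple Rm,
  cabs (dechirped (ctup xi eta)) <= c * expR (2 * pi * r * tnorm eta) * kernel_prod xi.
Proof.
have [c c0 Hc] := dechirped_kernel 0; exists c => // xi eta.
by have := Hc xi eta; rewrite expr0 mul1r.
Qed.

Let inv_transform0 x : r < enorm x -> inv_transform m x = 0.
Proof.
rewrite -[in enorm x](tuple_of_colK x) enorm_tnorm => rx.
exact: (density_support r0 dechirped_tcont dechirped_hol Fbound rx).
Qed.

Lemma preimage_supported : supported r preimage_density.
Proof.
split.
  apply: csmoothM; last exact: chirp_csmooth.
  exact: inv_transform_csmooth moment_dechirped.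
by move=> x rx; rewrite /preimage_density inv_transform0 // mul0r.
Qed.

Lemma preimage_supp : supp preimage_density `<=` eball r.
Proof.
have cl : closed (~` [set x : V | r < enorm x]) by apply: open_closedC; exact: (open_enorm_gt r0).
move=> x sx; rewrite /eball /= leNgt; apply/negP => rx.
have : (~` [set x : V | r < enorm x]) x.
  apply: cl; apply: closure_subset sx => y /= fy ry; move/eqP: fy; apply.
  by rewrite /preimage_density inv_transform0 // mul0r.
exact.
Qed.

(** This is [density_inversion], with the real part of w as the base point and
    its imaginary part as the shift. *)
Lemma laplace_preimage (w : W) : laplace (inv_transform m) w = dechirped w.
Proof.
pose a : n.-tuple Rm := [tuple (complex.Re (w j 0) : R) | j < n].
pose c : n.-tuple Rm := [tuple (complex.Im (w j 0) : R) | j < n].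
have wE : w = ctup a c.
  by apply/matrixP => i k; rewrite (ord1 k) !mxE !tnth_mktuple; case: (w i 0).
have dE t : inv_transform m (col_of_tuple t) = density dechirped t.
  by rewrite /inv_transform col_of_tupleK.
have md : cmeas (density dechirped).
  rewrite (_ : density _ = fun t => inv_transform m (col_of_tuple t)); last first.
    by apply/funext => t; rewrite dE.
  exact/tcont_measurable/vcont_tcont/csmooth_vcont/inv_transform_csmooth/moment_dechirped.
rewrite [in RHS]wE -(density_inversion r0 dechirped_tcont dechirped_hol Fbound a c md).
apply: eq_cint => t; rewrite dE; congr (_ * _)%R.
rewrite -cexp_real /phase -cexpD /wave; congr cexp.
have -> : \sum_j (col_of_tuple t j 0)%:C * w j 0 = (tdot t a)%:C + 'i%C * (tdot t c)%:C.
  rewrite /tdot !Csum mulr_sumr -big_split /=; apply: eq_bigr => j _; rewrite !mxE !tnth_mktuple.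
  by apply: complexP; rewrite ?Re_add ?Im_add ?Re_mul ?Im_mul /=; ring.
by apply: complexP; rewrite ?(Re_add, Im_add, Re_opp, Im_opp, Re_mul, Im_mul) /=; ring.
Qed.

Lemma preimage_lct z : g z = lct (block_mx A B C D) b preimage_density z.
Proof.
have fE : (fun x => preimage_density x * chirp ip x) = inv_transform m.
  apply/funext => x; rewrite /preimage_density /chirp -mulrA -cexpD mulNr addNr cexp0.
  by rewrite mulr1.
have sf : supported r (fun x => preimage_density x * chirp ip x).
  by rewrite fE; split; [exact: inv_transform_csmooth moment_dechirped|exact: inv_transform0].
rewrite lct_laplace // fE laplace_preimage /dechirped toCK cexpN.
set c := cexp _; have c0 : c != 0 by exact: cexp_neq0.
by have k0 := kappa_neq0; field; rewrite c0 k0.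
Qed.

End Backward.

End Assembly.

Theorem theorem32 (R : realType) (n : nat) (A B C D : 'M[R]_n)
    (S_symplectic : symplectic (block_mx A B C D))
    (detB_neq0 : \det B != 0)
    (b : R[i]) (b_sqrt_detB : b ^+ 2 = (\det B)%:C)
    (r : R) (r_ge0 : 0 <= r)
    (g : 'cV[R[i]]_n -> R[i]) (g_entire : entire g) :
  (exists f : 'cV[R]_n -> R[i],
     [/\ schwartz f, supp f `<=` eball r
       & forall z, g z = lct (block_mx A B C D) b f z])
  <->
  (forall N : nat, exists2 CN : R, 0 < CN &
     forall xi eta : 'cV[R]_n,
       let z := \col_j (xi j 0 +i* eta j 0) in
       `|g z| <=
       (CN * (expR (- 2 * pi * dotv xi (sympart (D *m invmx B) *m eta)
                    + 2 * pi * r * enorm (invmx B *m eta))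
              / (1 + cenorm z) ^+ N))%:C).
Proof.
split=> [[f [sf suppf gf]] N|decay].
- have sup := @schwartz_supported R n A B r f sf suppf.
  have [CN CN0 H] := @lct_decay R n A B C D detB_neq0 b r r_ge0 f N sup.
  by exists CN => // xi eta /=; rewrite cabsE lecR gf; exact: H.
- have decay' N : exists2 CN : R, 0 < CN & forall xi eta : 'cV[R]_n,
      cabs (g (cpoint xi eta)) <= CN * (expR (- 2 * pi * dotv xi (sympart (D *m invmx B) *m eta) +
        2 * pi * r * enorm (invmx B *m eta)) / (1 + cenorm (cpoint xi eta)) ^+ N).
    have [CN CN0 H] := decay N; exists CN => // xi eta.
    by rewrite -lecR -cabsE; exact: H.
  exists (preimage_density A B D b g); split.
  + by apply: (supported_schwartz r_ge0); exact: preimage_supported.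
  + exact: preimage_supp.
  + move=> z.
    exact: (@preimage_lct _ _ _ _ C _ detB_neq0 _ b_sqrt_detB _ r_ge0 _ g_entire decay').
Qed.
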